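(* Let $\{X_{j,i},\ j\ge1,\ i\ge0\}$ be an array of standard stationary Gaussian processes such that for each fixed $j\ge1$, $(X_{j,i})_{i\ge0}$ has a spectral density $f_j$ and an autocorrelation function $\rho_j$ defined by $\rho_j(k)=\mathbb{E}(X_{j,0}X_{j,k})$ for all $k\ge0$. Assume also that there exists a non-increasing sequence $\{u_j\}_{j\ge1}$ such that for all $j\ge1$, $$\sup_{\lambda\in(-\pi,\pi)}|f_j(\lambda)-g_\infty(\lambda)|\le u_j,$$ where $g_\infty$ is a $2\pi$-periodic function which is bounded on $(-\pi,\pi)$ and continuous at the origin. Let $h$ be a function on $\mathbb{R}$ with Hermite rank $\tau\ge1$. Assume that $h$ is either bounded or is a finite linear combination of Hermite polynomials. Let $\{n_j\}_{j\ge1}$ be a sequence of integers such that $n_j$ tends to infinity as $j$ tends to infinity. Then $$\frac1{\sqrt{n_j}}\sum_{i=1}^{n_j}h(X_{j,i})\xrightarrow{d}\mathcal{N}(0,\tilde\sigma^2)\quad\text{as } j\to\infty,$$ where $$\tilde\sigma^2=\lim_{j\to\infty}\mathrm{Var}\Big(\frac1{\sqrt{n_j}}\sum_{i=1}^{n_j}h(X_{j,i})\Big)=\sum_{\ell\ge\tau}\frac{c_\ell^2}{\ell!}\,g_\infty^{\star\ell}(0),$$ with $c_\ell=\mathbb{E}[h(X)H_\ell(X)]$, where $H_\ell$ is the $\ell$-th Hermite polynomial and $X$ is a standard Gaussian random variable.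
   Context: ''Standard'' means each $X_{j,i}$ has mean $0$ and variance $1$. The spectral density $f_j$ is related to the autocorrelation by $\rho_j(k)=\int_{-\pi}^{\pi}e^{i\lambda k}f_j(\lambda)\,d\lambda$. $H_\ell$ are the probabilists' Hermite polynomials ($H_0=1$, $H_1(x)=x$, $H_2(x)=x^2-1$, ...). The Hermite rank of $h$ is the smallest integer $\ell\ge0$ with $\mathbb{E}[h(X)H_\ell(X)]\ne0$ (so rank $\ge1$ entails $\mathbb{E}h(X)=0$). $g^{\star\ell}$ is the $\ell$-th self-convolution of the $2\pi$-periodic function $g$: $g^{\star1}=g$, $g^{\star(\ell+1)}(\lambda)=\int_{-\pi}^{\pi}g^{\star\ell}(\lambda-\mu)g(\mu)\,d\mu$. $\xrightarrow{d}$ denotes convergence in distribution.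
   Formalization: The non-increasing sequence u_j is additionally assumed to tend to 0 (otherwise the variance need not converge), and the asymptotic variance carries a factor 2π: it equals 2π times the sum over ℓ≥τ of c_ℓ²/ℓ! · g_∞^{⋆ℓ}(0), as the stated Fourier convention requires. *)

(* Defs.v *)
From HB Require Import structures.
From mathcomp Require Import all_boot all_order all_algebra.
From mathcomp Require Import all_classical all_reals all_analysis.
Set Implicit Arguments.
Unset Strict Implicit.
Unset Printing Implicit Defensive.
Import Order.TTheory GRing.Theory Num.Theory.
Import numFieldNormedType.Exports.
Local Open Scope classical_set_scope.
Local Open Scope ring_scope.

(* Probabilists' normalisation: 1, X, X^2 - 1, X^3 - 3 X, ... *)
Fixpoint hermite (R : realType) (l : nat) : {poly R} :=
  if l is k.+1 then 'X * hermite R k - (hermite R k)^`() else 1.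

(* c_l = E[h(X) H_l(X)] for X standard Gaussian. *)
Definition hermite_coef (R : realType) (h : R -> R) (l : nat) : R :=
  \int[@normal_prob R 0 1]_x (h x * (hermite R l).[x]).

Definition hermite_rank (R : realType) (h : R -> R) (tau : nat) : Prop :=
  hermite_coef h tau != 0 /\ forall l, (l < tau)%N -> hermite_coef h l = 0.

(* The Gaussian law with mean m and *variance* v.  The library's normal_prob
   takes a standard deviation s and is a junk value (uniform law) at s = 0,
   whereas N(m, 0) has to be the point mass at m. *)
Definition normal_law (R : realType) (m v : R) :
    probability (measurableTypeR R) R :=
  if v == 0
  then (@dirac _ (measurableTypeR R) m R : probability (measurableTypeR R) R)
  else (normal_prob m (Num.sqrt v) : probability (measurableTypeR R) R).

Section processes.
Context d (T : measurableType d) (R : realType) (P : probability T R).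
Local Open Scope ereal_scope.

(* Every finite linear combination is Gaussian, possibly degenerate. *)
Definition gaussian_process (X : nat -> {RV P >-> R}) : Prop :=
  forall (N : nat) (a : nat -> R), exists m v : R, (0 <= v)%R /\
    forall A, measurable A ->
      pushforward P (fun w => \sum_(i < N) a i * X i w)%R A = normal_law m v A.

(* Second-order stationarity; for Gaussian processes this is the same as
   invariance of the finite-dimensional distributions under time shifts. *)
Definition stationary (X : nat -> {RV P >-> R}) : Prop :=
  (forall i, 'E_P[X i] = 'E_P[X 0%N]) /\
  (forall i k, covariance P (X i) (X (i + k)%N) = covariance P (X 0%N) (X k)).

Definition standard (X : nat -> {RV P >-> R}) : Prop :=
  forall i, 'E_P[X i] = 0 /\ 'V_P[X i] = 1.

Definition autocorrelation (X : nat -> {RV P >-> R}) (rho : nat -> R) : Prop :=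
  forall k, 'E_P[(X 0%N : T -> R) * (X k : T -> R)] = (rho k)%:E.

(* Convergence in distribution of Y j to the law nu. *)
Definition cvg_in_distribution (Y : nat -> T -> R)
    (nu : probability (measurableTypeR R) R) : Prop :=
  forall phi : R -> R, continuous phi ->
    (exists M : R, forall x, (`|phi x| <= M)%R) ->
    \int[P]_w (phi (Y j w))%:E @[j --> \oo] --> \int[nu]_x (phi x)%:E.

End processes.

(* f is a spectral density of a real process with autocorrelation rho:
   f is nonnegative and integrable on (-pi, pi), and
   rho k = int_(-pi)^pi e^(i x k) f x dx, an identity between complex numbers
   written here through its real and imaginary parts. *)
Definition spectral_density (R : realType) (rho : nat -> R) (f : R -> R) : Prop :=
  [/\ forall x, x \in `]-pi, pi[ -> 0 <= f x,
      lebesgue_measure.-integrable `]-pi, pi[ (EFin \o f) &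
      forall k : nat,
        \int[lebesgue_measure]_(x in `]-pi, pi[) (cos (x * k%:R) * f x) = rho k
        /\ \int[lebesgue_measure]_(x in `]-pi, pi[) (sin (x * k%:R) * f x) = 0].

(* selfconv g l is the l-fold convolution of g with itself for l >= 1
   (l = 0 is a dummy value).  The integral is not normalised by 2 pi, so for a
   spectral density f of rho, summing rho k ^+ l over all integers k gives
   2 pi times selfconv f l 0; this is where the factor 2 pi in the asymptotic
   variance comes from. *)
Definition selfconv (R : realType) (g : R -> R) (l : nat) : R -> R :=
  iter l.-1 (fun (u : R -> R) x =>
    \int[lebesgue_measure]_(y in `]-pi, pi[) (u (x - y) * g y)) g.

Definition normalized_sum (R : realType) (T : Type) (h : R -> R)
    (X : nat -> T -> R) (n : nat) : T -> R :=
  fun w => (Num.sqrt n%:R)^-1 * \sum_(1 <= i < n.+1) h (X i w).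

(* Main.v *)
Require Import Defs.
From HB Require Import structures.
From mathcomp Require Import all_boot all_order all_algebra.
From mathcomp Require Import all_classical all_reals all_analysis.
From mathcomp Require Import ring lra zify.
From mathcomp Require Import measurable_realfun.
From mathcomp Require mpoly.
Import (canonicals, coercions) mpoly.
Import Order.TTheory GRing.Theory Num.Theory.
Import numFieldNormedType.Exports.
Set Implicit Arguments.
Unset Strict Implicit.
Unset Printing Implicit Defensive.
Local Open Scope classical_set_scope.
Local Open Scope ring_scope.

(** The proof has three layers.

    Polynomials in a Gaussian vector.  All that is used of a centered Gaussian
    vector with covariance matrix [C] is the rule
    E(x_i p) = \sum_k C_ik E(dp/dx_k) for polynomials [p] in its entries
    ([gaussian_mean]).  Let F be the normalized sum of b(X_1), ..., b(X_n) for a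
    finite combination b of H_1, ..., H_L.  Lowering the degree of every
    Hermite polynomial by one through that rule gives E F^(r+2) = (r+1) E(F^r W)
    for a polynomial W of mean E F^2 ([mean_stein]).  When the quadratic form of
    [C] is bounded by a constant K, the Poincare inequality ([poincare]) bounds
    the moments of F uniformly and shows that the variance of W is O(1/n).
    Hence E F^(r+2) - (r+1) E F^2 E F^r tends to 0 ([stein_moment_recursion]):
    in the limit the moments of F satisfy the recursion of a normal law.

    Spectral densities.  The form of the Toeplitz matrix rho(|i-k|) is the
    integral of the squared modulus of a trigonometric polynomial against the
    spectral density ([Rintegral_trig_sqr]).  So bounded densities give bounded
    forms, and densities that are uniformly close give Toeplitz matrices close in
    operator norm.  By orthogonality of the Hermite polynomials, E F^2 is a
    combination of the means n^-1 \sum_(i,k) rho(|i-k|)^l.  Closeness in operator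
    norm lets rho_j be replaced in them by the Fourier coefficients r of the
    limit density g ([form_power_diff]).  Since r^l is the sequence of Fourier
    coefficients of the l-fold convolution of g, which is continuous for l >= 2
    ([convol_continuous]) and at 0 by hypothesis for l = 1, Fejer's theorem gives
    the limit 2 pi g^{* l}(0) ([selfconv_fejer], [power_mean_cvg]).

    From polynomials to [h], and from moments to laws.  Polynomials are dense in
    the L2 space of the standard Gaussian law for functions of the class
    considered ([bounded_or_hermite_dense]), so the Hermite partial sums h_L
    converge to [h] there ([hermite_part_cvg]).  The variance of the normalized
    sum of h - h_L is at most a constant times the tail of \sum_l c_l^2/l!,
    uniformly in j, because the means above are bounded ([power_mean_bounded]).
    Convergence of moments gives convergence of the means of cos(t x + s) by
    Taylor's formula ([cos_mean_cvg]); the uniform tail bound carries it over from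
    h_L to [h]; and every bounded continuous function is uniformly close, on a
    segment, to a combination of such cosines with the same bound
    ([trig_approximation]), which with bounded second moments gives convergence
    in distribution ([cvg_in_distribution_of_cos]). *)

(** * Polynomials in several variables *)

Local Notation "{ 'mpoly' T [ n ] }" := (mpoly.mpoly n T) : type_scope.
Local Notation "p .@[ v ]" := (mpoly.meval v p)
  (at level 1, left associativity, format "p .@[ v ]") : ring_scope.
Local Notation "p ^`M ( i )" := (mpoly.mderiv i p)
  (at level 8, format "p ^`M ( i )") : ring_scope.
Local Notation "''x_' i" := (@mpoly.mpolyX _ _ (mpoly.mnm1 i))
  (at level 8, i at level 2, format "''x_' i") : ring_scope.

Section lift.
Context {R : realType} {N : nat}.
Implicit Types (p q : {mpoly R[N]}) (u v : {poly R}) (i k : 'I_N).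

Definition at_var i u : {mpoly R[N]} := horner_alg 'x_i u.

HB.instance Definition _ i := GRing.LRMorphism.copy (at_var i) (horner_alg 'x_i).

Lemma at_varX i : at_var i 'X = 'x_i.
Proof. exact: horner_algX. Qed.

Lemma at_varC i c : at_var i c%:P = c *: 1.
Proof. by rewrite /at_var horner_algC. Qed.

Lemma mevalXn p m w : (p ^+ m).@[w] = p.@[w] ^+ m.
Proof. exact: rmorphXn. Qed.

Lemma meval_sum (I : Type) (r : seq I) (P : pred I) (F : I -> {mpoly R[N]}) w :
  (\sum_(i <- r | P i) F i).@[w] = \sum_(i <- r | P i) (F i).@[w].
Proof. exact: raddf_sum. Qed.

Lemma at_varM i u v : at_var i (u * v) = at_var i u * at_var i v.
Proof. exact: rmorphM. Qed.

Lemma at_varB i u v : at_var i (u - v) = at_var i u - at_var i v.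
Proof. exact: rmorphB. Qed.

Lemma at_varZ i c u : at_var i (c *: u) = c *: at_var i u.
Proof. by rewrite -mul_polyC at_varM at_varC -scalerAl mul1r. Qed.

Lemma at_varXn i u m : at_var i (u ^+ m) = at_var i u ^+ m.
Proof. exact: rmorphXn. Qed.

Lemma at_var1 i : at_var i 1 = 1.
Proof. exact: rmorph1. Qed.

Lemma at_var_sum i (I : Type) (r : seq I) (P : pred I) (F : I -> {poly R}) :
  at_var i (\sum_(j <- r | P j) F j) = \sum_(j <- r | P j) at_var i (F j).
Proof. exact: raddf_sum. Qed.

Lemma meval_at_var i u w : (at_var i u).@[w] = u.[w i].
Proof.
elim/poly_ind: u => [|u c IH]; first by rewrite !rmorph0 horner0.
rewrite !rmorphD !rmorphM /= at_varX at_varC mpoly.mevalXU.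
by rewrite mpoly.mevalZ rmorph1 mulr1 hornerMXaddC IH.
Qed.

Lemma mderivXU i k : ('x_i : {mpoly R[N]})^`M(k) = (i == k)%:R.
Proof.
rewrite mpoly.mderivX mpoly.mnm1E; case: eqP => [->|_]; last by rewrite scale0r.
rewrite scale1r -[RHS]mpoly.mpolyX0; congr mpoly.mpolyX.
by apply/mpoly.mnmP => j; rewrite mpoly.mnmBE subnn mpoly.mnm0E.
Qed.

Lemma mderiv1 k : (1 : {mpoly R[N]})^`M(k) = 0.
Proof. by rewrite -[1]/(mpoly.mpolyC _ 1) mpoly.mderivC. Qed.

Lemma mderiv_at_var i k u : (at_var i u)^`M(k) = (i == k)%:R *: at_var i u^`().
Proof.
elim/poly_ind: u => [|u c IH]; first by rewrite deriv0 !rmorph0 mpoly.mderiv0 scaler0.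
rewrite derivD derivM derivX derivC addr0 mulr1 !rmorphD !rmorphM /=.
rewrite at_varX at_varC mpoly.mderivD mpoly.mderivZ mderiv1 scaler0 addr0 mpoly.mderivM.
rewrite IH mderivXU scalerDr scalerAl; congr (_ + _).
by case: eqP => _; rewrite ?mulr1 ?mulr0 ?scale1r ?scale0r.
Qed.

Lemma mderiv_exp p k m : (p ^+ m.+1)^`M(k) = m.+1%:R *: (p ^+ m * p^`M(k)).
Proof.
elim: m => [|m IH]; first by rewrite expr0 mul1r scale1r.
rewrite exprS mpoly.mderivM IH -scalerAr mulrA -exprS [p^`M(k) * _]mulrC.
by rewrite -[X in X + _]scale1r -scalerDl addrC natr1.
Qed.

Lemma mderiv_sum (I : Type) (r : seq I) (P : pred I) (F : I -> {mpoly R[N]}) k :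
  (\sum_(i <- r | P i) F i)^`M(k) = \sum_(i <- r | P i) (F i)^`M(k).
Proof. exact: linear_sum. Qed.

End lift.

(** * Integrals and limits of real sequences *)

Lemma expr_le1D (R : realFieldType) (x : R) (m n : nat) :
  0 <= x -> (m <= n)%N -> x ^+ m <= 1 + x ^+ n.
Proof.
move=> x0 mn; have [x1|/ltW x1] := leP x 1.
  by apply: (le_trans (exprn_ile1 _ x0 x1)); rewrite lerDl exprn_ge0.
by apply: (le_trans (ler_weXn2l x1 mn)); rewrite lerDr.
Qed.

Section real_integrable.
Context d (T : measurableType d) (R : realType) (mu : {measure set T -> \bar R}).
Variables (D : set T) (mD : measurable D).
Implicit Types f g : T -> R.

Lemma le_integrableR f g : measurable_fun D f ->
  (forall x, D x -> `|f x| <= g x) ->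
  mu.-integrable D (EFin \o g) -> mu.-integrable D (EFin \o f).
Proof.
move=> mf fg ig; apply: (le_integrable mD _ _ ig).
  exact/measurable_EFinP.
by move=> x Dx; rewrite lee_fin (le_trans (fg x Dx)) // ler_norm.
Qed.

Lemma integrableZlR (c : R) f : mu.-integrable D (EFin \o f) ->
  mu.-integrable D (EFin \o (fun x => c * f x)).
Proof. exact: integrableZl. Qed.

Lemma integrableDR f g : mu.-integrable D (EFin \o f) ->
  mu.-integrable D (EFin \o g) -> mu.-integrable D (EFin \o (fun x => f x + g x)).
Proof. exact: integrableD. Qed.

Lemma integrableBR f g : mu.-integrable D (EFin \o f) ->
  mu.-integrable D (EFin \o g) -> mu.-integrable D (EFin \o (fun x => f x - g x)).
Proof. exact: integrableB. Qed.

Lemma integrable_sumR (I : Type) (r : seq I) (F : I -> T -> R) :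
  (forall i, mu.-integrable D (EFin \o F i)) ->
  mu.-integrable D (EFin \o (fun x => \sum_(i <- r) F i x)).
Proof.
move=> iF; elim: r => [|i r IH].
  apply: (@eq_integrable _ _ _ mu D mD (cst 0%E)); last exact: integrable0.
  by move=> x _; rewrite /= big_nil.
apply: (@eq_integrable _ _ _ mu D mD (EFin \o (fun x => F i x + \sum_(j <- r) F j x))).
  by move=> x _; rewrite /= big_cons.
exact: integrableDR.
Qed.

Lemma Rintegral_sum (I : Type) (r : seq I) (F : I -> T -> R) :
  (forall i, mu.-integrable D (EFin \o F i)) ->
  \int[mu]_(x in D) (\sum_(i <- r) F i x) = \sum_(i <- r) \int[mu]_(x in D) F i x.
Proof.
move=> iF; elim: r => [|i r IH].
  rewrite big_nil; under eq_Rintegral do rewrite big_nil.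
  by rewrite Rintegral_cst // mul0r.
under eq_Rintegral do rewrite big_cons.
by rewrite big_cons RintegralD ?IH //; exact: integrable_sumR.
Qed.

Lemma measurable_integrableR f : mu.-integrable D (EFin \o f) -> measurable_fun D f.
Proof. by move=> /(measurable_int mu)/measurable_EFinP. Qed.

Lemma dominated_cvgR (f_ : nat -> T -> R) f g :
  (forall n, measurable_fun D (f_ n)) -> measurable_fun D f ->
  (forall x, D x -> f_ n x @[n --> \oo] --> f x) ->
  mu.-integrable D (EFin \o g) ->
  (forall n x, D x -> `|f_ n x| <= g x) ->
  \int[mu]_(x in D) f_ n x @[n --> \oo] --> \int[mu]_(x in D) f x.
Proof.
move=> mf_ mf cf ig fg.
have cfE : forall x, D x -> (fun n => (f_ n x)%:E) n @[n --> \oo] --> (f x)%:E.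
  by move=> x Dx; apply: cvg_EFin; [near=> n|exact: cf].
have [iF _ cv] := @dominated_convergence _ _ _ mu D mD
  (fun n x => (f_ n x)%:E) (EFin \o f) (EFin \o g)
  (fun n => (proj2 (measurable_EFinP _ _)) (mf_ n))
  ((proj2 (measurable_EFinP _ _)) mf) (aeW _ cfE) ig
  (aeW _ (fun x n Dx => fg n x Dx)).
apply: fine_cvg; rewrite fineK; last exact: integrable_fin_num.
exact: cv.
Unshelve. all: by end_near. Qed.

End real_integrable.

Lemma Rintegral_prob_cst d (T : measurableType d) (R : realType)
  (P : probability T R) (c : R) : \int[P]_x c = c.
Proof.
rewrite Rintegral_cst //; have := @probability_setT _ _ _ P => /= ->.
by rewrite mulr1.
Qed.

Section real_sequences.
Context {R : realType}.
Implicit Types (a b : nat -> R) (l c : R).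

Lemma cvg_sub0 a b l : (fun n => a n - b n) @ \oo --> (0 : R) -> b @ \oo --> l -> a @ \oo --> l.
Proof.
move=> h hb; have -> : a = (fun n => a n - b n) \+ b by apply/funext => n /=; rewrite subrK.
by rewrite -[l]add0r; exact: cvgD.
Qed.

Lemma cvg_scale c a l : a @ \oo --> l -> (fun n => c * a n) @ \oo --> c * l.
Proof. by move=> ha; apply: cvgM => //; exact: cvg_cst. Qed.

Lemma cvg_scale0 c a : a @ \oo --> (0 : R) -> (fun n => c * a n) @ \oo --> (0 : R).
Proof. by move=> /(@cvg_scale c); rewrite mulr0. Qed.

Lemma cvg_abs0_near a b : (\forall n \near \oo, `|a n| <= b n) -> b @ \oo --> (0 : R) ->
  a @ \oo --> (0 : R).
Proof.
move=> ab b0; apply/norm_cvg0P.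
apply: (@squeeze_cvgr _ _ _ _ (fun=> 0) b) => //; last exact: cvg_cst.
by near=> n; rewrite normr_ge0 /=; near: n.
Unshelve. all: by end_near. Qed.

Lemma cvg_le_near a l c : (\forall n \near \oo, a n <= c) -> a @ \oo --> l -> l <= c.
Proof. by move=> ac al; exact: (ler_cvg_to al (cvg_cst c) ac). Qed.

Lemma cvg_add0 a b : a @ \oo --> (0 : R) -> b @ \oo --> (0 : R) ->
  (fun n => a n + b n) @ \oo --> (0 : R).
Proof. by move=> ha hb; rewrite -[X in _ --> X](addr0 (0 : R)); exact: cvgD. Qed.

Lemma cvg_sumR (I : Type) (r : seq I) (F : I -> nat -> R) (G : I -> R) :
  (forall i, F i @ \oo --> G i) ->
  (fun n => \sum_(i <- r) F i n) @ \oo --> \sum_(i <- r) G i.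
Proof.
move=> FG; elim: r => [|i r IH].
  rewrite big_nil (_ : (fun n => _) = fun=> 0); first exact: cvg_cst.
  by apply/funext => n; rewrite big_nil.
rewrite big_cons (_ : (fun n => _) = F i \+ (fun n => \sum_(j <- r) F j n)).
  by apply: cvgD; [exact: FG|exact: IH].
by apply/funext => n; rewrite big_cons.
Qed.

Lemma cvg_dist0 a l : a @ \oo --> l -> (fun n => `|l - a n|) @ \oo --> (0 : R).
Proof.
move=> al; rewrite -[X in _ --> X](@normr0 _ R) -[X in `|X|](subrr l).
by apply: cvg_norm; apply: cvgB => //; exact: cvg_cst.
Qed.

End real_sequences.

(** * Gaussian integration by parts and the Poincare inequality *)

Fixpoint gauss_moment (R : realType) (m : nat) : R :=
  match m with
  | 0 => 1
  | 1 => 0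
  | k.+2 => k.+1%:R * gauss_moment R k
  end.

(** The mean of [u] under the standard normal law, defined from the moments so
    that it makes sense without integration. *)
Definition gauss_mean (R : realType) (u : {poly R}) : R :=
  \sum_(i < size u) u`_i * gauss_moment R i.

(** The expectation of polynomials in a centered Gaussian vector with
    covariance matrix [C] and unit variances.  The integration by parts rule
    determines all moments, so that it can serve as the definition of
    Gaussianity; it makes sense for singular [C] as well. *)
Record gaussian_mean (R : realType) (N : nat) (C : 'I_N -> 'I_N -> R)
    (E : {scalar {mpoly R[N]}}) : Prop := GaussianMean {
  gmean1 : E 1 = 1;
  gmean_ge0 : forall p, (forall v, 0 <= p.@[v]) -> 0 <= E p;
  gmean_ibp : forall i p, E ('x_i * p) = \sum_k C i k * E (p^`M(k));
  gmean_var : forall i, C i i = 1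
}.

Arguments hermite : simpl never.

Section hermite_poly.
Context {R : realType}.
Implicit Type l : nat.

Lemma hermite0 : hermite R 0 = 1.
Proof. by []. Qed.

Lemma hermiteS l : hermite R l.+1 = 'X * hermite R l - (hermite R l)^`().
Proof. by []. Qed.

Lemma deriv_hermite l : (hermite R l.+1)^`() = l.+1%:R *: hermite R l.
Proof.
elim: l => [|l IH].
  by rewrite /hermite derivB derivM !derivX -[1]/(1%:P) !derivC mulr0 subr0 mulr1 addr0 scale1r.
rewrite hermiteS derivB derivM derivX mul1r IH derivZ -scalerAr.
have -> : (hermite R l)^`() = 'X * hermite R l - hermite R l.+1.
  by rewrite hermiteS opprB addrC subrK.
by rewrite scalerBr opprB addrCA addrC addrK -[l.+2%:R]natr1 scalerDl scale1r addrC.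
Qed.

End hermite_poly.

Section gaussian_mean_theory.
Context {R : realType} {N : nat} {C : 'I_N -> 'I_N -> R}.
Context {E : {scalar {mpoly R[N]}}}.
Hypothesis GE : gaussian_mean C E.
Implicit Types (p q : {mpoly R[N]}) (u v : {poly R}) (i k : 'I_N).

Lemma meanZ c p : E (c *: p) = c * E p.
Proof. exact: linearZ. Qed.

Lemma meanD p q : E (p + q) = E p + E q.
Proof. exact: linearD. Qed.

Lemma meanB p q : E (p - q) = E p - E q.
Proof. exact: linearB. Qed.

Lemma mean_sum (I : Type) (r : seq I) (P : pred I) (F : I -> {mpoly R[N]}) :
  E (\sum_(i <- r | P i) F i) = \sum_(i <- r | P i) E (F i).
Proof. exact: linear_sum. Qed.

Lemma mean_cst c : E (c *: 1) = c.
Proof. by rewrite meanZ (gmean1 GE) mulr1. Qed.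

Lemma mean_mul_center p q c : E (p * (q - c *: 1)) = E (p * q) - c * E p.
Proof. by rewrite mulrBr meanB -[p * (c *: 1)]scalerAr mulr1 meanZ. Qed.

Lemma mean_center_sqr p : E ((p - E p *: 1) ^+ 2) = E (p ^+ 2) - E p ^+ 2.
Proof.
rewrite expr2 mean_mul_center mulrC mean_mul_center meanB mean_cst subrr mulr0 subr0.
by rewrite -!expr2.
Qed.

Lemma mean_le p q : (forall w, p.@[w] <= q.@[w]) -> E p <= E q.
Proof.
move=> pq; rewrite -subr_ge0 -linearB; apply: (gmean_ge0 GE) => w.
by rewrite mpoly.mevalB subr_ge0.
Qed.

Lemma mean_sqr_ge0 p : 0 <= E (p ^+ 2).
Proof. by apply: (gmean_ge0 GE) => w; rewrite rmorphXn sqr_ge0. Qed.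

(** Integration by parts in one variable, the factor [p] being carried along;
    the unit variance removes the covariance from the first term. *)
Lemma mean_ibp1 i u p : E (at_var i ('X * u) * p) =
  E (at_var i u^`() * p) + \sum_k C i k * E (at_var i u * p^`M(k)).
Proof.
rewrite at_varM at_varX -mulrA (gmean_ibp GE).
under eq_bigr do rewrite mpoly.mderivM linearD mulrDr mderiv_at_var.
rewrite big_split /=; congr (_ + _).
rewrite (bigD1 i) //= eqxx scale1r (gmean_var GE) mul1r big1 ?addr0 // => k ki.
by rewrite eq_sym (negPf ki) scale0r mul0r linear0 mulr0.
Qed.

Lemma mean_at_varX i m : E (at_var i 'X^m) = gauss_moment R m.
Proof.
suff: E (at_var i 'X^m) = gauss_moment R m /\
      E (at_var i 'X^(m.+1)) = gauss_moment R m.+1 by case.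
elim: m => [|m [IH1 IH2]]; split => //.
- by rewrite expr0 at_var1 (gmean1 GE).
- rewrite expr1 at_varX -[X in E X]mulr1 (gmean_ibp GE) big1 // => k _.
  by rewrite mderiv1 linear0 mulr0.
- rewrite exprS -[X in E X]mulr1 mean_ibp1 derivXn mulr1 big1 => [|k _]; last first.
    by rewrite mderiv1 mulr0 linear0 mulr0.
  by rewrite addr0 -scaler_nat at_varZ meanZ IH1.
Qed.

Lemma mean_at_var i u : E (at_var i u) = gauss_mean u.
Proof.
rewrite [in LHS](_ : u = \sum_(l < size u) u`_l *: 'X^l).
  rewrite at_var_sum linear_sum; apply: eq_bigr => l _.
  by rewrite at_varZ meanZ mean_at_varX.
by rewrite -poly_def coefK.
Qed.

(** The recursion H_(l+1) = x H_l - H_l' cancels the first term of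
    [mean_ibp1]: multiplying by a Hermite polynomial differentiates the other
    factor. *)
Lemma mean_hermite i l p : E (at_var i (hermite R l.+1) * p) =
  \sum_k C i k * E (at_var i (hermite R l) * p^`M(k)).
Proof.
rewrite hermiteS at_varB mulrBl linearB /= mean_ibp1.
by rewrite addrC addrA addNr add0r.
Qed.

Lemma mean_hermite1 i l : E (at_var i (hermite R l.+1)) = 0.
Proof.
rewrite -[at_var _ _]mulr1 mean_hermite big1 // => k _.
by rewrite mderiv1 mulr0 linear0 mulr0.
Qed.

Lemma mean_hermite2 i k l m :
  E (at_var i (hermite R l) * at_var k (hermite R m)) =
  (l == m)%:R * (l`!%:R * C i k ^+ l).
Proof.
elim: l m => [|l IH] [|m].
- by rewrite hermite0 !at_var1 mulr1 (gmean1 GE) expr0 !mulr1.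
- by rewrite hermite0 at_var1 mul1r mean_hermite1 mul0r.
- by rewrite hermite0 at_var1 mulr1 mean_hermite1 mul0r.
rewrite mean_hermite (bigD1 k) //= big1 ?addr0 => [|j jk]; last first.
  by rewrite mderiv_at_var eq_sym (negPf jk) scale0r mulr0 linear0 mulr0.
rewrite mderiv_at_var eqxx scale1r deriv_hermite at_varZ -scalerAr meanZ IH.
rewrite eqSS; case: eqP => [->|]; last by rewrite !mul0r !mulr0.
by rewrite factS natrM exprS !mul1r; ring.
Qed.

Lemma gmean_cov i k : E ('x_i * 'x_k) = C i k.
Proof.
rewrite (gmean_ibp GE) (bigD1 k) //= big1 => [|j jk].
  by rewrite mderivXU eqxx (gmean1 GE) mulr1 addr0.
by rewrite mderivXU eq_sym (negPf jk) linear0 mulr0.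
Qed.

Lemma gmean_covC i k : C i k = C k i.
Proof. by rewrite -!gmean_cov mulrC. Qed.

(** The creation operator of the variable [i]: it is adjoint to [wick_der] for
    the scalar product E(p q), see [mean_wick_mul]. *)
Definition wick_mul i p := 'x_i * p - \sum_k C i k *: p^`M(k).
Definition wick_der i p := \sum_k C i k *: p^`M(k).

Lemma wick_derM i p q : wick_der i (p * q) = wick_der i p * q + p * wick_der i q.
Proof.
rewrite /wick_der mulr_suml mulr_sumr -big_split; apply: eq_bigr => k _ /=.
by rewrite mpoly.mderivM scalerDr scalerAl scalerAr.
Qed.

Lemma mean_wick_mul i p q : E (q * wick_mul i p) = E (p * wick_der i q).
Proof.
have ibp r : E ('x_i * r) = E (wick_der i r).
  by rewrite (gmean_ibp GE) linear_sum; apply: eq_bigr => k _; rewrite meanZ.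
rewrite /wick_mul mulrBr linearB /= mulrCA ibp wick_derM linearD /=.
by rewrite addrK mulrC.
Qed.

Lemma wick_mulD i : {morph wick_mul i : p q / p + q}.
Proof.
move=> p q; rewrite /wick_mul mulrDr.
under eq_bigr do rewrite linearD scalerDr.
by rewrite big_split /= opprD addrACA.
Qed.

Lemma wick_mulZ i c p : wick_mul i (c *: p) = c *: wick_mul i p.
Proof.
rewrite /wick_mul -scalerAr scalerBr scaler_sumr; congr (_ - _).
by apply: eq_bigr => k _; rewrite linearZ !scalerA mulrC.
Qed.

Lemma wick_mul0 i : wick_mul i 0 = 0.
Proof. by rewrite -[in LHS](scale0r 0) wick_mulZ scale0r. Qed.

Lemma wick_mul_sum i (I : Type) (r : seq I) F :
  wick_mul i (\sum_(j <- r) F j) = \sum_(j <- r) wick_mul i (F j).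
Proof.
by apply: (big_morph (wick_mul i) (@wick_mulD i) (wick_mul0 i)).
Qed.

Lemma wick_der_deriv i k p : (wick_der i p)^`M(k) = wick_der i p^`M(k).
Proof.
rewrite /wick_der linear_sum; apply: eq_bigr => j _.
by rewrite linearZ /= mpoly.mderiv_comm.
Qed.

(** The canonical commutation relation. *)
Lemma mderiv_wick_mul i k p :
  (wick_mul i p)^`M(k) = (i == k)%:R * p + wick_mul i p^`M(k).
Proof.
rewrite /wick_mul linearB /= -/(wick_der i p) wick_der_deriv mpoly.mderivM mderivXU.
by rewrite addrA.
Qed.

Lemma wick_mulC i k p : wick_mul i (wick_mul k p) = wick_mul k (wick_mul i p).
Proof.
have D j l : wick_der j ('x_l * p) = C j l *: p + 'x_l * wick_der j p.
  rewrite wick_derM; congr (_ + _); rewrite /wick_der mulr_suml (bigD1 l) //=.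
  rewrite mderivXU eqxx -scalerAl mul1r big1 ?addr0 // => m ml.
  by rewrite mderivXU eq_sym (negPf ml) scaler0 mul0r.
have DB j r s : wick_der j (r - s) = wick_der j r - wick_der j s.
  by rewrite /wick_der -sumrB; apply: eq_bigr => m _; rewrite linearB scalerBr.
have DD j l : wick_der j (wick_der l p) = wick_der l (wick_der j p).
  rewrite [LHS]/wick_der; under eq_bigr do rewrite wick_der_deriv.
  rewrite [RHS]/wick_der; under [in RHS]eq_bigr do rewrite wick_der_deriv.
  rewrite /wick_der; under eq_bigr do rewrite scaler_sumr.
  rewrite exchange_big /=; apply: eq_bigr => m _; rewrite scaler_sumr.
  by apply: eq_bigr => m' _; rewrite mpoly.mderiv_comm !scalerA mulrC.
rewrite /wick_mul -!/(wick_der _ _) !DB !D DD gmean_covC; ring.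
Qed.

(** The Ornstein-Uhlenbeck operator; it multiplies the [m]-th chaos by [m]. *)
Definition number_op p := \sum_k wick_mul k p^`M(k).

Lemma number_op_wick_mul i p :
  number_op (wick_mul i p) = wick_mul i p + wick_mul i (number_op p).
Proof.
rewrite /number_op wick_mul_sum.
under eq_bigr do rewrite mderiv_wick_mul wick_mulD wick_mulC.
rewrite big_split /=; congr (_ + _); rewrite (bigD1 i) //= eqxx mul1r.
by rewrite big1 ?addr0 // => k ki; rewrite eq_sym (negPf ki) mul0r wick_mul0.
Qed.

(** The Dirichlet form of the Ornstein-Uhlenbeck operator. *)
Lemma mean_number_op p q :
  E (q * number_op p) = \sum_k \sum_l C k l * E (p^`M(k) * q^`M(l)).
Proof.
rewrite /number_op mulr_sumr linear_sum; apply: eq_bigr => k _ /=.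
rewrite mean_wick_mul /wick_der mulr_sumr linear_sum; apply: eq_bigr => l _.
by rewrite -scalerAr meanZ.
Qed.

Lemma mean_number_opC p q : E (q * number_op p) = E (p * number_op q).
Proof.
rewrite !mean_number_op exchange_big; apply: eq_bigr => k _; apply: eq_bigr => l _ /=.
by rewrite gmean_covC [_ * q^`M(_)]mulrC.
Qed.

(** [wick m]: the [m]-th Wiener chaos, spanned by [m]-fold creations applied to
    constants. *)
Inductive wick : nat -> {mpoly R[N]} -> Prop :=
| wick_cst c : wick 0 (c *: 1)
| wickS m i p : wick m p -> wick m.+1 (wick_mul i p)
| wick0 m : wick m 0
| wickD m p q : wick m p -> wick m q -> wick m (p + q)
| wickZ m c p : wick m p -> wick m (c *: p).

Lemma number_opD : {morph number_op : p q / p + q}.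
Proof.
move=> p q; rewrite /number_op -big_split; apply: eq_bigr => k _ /=.
by rewrite mpoly.mderivD wick_mulD.
Qed.

Lemma number_opZ c p : number_op (c *: p) = c *: number_op p.
Proof.
rewrite /number_op scaler_sumr; apply: eq_bigr => k _ /=.
by rewrite mpoly.mderivZ wick_mulZ.
Qed.

Lemma number_op_wick m p : wick m p -> number_op p = m%:R *: p.
Proof.
elim=> {m p}.
- move=> c; rewrite scale0r /number_op big1 // => k _.
  by rewrite mpoly.mderivZ mderiv1 scaler0 wick_mul0.
- move=> m i p _ IH; rewrite number_op_wick_mul IH wick_mulZ.
  by rewrite -natr1 scalerDl scale1r addrC.
- move=> m; rewrite /number_op big1 ?scaler0 // => k _.
  by rewrite mpoly.mderiv0 wick_mul0.
- by move=> m p q _ IHp _ IHq; rewrite number_opD IHp IHq scalerDr.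
- by move=> m c p _ IH; rewrite number_opZ IH !scalerA mulrC.
Qed.

Lemma mderiv_wick m p k : wick m p -> wick m.-1 p^`M(k) /\ (m = 0%N -> p^`M(k) = 0).
Proof.
elim=> {m p}.
- by move=> c; rewrite mpoly.mderivZ mderiv1 scaler0; split => //; exact: wick0.
- move=> m i p wp [IH1 IH2]; split => //=; rewrite mderiv_wick_mul.
  apply: wickD.
    by case: (i == k); rewrite ?mul1r ?mul0r //; exact: wick0.
  case: m => [|m] /= in wp IH1 IH2 *; last exact: wickS.
  by rewrite IH2 // wick_mul0; exact: wick0.
- by move=> m; rewrite mpoly.mderiv0; split => //; exact: wick0.
- move=> m p q _ [IH1 IH2] _ [IH3 IH4]; split; first by rewrite mpoly.mderivD; exact: wickD.
  by move=> m0; rewrite mpoly.mderivD IH2 // IH4 // addr0.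
- move=> m c p _ [IH1 IH2]; split; first by rewrite mpoly.mderivZ; exact: wickZ.
  by move=> m0; rewrite mpoly.mderivZ IH2 // scaler0.
Qed.

(** Chaos decompositions.  They are found for all polynomials ([all_chaotic])
    because multiplying by a variable is creating plus annihilating. *)
Definition chaotic p := exists d (c : nat -> {mpoly R[N]}),
  (forall m, wick m (c m)) /\ p = \sum_(m < d) c m.

Lemma wick_chaotic m p : wick m p -> chaotic p.
Proof.
move=> wp; exists m.+1, (fun k : nat => if k == m then p else 0); split.
  by move=> k; case: eqP => [->|_] //; exact: wick0.
rewrite big_ord_recr /= eqxx big1 ?add0r // => k _.
by rewrite ltn_eqF.
Qed.

Lemma chaoticD p q : chaotic p -> chaotic q -> chaotic (p + q).
Proof.
move=> [d [c [wc ->]]] [d' [c' [wc' ->]]].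
exists (maxn d d'), (fun m => (if (m < d)%N then c m else 0) + if (m < d')%N then c' m else 0).
split; first by move=> m; apply: wickD; case: ifP => // _; exact: wick0.
rewrite big_split /=; congr (_ + _).
  by rewrite (big_ord_widen _ _ (leq_maxl d d')) big_mkcond.
by rewrite (big_ord_widen _ _ (leq_maxr d d')) big_mkcond.
Qed.

Lemma chaotic_sum (I : Type) (r : seq I) F :
  (forall j, chaotic (F j)) -> chaotic (\sum_(j <- r) F j).
Proof.
move=> cF; elim/big_ind: _ => //; last exact: chaoticD.
exact: wick_chaotic (wick0 0).
Qed.

Lemma chaoticZ c p : chaotic p -> chaotic (c *: p).
Proof.
move=> [d [f [wf ->]]]; exists d, (fun m => c *: f m); split; last by rewrite scaler_sumr.
by move=> m; exact: wickZ.
Qed.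

Lemma chaotic_mulX i p : chaotic p -> chaotic ('x_i * p).
Proof.
move=> [d [c [wc ->]]]; rewrite mulr_sumr; apply: chaotic_sum => m.
rewrite -[X in chaotic X](subrK (wick_der i (c m))); apply: chaoticD.
  exact: wick_chaotic (wickS i (wc m)).
apply: chaotic_sum => k; apply: chaoticZ.
exact: (wick_chaotic (proj1 (mderiv_wick k (wc m)))).
Qed.

Lemma all_chaotic p : chaotic p.
Proof.
elim/mpoly.mpolyind: p => [|c m p _ _ cp]; first exact: wick_chaotic (wick0 0).
apply: chaoticD => //; apply: chaoticZ; rewrite mpoly.mpolyXE_id.
have c1 : chaotic 1 by rewrite -(scale1r 1); exact: wick_chaotic (wick_cst 1).
elim/big_rec: _ => [//|i q _ cq].
elim: (m i) => [|e IH]; first by rewrite expr0 mul1r.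
by rewrite exprS -mulrA; exact: chaotic_mulX.
Qed.

(** On the chaos decomposition of [p] the left side is the sum of the mean
    squares of the components of order [m >= 1], and the right side, which is the
    Dirichlet form, is the same sum with weights [m]. *)
Lemma poincare p :
  E (p ^+ 2) - E p ^+ 2 <= \sum_k \sum_l C k l * E (p^`M(k) * p^`M(l)).
Proof.
have [d [c [wc ->]]] := all_chaotic p.
rewrite -mean_number_op.
(* a symmetric operator has orthogonal eigenspaces *)
have ort m m' : m != m' -> E (c m * c m') = 0.
  move=> mm'; apply/eqP; have := mean_number_opC (c m) (c m').
  rewrite !(number_op_wick (wc _)) -!scalerAr !meanZ [c m' * _]mulrC => /eqP.
  by rewrite -subr_eq0 -mulrBl mulf_eq0 subr_eq0 eqr_nat (negPf mm').
have Ec m : m != 0%N -> E (c m) = 0.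
  move=> m0; have := mean_number_op (c m) 1; rewrite (number_op_wick (wc _)) mul1r meanZ.
  rewrite big1; last first.
    by move=> k _; rewrite big1 // => l _; rewrite mderiv1 mulr0 linear0 mulr0.
  by move/eqP; rewrite mulf_eq0 pnatr_eq0 (negPf m0) => /eqP.
have diag (a : nat -> R) : E ((\sum_(m < d) c m) * \sum_(m < d) a m *: c m) =
    \sum_(m < d) a m * E (c m ^+ 2).
  rewrite mulr_suml linear_sum; apply: eq_bigr => m _ /=.
  rewrite mulr_sumr linear_sum (bigD1 m) //= -scalerAr meanZ expr2.
  rewrite big1 ?addr0 // => k km; rewrite -scalerAr meanZ ort ?mulr0 //.
  by rewrite eq_sym.
have -> : (\sum_(m < d) c m) * number_op (\sum_(m < d) c m) =
    (\sum_(m < d) c m) * \sum_(m < d) m%:R *: c m.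
  congr (_ * _).
  have n0 : number_op 0 = 0 by rewrite -[in LHS](scale0r 0) number_opZ scale0r.
  rewrite (big_morph number_op number_opD n0); apply: eq_bigr => m _.
  exact: number_op_wick.
rewrite diag [X in E X](_ : _ = (\sum_(m < d) c m) * \sum_(m < d) 1 *: c m); last first.
  by rewrite expr2; congr (_ * _); apply: eq_bigr => m _; rewrite scale1r.
rewrite (diag (fun=> 1)) {diag}; case: d => [|d]; first by rewrite !big_ord0 linear0 expr0n subrr.
rewrite !big_ord_recl /= linearD linear_sum /= mul0r add0r mul1r.
rewrite [X in (_ + X) ^+ 2]big1 ?addr0 => [|m _]; last by rewrite Ec.
have w0 : E (c 0%N ^+ 2) = E (c 0%N) ^+ 2.
  suff [b ->] : exists b, c 0%N = b *: 1.
    by rewrite exprZn expr1n !mean_cst.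
  have := wc 0%N; move: (c 0%N) => q; move e: 0%N => z wq.
  elim: wq e => // {z q}; first by move=> b _; exists b.
  - by move=> m _; exists 0; rewrite scale0r.
  - by move=> m p1 q1 _ IH1 _ IH2 e; have [b ->] := IH1 e; have [b' ->] := IH2 e;
      exists (b + b'); rewrite scalerDl.
  - by move=> m a p1 _ IH e; have [b ->] := IH e; exists (a * b); rewrite scalerA.
rewrite w0 addrC addKr; apply: ler_sum => m _; rewrite mul1r ler_peMl ?mean_sqr_ge0 //.
by rewrite ler1n.
Qed.

End gaussian_mean_theory.

(** * Quadratic forms, and moments of linear statistics *)

(** Young's inequality with exponents (m+1)/m and m+1, with a poor constant that
    avoids roots. *)
Lemma young_expr (R : realFieldType) (x y e : R) (m : nat) :
  0 <= x -> 0 <= y -> 0 < e ->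
  x ^+ m * y <= e * x ^+ m.+1 + e^-1 ^+ m * y ^+ m.+1.
Proof.
move=> x0 y0 e0; have ei : 0 < e^-1 by rewrite invr_gt0.
have [yx|/ltW yx] := leP y (e * x).
  apply: (@le_trans _ _ (e * x ^+ m.+1)); last first.
    by rewrite lerDl mulr_ge0 ?exprn_ge0 // ltW.
  by rewrite exprSr mulrCA ler_wpM2l // exprn_ge0.
apply: (@le_trans _ _ (e^-1 ^+ m * y ^+ m.+1)); last first.
  by rewrite lerDr mulr_ge0 ?exprn_ge0 // ltW.
rewrite exprSr mulrA -exprMn ler_wpM2r // lerXn2r ?nnegrE //.
  by rewrite mulr_ge0 // ltW.
by rewrite mulrC ler_pdivlMr // mulrC.
Qed.

(** One-sided bound of the quadratic form; enough for a covariance matrix, whose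
    form is nonnegative. *)
Definition form_bounded (R : realType) (N : nat) (C : 'I_N -> 'I_N -> R) (K : R) :=
  forall v : 'I_N -> R, \sum_k \sum_l C k l * (v k * v l) <= K * \sum_k v k ^+ 2.

Definition lin_stat (R : realType) (N : nat) (a : 'I_N -> R) (b : {poly R}) : {mpoly R[N]} :=
  \sum_k a k *: at_var k b.

Definition form_norm_bounded (R : realType) (N : nat) (C : 'I_N -> 'I_N -> R) (K : R) :=
  forall v : 'I_N -> R, `|\sum_k \sum_l C k l * (v k * v l)| <= K * \sum_k v k ^+ 2.

Section symmetric_form.
Context {R : realType} {N : nat} {C : 'I_N -> 'I_N -> R} {K : R}.
Hypothesis Csym : forall k l, C k l = C l k.
Hypothesis CK : form_norm_bounded C K.
Hypothesis K0 : 0 < K.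

(** For a symmetric matrix the bound of the quadratic form is a bound of the
    operator norm, by polarization between [v] and [C v / K]. *)
Lemma sym_form_sqr_norm (v : 'I_N -> R) :
  \sum_k (\sum_l C k l * v l) ^+ 2 <= K ^+ 2 * \sum_k v k ^+ 2.
Proof.
pose y k := \sum_l C k l * v l.
pose x k := K^-1 * y k.
have xv : \sum_k \sum_l C k l * (x k * v l) = K^-1 * \sum_k y k ^+ 2.
  rewrite mulr_sumr; apply: eq_bigr => k _.
  rewrite expr2 /x mulrA [X in _ = _ * X]/y mulr_sumr; apply: eq_bigr => l _; ring.
have xx : \sum_k x k ^+ 2 = K^-1 ^+ 2 * \sum_k y k ^+ 2.
  by rewrite mulr_sumr; apply: eq_bigr => k _; rewrite exprMn.
have pol : \sum_k \sum_l C k l * ((x k + v k) * (x l + v l)) -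
    \sum_k \sum_l C k l * ((x k - v k) * (x l - v l)) =
    4 * (\sum_k \sum_l C k l * (x k * v l)).
  have -> : 4 * (\sum_k \sum_l C k l * (x k * v l)) =
     2 * \sum_k \sum_l C k l * (x k * v l) + 2 * \sum_k \sum_l C k l * (v k * x l).
    have -> : \sum_k \sum_l C k l * (v k * x l) = \sum_k \sum_l C k l * (x k * v l).
      rewrite exchange_big; apply: eq_bigr => k _; apply: eq_bigr => l _ /=.
      by rewrite (Csym l k); ring.
    ring.
  rewrite !mulr_sumr -sumrB -big_split; apply: eq_bigr => k _ /=.
  rewrite !mulr_sumr -sumrB -big_split; apply: eq_bigr => l _ /=; ring.
have par : \sum_k (x k + v k) ^+ 2 + \sum_k (x k - v k) ^+ 2 =
    2 * (\sum_k x k ^+ 2 + \sum_k v k ^+ 2).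
  rewrite -!big_split mulr_sumr; apply: eq_bigr => k _ /=; ring.
have := CK (fun k => x k + v k); have := CK (fun k => x k - v k).
rewrite !ler_norml => /andP[h1 _] /andP[_ h2].
move: pol par xx h1 h2; rewrite xv.
set P := \sum_k \sum_l _; set Q := \sum_k \sum_l _.
set a := \sum_k (x k + v k) ^+ 2; set b := \sum_k (x k - v k) ^+ 2.
set X := \sum_k x k ^+ 2; set V := \sum_k v k ^+ 2; rewrite -/y; set Y := \sum_k y k ^+ 2.
move=> pol par xx h1 h2.
have h : 4 * (K^-1 * Y) <= K * (2 * (X + V)).
  by rewrite -pol -par mulrDr; lra.
have e : K * X = K^-1 * Y by rewrite xx; field; rewrite gt_eqF.
have {}h : K^-1 * Y <= K * V.
  have ex : K * (2 * (X + V)) = 2 * (K * X) + 2 * (K * V) by ring.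
  by move: h; rewrite ex e; lra.
move: h; rewrite mulrC ler_pdivrMr // -/Y; congr (_ <= _); ring.
Qed.

(** The previous bound at a vector of the canonical basis: the rows of [C] are
    bounded in l2, whatever the size of the matrix. *)
Lemma sym_form_row i : \sum_k C i k ^+ 2 <= K ^+ 2.
Proof.
have := sym_form_sqr_norm (fun k => (k == i)%:R).
have -> : \sum_k (k == i)%:R ^+ 2 = 1 :> R.
  rewrite (bigD1 i) //= eqxx expr1n big1 ?addr0 // => k ki.
  by rewrite (negPf ki) expr0n.
rewrite mulr1; congr (_ <= _); apply: eq_bigr => k _.
rewrite (bigD1 i) //= eqxx mulr1 big1 ?addr0 => [|l li]; last by rewrite (negPf li) mulr0.
by rewrite Csym.
Qed.

End symmetric_form.

Section form_bounded_theory.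
Context {R : realType} {N : nat} {C : 'I_N -> 'I_N -> R}.
Context {E : {scalar {mpoly R[N]}}} {K : R}.
Hypothesis GE : gaussian_mean C E.
Hypothesis CK : form_bounded C K.
Implicit Types (p q : {mpoly R[N]}) (b : {poly R}) (i k : 'I_N).

Lemma poincare_bounded p :
  E (p ^+ 2) - E p ^+ 2 <= K * \sum_k E (p^`M(k) ^+ 2).
Proof.
apply: (le_trans (poincare GE p)).
under eq_bigr do under eq_bigr do rewrite -meanZ.
under eq_bigr do rewrite -mean_sum.
rewrite -!mean_sum -meanZ; apply: (mean_le GE) => w.
rewrite mpoly.mevalZ !meval_sum.
under eq_bigr do rewrite meval_sum.
under [X in _ * X]eq_bigr do rewrite mevalXn.
under eq_bigr do under eq_bigr do rewrite mpoly.mevalZ mpoly.mevalM.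
exact: (CK (fun k => (p^`M(k)).@[w])).
Qed.

Lemma form_norm_boundedW : 0 < K -> form_norm_bounded C K.
Proof.
move=> K0 v; rewrite ger0_norm; first exact: CK.
have := mean_sqr_ge0 GE (\sum_k v k *: 'x_k).
rewrite expr2 mulr_suml linear_sum; congr (_ <= _); apply: eq_bigr => k _.
rewrite mulr_sumr linear_sum; apply: eq_bigr => l _ /=.
by rewrite -scalerAl -scalerAr !meanZ (gmean_cov GE); ring.
Qed.

Lemma form_sqr_norm (v : 'I_N -> R) :
  0 < K -> \sum_k (\sum_l C k l * v l) ^+ 2 <= K ^+ 2 * \sum_k v k ^+ 2.
Proof.
by move=> K0; exact: (sym_form_sqr_norm (gmean_covC GE) (form_norm_boundedW K0) K0).
Qed.

Lemma form_row i : 0 < K -> \sum_k C i k ^+ 2 <= K ^+ 2.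
Proof. by move=> K0; exact: (sym_form_row (gmean_covC GE) (form_norm_boundedW K0) K0). Qed.

Lemma form_row_sum : 0 < K -> \sum_i (\sum_k C i k) ^+ 2 <= K ^+ 2 * N%:R.
Proof.
move=> K0; have := form_sqr_norm (fun=> 1) K0.
under [X in _ <= _ * X]eq_bigr do rewrite expr1n.
rewrite sumr_const card_ord; congr (_ <= _); apply: eq_bigr => k _.
by under eq_bigr do rewrite mulr1.
Qed.

Lemma mderiv_lin_stat (a : 'I_N -> R) b k :
  (lin_stat a b)^`M(k) = a k *: at_var k b^`().
Proof.
rewrite /lin_stat mderiv_sum (bigD1 k) //= mpoly.mderivZ mderiv_at_var eqxx scale1r.
by rewrite big1 ?addr0 // => j jk; rewrite mpoly.mderivZ mderiv_at_var (negPf jk) scale0r scaler0.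
Qed.

Lemma mean_lin_stat (a : 'I_N -> R) b : gauss_mean b = 0 -> E (lin_stat a b) = 0.
Proof.
move=> b0; rewrite /lin_stat linear_sum big1 // => k _.
by rewrite meanZ (mean_at_var GE) b0 mulr0.
Qed.

End form_bounded_theory.

(** Moments of order 2, 4, 8, ... of a linear statistic are bounded uniformly in
    the number of variables.  The Poincare inequality is applied to S^(m+1), with
    m+1 = 2^(s+1); its gradient is a_k (m+1) S^m b'(x_k), and Young's inequality
    splits S^(2m) b'(x_k)^2 into a small multiple of S^(2m+2), absorbed on the
    left, and a moment of one variable. *)
Lemma lin_stat_moment (R : realType) (K A : R) (b : {poly R}) (s : nat) :
  0 < K -> 0 < A -> gauss_mean b = 0 ->
  exists B : R, forall N (C : 'I_N -> 'I_N -> R) E,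
    gaussian_mean C E -> form_bounded C K ->
    forall a : 'I_N -> R, \sum_k a k ^+ 2 <= A -> E (lin_stat a b ^+ (2 ^ s.+1)) <= B.
Proof.
move=> K0 A0 b0; elim: s => [|s [B IH]].
  exists (K * (A * `|gauss_mean (b^`() ^+ 2)|)) => N C E GE CK a aA; rewrite expn1.
  have := poincare_bounded GE CK (lin_stat a b).
  rewrite (mean_lin_stat GE) // expr0n subr0 => /le_trans; apply.
  rewrite ler_pM2l //.
  under eq_bigr do rewrite mderiv_lin_stat exprZn meanZ -at_varXn (mean_at_var GE).
  rewrite -mulr_suml; apply: (@le_trans _ _ ((\sum_i a i ^+ 2) * `|gauss_mean (b^`() ^+ 2)|)).
    by rewrite ler_wpM2l ?ler_norm // sumr_ge0 // => i _; exact: sqr_ge0.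
  by rewrite ler_wpM2r.
have [m mE] : exists m, (2 ^ s.+1)%N = m.+1 by exists (2 ^ s.+1).-1; rewrite prednK // expn_gt0.
pose L := K * (m.+1%:R ^+ 2 * A).
have L0 : 0 < L by rewrite !mulr_gt0 // exprn_gt0 // ltr0n.
(* with this weight, half of [Q = E (S ^+ (2 * m.+1))] is absorbed below *)
pose e := (2 * L)^-1.
have e0 : 0 < e by rewrite invr_gt0 mulr_gt0.
have em0 : 0 <= e^-1 ^+ m by rewrite exprn_ge0 // invr_ge0 ltW.
pose G := `|gauss_mean (b^`() ^+ (m.+1 * 2))|.
exists (2 * (B ^+ 2 + L * (e^-1 ^+ m * G))) => N C E GE CK a aA.
have {}IH := IH N C E GE CK a aA.
rewrite expnSr mulnC exprM; rewrite mE in IH *.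
set S := lin_stat a b in IH *.
have := poincare_bounded GE CK (S ^+ m.+1); rewrite -exprM mulnC exprM.
set Q := E _; rewrite lerBlDr => hQ.
have hB : E (S ^+ m.+1) ^+ 2 <= B ^+ 2.
  rewrite lerXn2r ?nnegrE //.
    have := mean_sqr_ge0 GE (S ^+ (2 ^ s)); rewrite -exprM -expnSr mE //.
  have := mean_sqr_ge0 GE (S ^+ (2 ^ s)); rewrite -exprM -expnSr mE // => /le_trans.
  exact.
have hS : \sum_k E ((S ^+ m.+1)^`M(k) ^+ 2) <=
    m.+1%:R ^+ 2 * A * (e * Q + e^-1 ^+ m * G).
  have h k : E ((S ^+ m.+1)^`M(k) ^+ 2) <=
      a k ^+ 2 * (m.+1%:R ^+ 2 * (e * Q + e^-1 ^+ m * G)).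
    have -> : (S ^+ m.+1)^`M(k) ^+ 2 =
        (a k ^+ 2 * m.+1%:R ^+ 2) *: ((S ^+ 2) ^+ m * at_var k (b^`() ^+ 2)).
      rewrite mderiv_exp mderiv_lin_stat -scalerAr scalerA exprZn exprMn.
      by rewrite exprMn [m.+1%:R ^+ 2 * _]mulrC -!exprM mulnC at_varXn.
    rewrite [in leRHS]mulrA meanZ; apply: ler_wpM2l; first by rewrite mulr_ge0 ?sqr_ge0.
    apply: (@le_trans _ _ (E (e *: (S ^+ 2) ^+ m.+1 +
        (e^-1 ^+ m) *: at_var k (b^`() ^+ 2) ^+ m.+1))).
      apply: (mean_le GE) => w; rewrite mpoly.mevalD !mpoly.mevalZ mpoly.mevalM.
      rewrite !mevalXn at_varXn [(_ ^+ 2).@[w]]mevalXn.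
      by apply: young_expr => //; exact: sqr_ge0.
    rewrite meanD !meanZ lerD2l; apply: ler_wpM2l; first exact: em0.
    by rewrite -at_varXn (mean_at_var GE) -exprM mulnC ler_norm.
  have G0 : 0 <= G by exact: normr_ge0.
  have Q0 : 0 <= Q by rewrite /Q -exprM mulnC exprM (mean_sqr_ge0 GE).
  have T0 : 0 <= m.+1%:R ^+ 2 * (e * Q + e^-1 ^+ m * G).
    by apply: mulr_ge0; [exact: sqr_ge0|apply: addr_ge0; apply: mulr_ge0 => //; exact: ltW].
  apply: le_trans (ler_sum _ (fun k _ => h k)) _; rewrite -mulr_suml.
  by rewrite [m.+1%:R ^+ 2 * A]mulrC -[leRHS]mulrA; exact: ler_wpM2r.
have : Q <= K * (m.+1%:R ^+ 2 * A * (e * Q + e^-1 ^+ m * G)) + B ^+ 2.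
  by apply: (le_trans hQ); apply: lerD => //; rewrite ler_pM2l.
rewrite mulrA -/L mulrDr mulrA.
have -> : L * e = 2^-1 by rewrite /e; field; rewrite gt_eqF.
by set Y := L * _; lra.
Qed.

(** * Asymptotic recursion for the moments of Hermite sums *)

Section gauss_mean_linear.
Context {R : realType}.
Implicit Types u v : {poly R}.

Lemma gauss_meanE n u : (size u <= n)%N ->
  gauss_mean u = \sum_(i < n) u`_i * gauss_moment R i.
Proof.
move=> un; rewrite /gauss_mean.
rewrite (big_ord_widen _ (fun i => u`_i * gauss_moment R i) un) big_mkcond /=.
apply: eq_bigr => i _; case: ltnP => // ui.
by rewrite nth_default // mul0r.
Qed.

Lemma gauss_meanD u v : gauss_mean (u + v) = gauss_mean u + gauss_mean v.
Proof.
have h := size_polyD u v.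
rewrite (gauss_meanE h) (gauss_meanE (leq_maxl (size u) (size v))).
rewrite (gauss_meanE (leq_maxr (size u) (size v))) -big_split.
by apply: eq_bigr => i _; rewrite /= coefD mulrDl.
Qed.

Lemma gauss_meanZ c u : gauss_mean (c *: u) = c * gauss_mean u.
Proof.
rewrite (gauss_meanE (size_scale_leq c u)) mulr_sumr.
by apply: eq_bigr => i _; rewrite coefZ mulrA.
Qed.

Lemma gauss_meanC c : gauss_mean c%:P = c :> R.
Proof.
by rewrite (gauss_meanE (size_polyC_leq1 c)) big_ord1 coefC /= mulr1.
Qed.

Lemma gauss_mean_center u : gauss_mean (u - (gauss_mean u)%:P) = 0.
Proof.
by rewrite -scaleN1r gauss_meanD gauss_meanZ gauss_meanC mulN1r subrr.
Qed.

Lemma gauss_mean_ibp u : gauss_mean ('X * u) = gauss_mean u^`().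
Proof.
have [->|u0] := eqVneq u 0; first by rewrite mulr0 deriv0.
have su : (size u).-1.+1 = size u by rewrite prednK // size_poly_gt0.
have s1 : (size ('X * u)%R <= (size u).-1.+2)%N by rewrite su mulrC size_mulX.
have s2 : (size (u^`())%R <= (size u).-1)%N by rewrite -ltnS su lt_size_deriv.
rewrite (gauss_meanE s1) (gauss_meanE s2) 2!big_ord_recl /= !coefXM /= mul0r mulr0 !add0r.
apply: eq_bigr => i _; rewrite (_ : bump 0 (bump 0 i) = i.+2) // coefXM coef_deriv /=.
by rewrite mulr_natl mulrnAl mulrnAr.
Qed.

Lemma gauss_mean_hermiteS l u :
  gauss_mean (hermite R l.+1 * u) = gauss_mean (hermite R l * u^`()).
Proof.
rewrite hermiteS mulrBl -scaleN1r gauss_meanD gauss_meanZ mulN1r -mulrA gauss_mean_ibp.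
by rewrite derivM gauss_meanD addrC addrA addNr add0r.
Qed.

Lemma gauss_mean_hermite1 l : gauss_mean (hermite R l.+1) = 0.
Proof.
rewrite -[hermite _ _]mulr1 gauss_mean_hermiteS -[1]/(1%:P) derivC mulr0.
by rewrite -[0]/(0%:P) gauss_meanC.
Qed.

Lemma gauss_mean_hermite2 l m :
  gauss_mean (hermite R l * hermite R m) = (l == m)%:R * l`!%:R.
Proof.
elim: l m => [|l IH] [|m].
- by rewrite hermite0 mulr1 -[1]/(1%:P) gauss_meanC mulr1.
- by rewrite hermite0 mul1r gauss_mean_hermite1 mul0r.
- by rewrite hermite0 mulr1 gauss_mean_hermite1 mul0r.
rewrite gauss_mean_hermiteS deriv_hermite -scalerAr gauss_meanZ IH eqSS.
by case: eqP => [->|_]; rewrite ?mul0r ?mulr0 // !mul1r factS natrM.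
Qed.

End gauss_mean_linear.

Section cross_terms.
Context {R : realType} (K : R) (K0 : 0 < K).

(** The mean of [b] contributes at most the squared row sums of [C], which add up
    to O(N) by the bound of the form at the vector (1, ..., 1).  The centered part
    of [b] is a linear statistic whose coefficients are a row of [C], bounded in
    l2, so that its fourth moment is bounded for each [m]. *)
Lemma cross_term_bound (u b : {poly R}) :
  exists B : R, forall N (C : 'I_N -> 'I_N -> R) E,
    gaussian_mean C E -> form_bounded C K ->
    \sum_m E ((at_var m u * lin_stat (C m) b) ^+ 2) <= B * N%:R.
Proof.
have K2 : 0 < K ^+ 2 by rewrite exprn_gt0.
have [B HB] := lin_stat_moment 1 K0 K2 (gauss_mean_center b).
pose b0 := gauss_mean b; pose bt := b - b0%:P.
exists (2 * b0 ^+ 2 * `|gauss_mean (u ^+ 2)| * K ^+ 2 + (`|gauss_mean (u ^+ 4)| + B)).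
move=> N C E GE CK.
pose s m := \sum_k C m k.
have split m : lin_stat (C m) b = (b0 * s m) *: 1 + lin_stat (C m) bt.
  rewrite /lin_stat /s mulr_sumr scaler_suml -big_split; apply: eq_bigr => k _ /=.
  by rewrite /bt at_varB at_varC scalerBr scalerA [b0 * _]mulrC addrC subrK.
have h m : E ((at_var m u * lin_stat (C m) b) ^+ 2) <=
    2 * b0 ^+ 2 * `|gauss_mean (u ^+ 2)| * s m ^+ 2 + (`|gauss_mean (u ^+ 4)| + B).
  apply: (@le_trans _ _ (E ((2 * b0 ^+ 2 * s m ^+ 2) *: at_var m (u ^+ 2) +
      (at_var m (u ^+ 4) + lin_stat (C m) bt ^+ 4)))).
    apply: (mean_le GE) => w; rewrite !mpoly.mevalD mpoly.mevalZ !mevalXn split.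
    rewrite mpoly.mevalM mpoly.mevalD mpoly.mevalZ mpoly.meval1 !at_varXn !mevalXn.
    set U := (at_var m u).@[w]; set V := (lin_stat _ _).@[w].
    rewrite -subr_ge0 (_ : _ - _ = (U * (b0 * s m) - U * V) ^+ 2 + (U ^+ 2 - V ^+ 2) ^+ 2).
      by rewrite addr_ge0 ?sqr_ge0.
    ring.
  rewrite !linearD /= meanZ !(mean_at_var GE); apply: lerD; last apply: lerD.
  - by rewrite mulrAC ler_wpM2r ?sqr_ge0 // ler_wpM2l ?ler_norm // mulr_ge0 ?sqr_ge0.
  - exact: ler_norm.
  - by apply: (HB N C E GE CK (C m)); exact: (form_row GE CK m K0).
apply: le_trans (ler_sum _ (fun m _ => h m)) _; rewrite big_split /=.
rewrite sumr_const card_ord -mulr_sumr -[_ *+ N]mulr_natr [leRHS]mulrDl lerD2r.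
rewrite -[leRHS]mulrA; apply: ler_wpM2l; last exact: (form_row_sum GE CK K0).
by rewrite mulr_ge0 // mulr_ge0 // sqr_ge0.
Qed.

End cross_terms.

Definition hermite_sum (R : realType) (L : nat) (a : nat -> R) : {poly R} :=
  \sum_(l < L) a l *: hermite R l.+1.

Section stein.
Context {R : realType}.
Implicit Types (a : nat -> R) (L : nat).

(** [hermite_sum L a] with the degree of each Hermite polynomial lowered by
    one, as integration by parts does. *)
Definition hermite_shift L a : {poly R} := \sum_(l < L) a l *: hermite R l.

(** The weight W of Stein's identity E(F^(r+2)) = (r+1) E(F^r W) for
    F = \sum_i w b(x_i): in the language of Malliavin calculus, the scalar product
    of the gradients of F and of the inverse Ornstein-Uhlenbeck operator applied
    to F. *)
Definition stein_weight N (C : 'I_N -> 'I_N -> R) L a (w : R) : {mpoly R[N]} :=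
  w ^+ 2 *: \sum_i \sum_k C i k *:
    (at_var i (hermite_shift L a) * at_var k (hermite_sum L a)^`()).

Lemma gauss_mean_hermite_sum L a : gauss_mean (hermite_sum L a) = 0.
Proof.
rewrite /hermite_sum; elim/big_ind: _ => [|p q p0 q0|l _].
- by rewrite -(polyC0 R) gauss_meanC.
- by rewrite gauss_meanD p0 q0 addr0.
by rewrite gauss_meanZ gauss_mean_hermite1 mulr0.
Qed.

Section one_mean.
Context {N : nat} {C : 'I_N -> 'I_N -> R} {E : {scalar {mpoly R[N]}}}.
Hypothesis GE : gaussian_mean C E.
Variables (L : nat) (a : nat -> R) (w : R).

Let F : {mpoly R[N]} := lin_stat (fun=> w) (hermite_sum L a).
Let W := stein_weight C L a w.

Lemma mean_sqrD c p q :
  E ((c *: (p + q)) ^+ 2) <= 2 * c ^+ 2 * (E (p ^+ 2) + E (q ^+ 2)).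
Proof.
rewrite -linearD -meanZ; apply: (mean_le GE) => v.
rewrite mpoly.mevalZ mpoly.mevalD !mevalXn mpoly.mevalZ mpoly.mevalD.
rewrite -subr_ge0 (_ : _ - _ = (c * (p.@[v] - q.@[v])) ^+ 2) ?sqr_ge0 //; ring.
Qed.

Lemma mean_hermite_sum i p : E (at_var i (hermite_sum L a) * p) =
  \sum_k C i k * E (at_var i (hermite_shift L a) * p^`M(k)).
Proof.
rewrite /hermite_sum /hermite_shift !at_var_sum mulr_suml mean_sum.
under eq_bigr do rewrite at_varZ -scalerAl meanZ (mean_hermite GE) mulr_sumr.
rewrite exchange_big; apply: eq_bigr => k _ /=.
rewrite mulr_suml mean_sum mulr_sumr; apply: eq_bigr => l _.
by rewrite at_varZ -scalerAl meanZ mulrCA.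
Qed.

(** Integration by parts on one of the factors F. *)
Lemma mean_stein r : E (F ^+ r.+2) = r.+1%:R * E (F ^+ r * W).
Proof.
rewrite exprS {1}/F /lin_stat mulr_suml mean_sum.
under eq_bigr do rewrite -scalerAl meanZ mean_hermite_sum mulr_sumr.
rewrite /W /stein_weight -scalerAr meanZ mulr_sumr mean_sum.
rewrite mulrA mulr_sumr; apply: eq_bigr => i _.
rewrite mulr_sumr mean_sum mulr_sumr; apply: eq_bigr => k _.
rewrite mderiv_exp /F mderiv_lin_stat -/F -!scalerAr !meanZ -!mulrA.
by rewrite [at_var i _ * (_ * _)]mulrCA [LHS]mulrCA; congr (_ * _); ring.
Qed.

Lemma mean_stein_weight : E W = E (F ^+ 2).
Proof. by rewrite mean_stein expr0 !mul1r. Qed.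

(** Hermite polynomials of different degrees are orthogonal even in different
    variables, hence no cross terms in [l]. *)
Lemma mean_sqr_lin_stat : E (F ^+ 2) =
  w ^+ 2 * \sum_i \sum_k \sum_(l < L) a l ^+ 2 * l.+1`!%:R * C i k ^+ l.+1.
Proof.
rewrite expr2 {1}/F /lin_stat mulr_suml mean_sum mulr_sumr; apply: eq_bigr => i _.
rewrite -scalerAl meanZ /F /lin_stat mulr_sumr mean_sum !mulr_sumr.
apply: eq_bigr => k _; rewrite -scalerAr meanZ mulrA -expr2; congr (_ * _).
rewrite /hermite_sum !at_var_sum mulr_suml mean_sum; apply: eq_bigr => l _.
rewrite mulr_sumr mean_sum (bigD1 l) //= !at_varZ -scalerAl -scalerAr !meanZ.
rewrite (mean_hermite2 GE) eqxx mul1r big1 ?addr0 => [|m ml]; first by ring.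
rewrite !at_varZ -scalerAl -scalerAr !meanZ (mean_hermite2 GE) eqSS.
by rewrite eq_sym (negPf (_ : (m != l :> nat))) ?mul0r ?mulr0.
Qed.

Lemma mderiv_stein_weight m : W^`M(m) = w ^+ 2 *:
   (at_var m (hermite_shift L a)^`() * lin_stat (C m) (hermite_sum L a)^`() +
    at_var m (hermite_sum L a)^`()^`() * lin_stat (C m) (hermite_shift L a)).
Proof.
rewrite /W /stein_weight mpoly.mderivZ mderiv_sum; congr (_ *: _).
under eq_bigr do rewrite mderiv_sum.
under eq_bigr do under eq_bigr do rewrite mpoly.mderivZ mpoly.mderivM !mderiv_at_var scalerDr.
under eq_bigr do rewrite big_split /=.
rewrite big_split /=; congr (_ + _).
  rewrite (bigD1 m) //= [X in _ + X]big1 ?addr0 => [|i im]; last first.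
    by rewrite big1 // => k _; rewrite (negPf im) scale0r mul0r scaler0.
  by rewrite /lin_stat mulr_sumr; apply: eq_bigr => k _; rewrite eqxx scale1r scalerAr.
rewrite exchange_big (bigD1 m) //= [X in _ + X]big1 ?addr0 => [|i im]; last first.
  by rewrite big1 // => k _; rewrite (negPf im) scale0r mulr0 scaler0.
rewrite /lin_stat mulr_sumr; apply: eq_bigr => k _; rewrite eqxx scale1r.
by rewrite (gmean_covC GE) mulrC scalerAr.
Qed.

End one_mean.

(** Each partial derivative of W is a function of one variable times a linear
    statistic with coefficients a row of [C], so [cross_term_bound] applies after
    the Poincare inequality. *)
Lemma stein_weight_variance (K : R) L a : 0 < K ->
  exists B : R, forall N (C : 'I_N -> 'I_N -> R) E (w : R),
    gaussian_mean C E -> form_bounded C K -> 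
    E (stein_weight C L a w ^+ 2) - E (stein_weight C L a w) ^+ 2 <= B * (w ^+ 4 * N%:R).
Proof.
move=> K0.
have [B1 HB1] := cross_term_bound K0 (hermite_shift L a)^`() (hermite_sum L a)^`().
have [B2 HB2] := cross_term_bound K0 (hermite_sum L a)^`()^`() (hermite_shift L a).
exists (K * (2 * (B1 + B2))) => N C E w GE CK.
apply: le_trans (poincare_bounded GE CK _) _; rewrite -mulrA ler_pM2l //.
under eq_bigr do rewrite (mderiv_stein_weight GE).
apply: (@le_trans _ _ (\sum_m (2 * w ^+ (2 * 2)) * (
  E ((at_var m (hermite_shift L a)^`() * lin_stat (C m) (hermite_sum L a)^`()) ^+ 2) +
  E ((at_var m (hermite_sum L a)^`()^`() * lin_stat (C m) (hermite_shift L a)) ^+ 2)))).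
  by apply: ler_sum => m _; rewrite exprM (mean_sqrD GE).
rewrite -mulr_sumr big_split /=.
have -> : 2 * (B1 + B2) * (w ^+ 4 * N%:R) = 2 * w ^+ 4 * (B1 * N%:R + B2 * N%:R) by ring.
apply: ler_wpM2l; last by apply: lerD; [exact: HB1|exact: HB2].
by rewrite mulr_ge0 // exprM sqr_ge0.
Qed.

Lemma lin_stat_even_moment (K : R) L a r : 0 < K ->
  exists B : R, forall N (C : 'I_N -> 'I_N -> R) E (w : R),
    gaussian_mean C E -> form_bounded C K -> w ^+ 2 * N%:R <= 1 ->
    E (lin_stat (fun=> w) (hermite_sum L a) ^+ (2 * r)) <= B.
Proof.
move=> K0; have [B HB] := lin_stat_moment r K0 (@ltr01 R) (gauss_mean_hermite_sum L a).
exists (1 + B) => N C E w GE CK wN.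
have {}HB : E (lin_stat (fun=> w) (hermite_sum L a) ^+ (2 ^ r.+1)) <= B.
  by apply: HB GE CK _ _; rewrite sumr_const card_ord -mulr_natr.
apply: le_trans (_ : E (1 *: 1 + lin_stat (fun=> w) (hermite_sum L a) ^+ (2 ^ r.+1)) <= _).
  apply: (mean_le GE) => v; rewrite mpoly.mevalD scale1r mpoly.meval1 !mevalXn.
  rewrite exprM expnS exprM; apply: expr_le1D; first exact: sqr_ge0.
  by apply: ltnW; rewrite ltn_expl.
by rewrite linearD /= (mean_cst GE) lerD2l.
Qed.

(** In Stein's identity W may be replaced by its mean E F^2, since the variance
    of W is O(w^2) while the moments of F are bounded. *)
Lemma stein_moment_recursion (K : R) L a r : 0 < K ->
  exists B : R, forall N (C : 'I_N -> 'I_N -> R) E (w : R),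
    gaussian_mean C E -> form_bounded C K -> 0 < w -> w ^+ 2 * N%:R <= 1 ->
    `|E (lin_stat (fun=> w) (hermite_sum L a) ^+ r.+2) -
      r.+1%:R * E (lin_stat (fun=> w) (hermite_sum L a) ^+ 2) *
      E (lin_stat (fun=> w) (hermite_sum L a) ^+ r)| <= B * w.
Proof.
move=> K0; have [B1 HB1] := lin_stat_even_moment L a r K0.
have [B2 HB2] := stein_weight_variance L a K0.
exists (r.+1%:R * (B1 + `|B2|)) => N C E w GE CK w0 wN; set F := lin_stat _ _.
rewrite /F (mean_stein GE) -(mean_stein_weight GE) -/F; set W := stein_weight _ _ _ _.
have -> : r.+1%:R * E (F ^+ r * W) - r.+1%:R * E W * E (F ^+ r) =
    r.+1%:R * E (F ^+ r * (W - E W *: 1)).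
  by rewrite mean_mul_center; ring.
rewrite normrM ger0_norm // -!mulrA ler_pM2l ?ltr0n //.
set V := W - _.
have VV : E (V ^+ 2) <= `|B2| * w ^+ 2.
  have -> : E (V ^+ 2) = E (W ^+ 2) - E W ^+ 2.
    exact: (mean_center_sqr GE).
  apply: (le_trans (HB2 _ _ _ w GE CK)).
  have -> : w ^+ 4 * N%:R = w ^+ 2 * (w ^+ 2 * N%:R) by ring.
  apply: (@le_trans _ _ (`|B2| * (w ^+ 2 * (w ^+ 2 * N%:R)))).
    apply: ler_wpM2r; last exact: ler_norm.
    by apply: mulr_ge0; [exact: sqr_ge0|apply: mulr_ge0; rewrite ?sqr_ge0].
  by rewrite ler_wpM2l // -[leRHS]mulr1 ler_wpM2l ?sqr_ge0.
have FF : E (F ^+ (2 * r)) <= B1 by exact: HB1 GE CK wN.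
(* the weights [w] and [w^-1] balance E (F ^+ (2 * r)) = O(1) against E (V ^+ 2) = O(w^2) *)
have amgm s : s ^+ 2 = 1 -> s * E (F ^+ r * V) <= (B1 + `|B2|) * w.
  move=> s1; have : 2 * (s * E (F ^+ r * V)) <= w * E (F ^+ (2 * r)) + w^-1 * E (V ^+ 2).
    rewrite -!meanZ -linearD; apply: (mean_le GE) => v.
    rewrite !mpoly.mevalD !mpoly.mevalZ mpoly.mevalM !mevalXn.
    set x := F.@[v]; set y := V.@[v].
    have -> : w * x ^+ (2 * r) = w * s ^+ 2 * (x ^+ r) ^+ 2.
      by rewrite s1 mulr1 mulnC exprM.
    rewrite -subr_ge0 (_ : _ - _ = w * (s * x ^+ r - w^-1 * y) ^+ 2).
      by rewrite mulr_ge0 ?sqr_ge0 // ltW.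
    by field; rewrite gt_eqF.
  have h1 : w * E (F ^+ (2 * r)) <= w * B1 by rewrite ler_pM2l.
  have h2 : w^-1 * E (V ^+ 2) <= w * `|B2|.
    by rewrite mulrC ler_pdivrMr //; apply: (le_trans VV); rewrite mulrAC mulrC -expr2.
  have : 0 <= E (F ^+ (2 * r)) by rewrite mulnC exprM (mean_sqr_ge0 GE).
  have := mean_sqr_ge0 GE V => e1 e2.
  have h3 : 0 <= w * B1 by apply: (le_trans _ h1); rewrite mulr_ge0 // ltW.
  have h4 : 0 <= w * `|B2| by rewrite mulr_ge0 // ltW.
  by lra.
have h1 := amgm 1 (expr1n _ _); have h2 := amgm (-1) (etrans (sqrrN 1) (expr1n _ _)).
rewrite ler_norml; apply/andP; split; last by lra.
by move: h2; rewrite mulN1r lerNl.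
Qed.

End stein.

(** * From Gaussian linear forms to integration by parts *)

Section polarization.
Context {R : realType} {N : nat}.
Implicit Types (f : {scalar {mpoly R[N]}}) (p q u y : {mpoly R[N]}).

Lemma poly_eq_fun (r s : {poly R}) : (forall t, r.[t] = s.[t]) -> r = s.
Proof.
move=> rs; apply/eqP; rewrite -subr_eq0; apply/eqP.
apply: (@roots_geq_poly_eq0 _ _ [seq i%:R | i <- iota 0 (size (r - s))]).
- by apply/allP => t _; rewrite /root hornerD hornerN rs subrr.
- by rewrite map_inj_uniq ?iota_uniq // => a b /eqP; rewrite eqr_nat => /eqP.
- by rewrite size_map size_iota.
Qed.

(** [f] applied to the coefficients of a polynomial in a parameter.  Identities
    in the parameter can then be differentiated by comparing coefficients. *)
Definition poly_functional f (P : {poly {mpoly R[N]}}) : {poly R} :=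
  \poly_(j < size P) f P`_j.

Lemma coef_poly_functional f P j : (poly_functional f P)`_j = f P`_j.
Proof.
by rewrite coef_poly; case: ltnP => // h; rewrite nth_default // linear0.
Qed.

Lemma horner_poly_functional f P t : (poly_functional f P).[t] = f P.[t *: 1].
Proof.
rewrite horner_poly horner_coef linear_sum; apply: eq_bigr => j _.
by rewrite exprZn expr1n -scalerAr mulr1 linearZ /= mulrC.
Qed.

Definition affine_power p u y m : {poly {mpoly R[N]}} :=
  p%:P * (u%:P + y *: 'X) ^+ m.

Lemma horner_affine_power p u y m t :
  (affine_power p u y m).[t *: 1] = p * (u + t *: y) ^+ m.
Proof.
rewrite /affine_power hornerM hornerC horner_exp hornerD hornerC hornerZ hornerX.
by rewrite -scalerAr mulr1.
Qed.

Lemma coef0_affine_power p u y m : (affine_power p u y m)`_0 = p * u ^+ m.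
Proof. by rewrite -horner_coef0 -(scale0r 1) horner_affine_power scale0r addr0. Qed.

Lemma coef1_affine_power p u y m :
  (affine_power p u y m.+1)`_1 = m.+1%:R *: (p * u ^+ m * y).
Proof.
have -> : (affine_power p u y m.+1)`_1 = (affine_power p u y m.+1)^`()`_0.
  by rewrite coef_deriv.
rewrite /affine_power derivM derivC mul0r add0r deriv_exp derivD derivC add0r.
rewrite derivZ derivX alg_polyC -horner_coef0 hornerCM hornerMn hornerCM horner_exp.
by rewrite hornerD hornerC hornerZ hornerX mulr0 addr0 mulrnAr scaler_nat [y * _]mulrC mulrA.
Qed.

(** Differentiation at t = 0. *)
Lemma affine_power_coef1 f p u y m :
  (forall t, f (p * (u + t *: y) ^+ m.+1) = 0) -> f (p * u ^+ m * y) = 0.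
Proof.
move=> f0; have /(congr1 (fun r : {poly R} => r`_1)) :
    poly_functional f (affine_power p u y m.+1) = 0.
  by apply: poly_eq_fun => t; rewrite horner_poly_functional horner_affine_power f0 horner0.
rewrite coef_poly_functional coef1_affine_power coef0 linearZ /= => /eqP.
by rewrite mulf_eq0 pnatr_eq0 /= => /eqP.
Qed.

End polarization.

Section gaussian_from_linear_forms.
Context {R : realType} {N : nat} (E : {scalar {mpoly R[N]}}).
Implicit Types (p q : {mpoly R[N]}) (a b : 'I_N -> R).

Definition linear_form a : {mpoly R[N]} := \sum_k a k *: 'x_k.

Hypothesis E1 : E 1 = 1.
Hypothesis Ex : forall i, E 'x_i = 0.
(* the recursion of the moments of a centered normal law, for all linear forms *)
Hypothesis El : forall a m, E (linear_form a ^+ m.+2) =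
  m.+1%:R * E (linear_form a ^+ 2) * E (linear_form a ^+ m).

Let E_form a : E (linear_form a) = 0.
Proof. by rewrite linear_sum big1 // => k _; rewrite linearZ /= Ex mulr0. Qed.

Lemma linear_formDZ a b t :
  linear_form a + t *: linear_form b = linear_form (fun k => a k + t * b k).
Proof.
rewrite /linear_form scaler_sumr -big_split; apply: eq_bigr => k _ /=.
by rewrite scalerDl scalerA.
Qed.

(** The derivative at t = 0 of the moment recursion for the linear form
    [a + t b]. *)
Lemma mean_form_power a b m : E (linear_form a ^+ m.+1 * linear_form b) =
  m.+1%:R * E (linear_form a * linear_form b) * E (linear_form a ^+ m).
Proof.
set u := linear_form a; set y := linear_form b.
have rec k : k.+2%:R * E (u ^+ k.+1 * y) =
    k.+1%:R * (E (u ^+ 2) * (if k is j.+1 then k%:R * E (u ^+ j * y) else 0) +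
               2 * E (u * y) * E (u ^+ k)).
  pose Q j := poly_functional E (affine_power 1 u y j).
  have QE : Q k.+2 = k.+1%:R *: (Q 2 * Q k).
    apply: poly_eq_fun => t; rewrite hornerZ hornerM !horner_poly_functional.
    by rewrite !horner_affine_power !mul1r linear_formDZ El mulrA.
  have := congr1 (fun r : {poly R} => r`_1) QE.
  rewrite coefZ coefM !big_ord_recl big_ord0 /= addr0 !coef_poly_functional.
  rewrite !coef0_affine_power !coef1_affine_power !mul1r !linearZ /= expr1 => ->.
  congr (_ * (_ * _ + _)); case: k {QE} => [|j]; last first.
    by rewrite coef1_affine_power mul1r linearZ.
  by rewrite /affine_power expr0 mulr1 coefC /= linear0.
have natn0 k : k.+1%:R != 0 :> R by rewrite pnatr_eq0.
suff: E (u ^+ m.+1 * y) = m.+1%:R * E (u * y) * E (u ^+ m) /\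
  E (u ^+ m.+2 * y) = m.+2%:R * E (u * y) * E (u ^+ m.+1) by case.
elim: m => [|m [IH1 IH2]]; split => //.
- by rewrite expr1 expr0 E1 mulr1 mul1r.
- apply: (mulfI (natn0 2)); rewrite (rec 1%N) expr0 !mul1r E_form mulr0 add0r.
  by rewrite expr1 E_form !mulr0.
- apply: (mulfI (natn0 m.+3)); rewrite rec IH1.
  have -> : E (u ^+ m.+2) = m.+1%:R * E (u ^+ 2) * E (u ^+ m) := El a m.
  by rewrite -[m.+4%:R]natr1 -[m.+3%:R]natr1 -[m.+2%:R]natr1; ring.
Qed.

Definition ibp_defect i p := E ('x_i * p) - \sum_k E ('x_i * 'x_k) * E (p^`M(k)).

Lemma ibp_defect_is_linear i : linear_for *%R (ibp_defect i).
Proof.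
move=> c p q; rewrite /ibp_defect mulrDr -scalerAr linearD linearZ /=.
have -> : \sum_k E ('x_i * 'x_k) * E ((c *: p + q)^`M(k)) =
    c * \sum_k E ('x_i * 'x_k) * E (p^`M(k)) + \sum_k E ('x_i * 'x_k) * E (q^`M(k)).
  rewrite mulr_sumr -big_split; apply: eq_bigr => k _ /=.
  rewrite mpoly.mderivD mpoly.mderivZ linearD linearZ /=; ring.
ring.
Qed.

HB.instance Definition _ i := GRing.isLinear.Build R {mpoly R[N]} R *%R
  (ibp_defect i) (ibp_defect_is_linear i).

Lemma linear_formX i : linear_form (fun k => (k == i)%:R) = 'x_i.
Proof.
rewrite /linear_form (bigD1 i) //= eqxx scale1r big1 ?addr0 // => k ki.
by rewrite (negPf ki) scale0r.
Qed.

Lemma mderiv_linear_form a k : (linear_form a)^`M(k) = a k *: 1.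
Proof.
rewrite /linear_form mderiv_sum (bigD1 k) //= mpoly.mderivZ mderivXU eqxx.
by rewrite big1 ?addr0 // => j jk; rewrite mpoly.mderivZ mderivXU (negPf jk) scaler0.
Qed.

(** For powers of a single linear form the rule is [mean_form_power]; a further
    factor is obtained by polarizing, that is by differentiating in the
    direction of that factor. *)
Lemma ibp_defect_forms i (s : seq ('I_N -> R)) a m :
  ibp_defect i (\prod_(b <- s) linear_form b * linear_form a ^+ m) = 0.
Proof.
elim: s a m => [|b s IH] a m.
  rewrite big_nil mul1r; case: m => [|m]; rewrite /ibp_defect.
    by rewrite expr0 mulr1 Ex big1 ?subrr // => k _; rewrite mderiv1 linear0 mulr0.
  rewrite mulrC -{1}(linear_formX i) mean_form_power linear_formX.
  rewrite {1}/linear_form mulr_suml mean_sum mulr_sumr mulr_suml -sumrB big1 // => k _.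
  rewrite mderiv_exp mderiv_linear_form -[_ ^+ m * (a k *: 1)]scalerAr mulr1 !meanZ.
  by rewrite -[a k *: 'x_k * 'x_i]scalerAl meanZ ['x_k * 'x_i]mulrC; ring.
rewrite big_cons -mulrA mulrC.
apply: affine_power_coef1 => t; rewrite linear_formDZ; exact: IH.
Qed.

(** Gaussian linear forms determine the law, here in the form needed: the
    integration by parts rule of [gaussian_mean], with covariances
    E(x_i x_k).  Monomials are products of linear forms. *)
Lemma ibp_from_linear_forms i p :
  E ('x_i * p) = \sum_k E ('x_i * 'x_k) * E (p^`M(k)).
Proof.
apply/eqP; rewrite -subr_eq0 -/(ibp_defect i p); apply/eqP.
rewrite (mpoly.mpolyE p) linear_sum big1 // => m _; rewrite linearZ /=.
suff [s ->] : exists s : seq ('I_N -> R), mpoly.mpolyX R m = \prod_(b <- s) linear_form b.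
  by rewrite -[X in ibp_defect i X]mulr1 -(expr0 (linear_form (fun=> 0))) ibp_defect_forms mulr0.
rewrite mpoly.mpolyXE_id; elim/big_ind: _ => [|_ _ [s ->] [s' ->]|j _].
- by exists [::]; rewrite big_nil.
- by exists (s ++ s'); rewrite big_cat.
exists (nseq (m j) (fun k => (k == j)%:R)); rewrite big_nseq linear_formX.
by elim: (m j) => [|e IH] //=; rewrite exprS IH.
Qed.

End gaussian_from_linear_forms.

(** * Moments of normal laws *)

Section normal_density.
Context {R : realType} (m s : R) (s0 : s != 0).
Local Notation mu := (@lebesgue_measure R).
Local Notation nu := (@normal_prob R m s).

(** The density as a Radon-Nikodym derivative. *)
Lemma ge0_integral_normal_prob (f : R -> \bar R) :
  measurable_fun setT f -> (forall x, 0 <= f x)%E ->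
  (\int[nu]_x f x = \int[mu]_x (f x * (normal_pdf m s x)%:E))%E.
Proof.
move=> mf f0.
rewrite -(Radon_Nikodym_SigmaFinite.change_of_variables (normal_prob_dominates m s) f0 measurableT mf).
have mRN : measurable_fun setT (Radon_Nikodym_SigmaFinite.f nu mu).
  apply: (measurable_int mu).
  exact: (Radon_Nikodym_SigmaFinite.f_integrable (normal_prob_dominates m s)).
have mpdf : measurable_fun setT (EFin \o normal_pdf m s).
  by apply/measurable_EFinP; exact: measurable_normal_pdf.
apply: ae_eq_integral => //.
- exact: emeasurable_funM.
- exact: emeasurable_funM.
apply: ae_eqe_mul2l.
apply: integral_ae_eq => //.
  exact: (Radon_Nikodym_SigmaFinite.f_integrable (normal_prob_dominates m s)).
move=> E _ mE.
by rewrite -(Radon_Nikodym_SigmaFinite.f_integral (normal_prob_dominates m s) mE).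
Qed.

Lemma integrable_normal_prob (f : R -> R) :
  measurable_fun setT f ->
  mu.-integrable setT (EFin \o (fun x => f x * normal_pdf m s x)) ->
  nu.-integrable setT (EFin \o f).
Proof.
move=> mf /integrableP[_ fi]; apply/integrableP; split; first exact/measurable_EFinP.
rewrite ge0_integral_normal_prob //; last first.
  by apply: measurableT_comp => //; exact/measurable_EFinP.
apply: le_lt_trans fi; rewrite le_eqVlt; apply/orP; left; apply/eqP.
apply: eq_integral => x _ /=.
by rewrite normrM EFinM (ger0_norm (normal_pdf_ge0 _ _ _)).
Qed.

Lemma Rintegral_normal_prob (f : R -> R) :
  measurable_fun setT f -> nu.-integrable setT (EFin \o f) ->
  \int[nu]_x f x = \int[mu]_x (f x * normal_pdf m s x).
Proof.
move=> mf fi; rewrite /Rintegral; congr fine.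
rewrite -(Radon_Nikodym_change_of_variables (normal_prob_dominates m s)) //.
have mpdf : measurable_fun setT (EFin \o normal_pdf m s).
  by apply/measurable_EFinP; exact: measurable_normal_pdf.
apply: ae_eq_integral => //.
- apply: emeasurable_funM; first exact/measurable_EFinP.
  apply: (measurable_int mu); apply: Radon_Nikodym_integrable.
  exact: (normal_prob_dominates m s).
- by apply/measurable_EFinP/measurable_funM => //; exact: measurable_normal_pdf.
have -> : (fun x => (f x * normal_pdf m s x)%:E) =
    (fun x => ((f x)%:E * (EFin \o normal_pdf m s) x)%E) by [].
apply: ae_eqe_mul2l.
apply: integral_ae_eq => //.
  by apply: Radon_Nikodym_integrable; exact: (normal_prob_dominates m s).
move=> E _ mE; rewrite -Radon_Nikodym_integral //.
exact: (normal_prob_dominates m s).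
Qed.

Lemma normal_pdf_val x : normal_pdf m s x =
  normal_peak s * expR (- (x - m) ^+ 2 / (s ^+ 2 *+ 2)).
Proof. by rewrite /normal_pdf (negPf s0). Qed.

Lemma sqr_gt0_s : 0 < s ^+ 2.
Proof. by rewrite exprn_even_gt0. Qed.

Lemma is_derive_normal_pdf (x : R) :
  is_derive x 1 (normal_pdf m s) (- ((x - m) / s ^+ 2) * normal_pdf m s x).
Proof.
have -> : normal_pdf m s = (fun x => normal_peak s * expR (- (x - m) ^+ 2 / (s ^+ 2 *+ 2))).
  by apply/funext => y; rewrite normal_pdf_val.
apply: is_derive_eq.
rewrite /GRing.scale /=; by field; rewrite ?s0.
Qed.

(** A power is absorbed by halving the exponent: with [y = x ^+ 2 / (4 s ^+ 2)],
    the factor exp y dominates y^(k+1)/(k+1)!. *)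
Lemma poly_exp_bound (k : nat) : exists C : R, forall x : R,
   `|x| ^+ k * expR (- x ^+ 2 / (s ^+ 2 *+ 2)) <= C * expR (- x ^+ 2 / (s ^+ 2 *+ 4)).
Proof.
have s4 : 0 < s ^+ 2 *+ 4 by rewrite pmulrn_lgt0 // sqr_gt0_s.
exists (1 + (s ^+ 2 *+ 4) ^+ k.+1 * k.+1`!%:R) => x.
have -> : expR (- x ^+ 2 / (s ^+ 2 *+ 2)) =
    expR (- x ^+ 2 / (s ^+ 2 *+ 4)) * expR (- x ^+ 2 / (s ^+ 2 *+ 4)).
  rewrite -expRD; congr expR; by field; rewrite ?s0.
rewrite mulrA ler_wpM2r ?expR_ge0 //.
rewrite mulNr expRN ler_pdivrMr ?expR_gt0 //.
set y := x ^+ 2 / _.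
have y0 : 0 <= y by rewrite divr_ge0 ?sqr_ge0 ?(ltW s4).
have := expR_ge1Dxn k y0; set z := expR y => zy.
apply: (@le_trans _ _ (1 + `|x| ^+ (2 * k.+1))).
  by apply: expr_le1D => //; lia.
have -> : `|x| ^+ (2 * k.+1) = (s ^+ 2 *+ 4) ^+ k.+1 * k.+1`!%:R * (y ^+ k.+1 / k.+1`!%:R).
  rewrite exprM -normrX (ger0_norm (sqr_ge0 x)) /y expr_div_n; field.
  by rewrite expf_neq0 ?gt_eqF //= pnatr_eq0 -lt0n fact_gt0.
have fy : 0 <= y ^+ k.+1 / k.+1`!%:R by rewrite divr_ge0 ?exprn_ge0.
set a := _ ^+ k.+1 * _; have a0 : 0 <= a by rewrite mulr_ge0 ?exprn_ge0 // ltW.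
set w := _ / _ in zy fy *; nra.
Qed.

Lemma expR_normal_pdf (x : R) :
  expR (- (x - m) ^+ 2 / (s ^+ 2 *+ 4)) =
  (normal_peak (Num.sqrt 2 * s))^-1 * normal_pdf m (Num.sqrt 2 * s) x.
Proof.
have s20 : Num.sqrt 2 * s != 0 by rewrite mulf_neq0 // gt_eqF // sqrtr_gt0.
rewrite /normal_pdf (negPf s20) mulrA mulVf ?mul1r; last first.
  by rewrite gt_eqF // normal_peak_gt0.
rewrite /normal_fun exprMn sqr_sqrtr //; congr (expR (_ / _)); ring.
Qed.

Lemma poly_normal_pdf_bound (k : nat) : exists C : R, forall x : R,
  `|x - m| ^+ k * normal_pdf m s x <= C * normal_pdf m (Num.sqrt 2 * s) x.
Proof.
have [C HC] := poly_exp_bound k.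
exists (normal_peak s * C * (normal_peak (Num.sqrt 2 * s))^-1) => x.
rewrite normal_pdf_val mulrCA -!mulrA ler_wpM2l ?normal_peak_ge0 //.
by rewrite -expR_normal_pdf.
Qed.

Lemma integrable_poly_normal_pdf (k : nat) :
  mu.-integrable setT (EFin \o (fun x => (x - m) ^+ k * normal_pdf m s x)).
Proof.
have [C HC] := poly_normal_pdf_bound k.
have s20 : Num.sqrt 2 * s != 0 by rewrite mulf_neq0 // gt_eqF // sqrtr_gt0.
apply: (@le_integrableR _ _ _ mu setT measurableT _ (fun x => C * normal_pdf m (Num.sqrt 2 * s) x)).
- apply/measurable_funM; last exact: measurable_normal_pdf.
  by apply: measurable_funX; exact: measurable_funB.
- move=> x _ /=; rewrite normrM normrX (ger0_norm (normal_pdf_ge0 _ _ _)).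
  exact: HC.
- by apply: integrableZlR => //; exact: integrable_normal_pdf.
Qed.

Lemma poly_normal_pdf_cvg0 (k : nat) (y : nat -> R) :
  (forall n, `|y n| = n.+1%:R) ->
  (y n ^+ k * normal_pdf m s (m + y n)) @[n --> \oo] --> (0 : R).
Proof.
move=> yn; have [C HC] := poly_normal_pdf_bound k.+1.
have s20 : Num.sqrt 2 * s != 0 by rewrite mulf_neq0 // gt_eqF // sqrtr_gt0.
set p := normal_peak (Num.sqrt 2 * s).
apply: (@cvg_abs0_near _ _ (fun n => `|C| * p * n.+1%:R^-1)).
  apply: nearW => n; rewrite normrM normrX (ger0_norm (normal_pdf_ge0 _ _ _)).
  have := HC (m + y n); rewrite addrAC subrr add0r => h.
  rewrite ler_pdivlMr ?ltr0n // mulrC mulrA -(yn n) -exprS; apply: (le_trans h).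
  apply: (@le_trans _ _ (`|C| * normal_pdf m (Num.sqrt 2 * s) (m + y n))).
    by rewrite ler_wpM2r ?normal_pdf_ge0 // ler_norm.
  by rewrite ler_wpM2l // normal_pdf_ub.
rewrite -[X in _ --> X](mulr0 (`|C| * p)); apply: cvgMr; exact: cvg_harmonic.
Qed.

(** The density satisfies f' = - ((x - m) / s^2) f, so that the difference of
    the two sides is the integral of the derivative of - s^2 (x - m)^k f, which
    vanishes at infinity. *)
Lemma normal_pdf_recursion (k : nat) :
  \int[mu]_x ((x - m) ^+ k.+1 * normal_pdf m s x) =
  s ^+ 2 * k%:R * \int[mu]_x ((x - m) ^+ k.-1 * normal_pdf m s x).
Proof.
pose f (j : nat) (x : R) := (x - m) ^+ j * normal_pdf m s x.
pose F (x : R) : R := - s ^+ 2 * f k x.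
pose g (x : R) := f k.+1 x - s ^+ 2 * k%:R * f k.-1 x.
have s2 : s ^+ 2 != 0 by rewrite expf_neq0.
have dF (x : R) : is_derive x 1 F (g x).
  rewrite /F /f; have := is_derive_normal_pdf x => d1.
  have d2 : is_derive x 1 (fun y : R => (y - m) ^+ k) (k%:R * (x - m) ^+ k.-1).
    have d3 : is_derive x 1 (fun y : R => y - m) 1 by apply: is_derive_eq; rewrite subr0.
    have := is_deriveX k d3; rewrite /GRing.scale /= mulr1.
    by congr is_derive; apply/funext => y; rewrite fctE.
  apply: is_derive_eq; rewrite /GRing.scale /= /g /f [_ ^+ k.+1]exprS; by field.
have cpdf : continuous (normal_pdf m s) by exact: continuous_normal_pdf.
have cf j : continuous (f j).
  move=> x; apply: cvgM; last exact: cpdf.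
  apply: (cvg_comp (fun y : R => y - m) (fun y : R => y ^+ j)); last exact: exprn_continuous.
  by apply: cvgB; [exact: cvg_id|exact: cvg_cst].
have cg : continuous g.
  move=> x; apply: cvgB; first exact: cf.
  by apply: cvgM; [exact: cvg_cst|exact: cf].
have mg : measurable_fun setT g by exact: continuous_measurable_fun.
have ifj j : mu.-integrable setT (EFin \o f j) by exact: integrable_poly_normal_pdf.
have ig : mu.-integrable setT (EFin \o g).
  by apply: integrableBR => //; exact: integrableZlR.
have ftc n : \int[mu]_(x in `[m - n.+1%:R, m + n.+1%:R]) g x =
    F (m + n.+1%:R) - F (m - n.+1%:R).
  rewrite /Rintegral (@continuous_FTC2 _ g F) //.
  - by rewrite ltrD2l (lt_trans (_ : _ < 0)) ?oppr_lt0 ?ltr0n.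
  - exact: continuous_subspaceT.
  - split => [x _|  | ].
    + exact: ex_derive.
    + apply: cvg_at_right_filter; apply: differentiable_continuous.
      by apply/derivable1_diffP; exact: ex_derive.
    + apply: cvg_at_left_filter; apply: differentiable_continuous.
      by apply/derivable1_diffP; exact: ex_derive.
  - by move=> x _; rewrite derive1E; exact: derive_val.
have c1 : \int[mu]_(x in `[m - n.+1%:R, m + n.+1%:R]) g x @[n --> \oo] --> \int[mu]_x g x.
  under eq_cvg do rewrite Rintegral_mkcond.
  apply: (@dominated_cvgR _ _ _ mu setT measurableT _ _ (fun x => `|g x|)) => //.
  - move=> n; apply/(measurable_restrictT _ (measurable_itv _)).
    exact: measurable_funTS.
  - move=> x _; apply: cvg_near_cst.
    near=> n; rewrite patchE ifT // inE /= in_itv /=.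
    have : `|x - m| <= n.+1%:R.
      near: n; apply: filterS (nbhs_infty_ger `|x - m|) => n /le_trans; apply.
      by rewrite ler_nat.
    by rewrite ler_norml => /andP[h1 h2]; apply/andP; split; lra.
  - exact: integrable_norm.
  - by move=> n x _; rewrite patchE; case: ifP => // _; rewrite normr0.
have c0 (y : nat -> R) : (forall n, `|y n| = n.+1%:R) ->
    F (m + y n) @[n --> \oo] --> (0 : R).
  move=> yn; rewrite -[X in _ --> X](mulr0 (- s ^+ 2)); apply: cvgMr.
  have := @poly_normal_pdf_cvg0 k y yn.
  by apply: cvg_trans; apply: near_eq_cvg; near=> n; rewrite /f addrAC subrr add0r.
have c2 : \int[mu]_(x in `[m - n.+1%:R, m + n.+1%:R]) g x @[n --> \oo] --> (0 : R).
  have h1 := c0 (fun n => n.+1%:R) (fun n => ger0_norm (ler0n _ _)).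
  have h2 := c0 (fun n => - n.+1%:R) (fun n => etrans (normrN _) (ger0_norm (ler0n _ _))).
  have h3 := cvgB h1 h2; rewrite (subrr 0) in h3.
  have e : (fun n => \int[mu]_(x in `[m - n.+1%:R, m + n.+1%:R]) g x) =
    (fun n => F (m + n.+1%:R) - F (m - n.+1%:R)) by apply/funext => n; exact: ftc.
  rewrite e; exact: h3.
have : \int[mu]_x g x = 0 by apply: (cvg_unique _ c1 c2).
rewrite /g RintegralB //; last exact: integrableZlR.
rewrite RintegralZl // => /eqP; rewrite subr_eq0 => /eqP. exact.
Unshelve. all: by end_near. Qed.

End normal_density.

Section normal_law_moments.
Context {R : realType}.
Implicit Types (m v : R) (k : nat).

Lemma measurable_polyfun (u : {poly R}) : measurable_fun setT (fun x : R => u.[x]).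
Proof. by apply: continuous_measurable_fun; exact: continuous_horner. Qed.

Lemma normal_law0 m (v : R) : v == 0 -> normal_law m v =
  (@dirac _ (measurableTypeR R) m R : probability (measurableTypeR R) R).
Proof. by rewrite /normal_law => ->. Qed.

Lemma normal_law_neq0 m (v : R) : v != 0 -> normal_law m v = normal_prob m (Num.sqrt v).
Proof. by rewrite /normal_law => /negPf ->. Qed.

Lemma integrable_dirac m (f : R -> R) : measurable_fun setT f ->
  (@dirac _ (measurableTypeR R) m R : probability (measurableTypeR R) R).-integrable
    setT (EFin \o f).
Proof.
move=> mf; apply/integrableP; split; first exact/measurable_EFinP.
rewrite integral_dirac //; last by apply: measurableT_comp => //; exact/measurable_EFinP.
by rewrite diracT mul1e ltry.
Qed.

(** For v = 0 the law is a point mass and both sides vanish. *)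
Lemma normal_law_center_moment m v k : 0 <= v ->
  (normal_law m v).-integrable setT (EFin \o (fun x : R => (x - m) ^+ k)) /\
  \int[normal_law m v]_x ((x - m) ^+ k.+1) =
    v * k%:R * \int[normal_law m v]_x ((x - m) ^+ k.-1).
Proof.
move=> v0; have mX j : measurable_fun setT (fun x : R => (x - m) ^+ j).
  by apply: measurable_funX; exact: measurable_funB.
have [v00|vn0] := eqVneq v 0.
  rewrite normal_law0 ?v00 //; split; first exact: integrable_dirac.
  rewrite !mul0r /Rintegral integral_dirac //; last by apply/measurable_EFinP; exact: mX.
  by rewrite diracT mul1e /= subrr expr0n.
rewrite normal_law_neq0 //.
have s0 : Num.sqrt v != 0 by rewrite gt_eqF // sqrtr_gt0 lt_neqAle eq_sym vn0.
have iX j : (normal_prob m (Num.sqrt v)).-integrable setT (EFin \o (fun x : R => (x - m) ^+ j)).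
  by apply: integrable_normal_prob => //; exact: integrable_poly_normal_pdf.
split; first exact: iX.
by rewrite !Rintegral_normal_prob // normal_pdf_recursion // sqr_sqrtr.
Qed.

Lemma integrable_normal_law_poly (u : {poly R}) m v : 0 <= v ->
  (normal_law m v).-integrable setT (EFin \o (fun x : R => u.[x])).
Proof.
move=> v0.
have -> : (fun x : R => u.[x]) =
    (fun x => \sum_(i < size (u \Po ('X + m%:P))) (u \Po ('X + m%:P))`_i * (x - m) ^+ i).
  apply/funext => x; rewrite -horner_coef horner_comp hornerD hornerX hornerC.
  by rewrite subrK.
apply: integrable_sumR => // i; apply: integrableZlR => //.
by have [] := normal_law_center_moment m i v0.
Qed.

Lemma integrable_normal_law_pow k m v : 0 <= v ->
  (normal_law m v).-integrable setT (EFin \o (fun x : R => x ^+ k)).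
Proof.
move=> v0; have := integrable_normal_law_poly 'X^k m v0.
by congr integrable; apply/funext => x; rewrite /= hornerXn.
Qed.

Lemma normal_law_mean m v : 0 <= v -> \int[normal_law m v]_x x = m.
Proof.
move=> v0; have [_] := normal_law_center_moment m 0 v0; rewrite mulr0 mul0r.
under eq_Rintegral do rewrite expr1.
rewrite RintegralB //.
- rewrite Rintegral_prob_cst => /eqP.
  by rewrite subr_eq0 => /eqP.
- have := integrable_normal_law_poly 'X m v0.
  by apply: eq_integrable => // x _; rewrite /= hornerX.
- exact: finite_measure_integrable_cst.
Qed.

Lemma normal_law_moment v k : 0 <= v ->
  \int[normal_law 0 v]_x (x ^+ k.+1) = v * k%:R * \int[normal_law 0 v]_x (x ^+ k.-1).
Proof.
move=> v0; have [_ h] := normal_law_center_moment 0 k v0.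
rewrite -[LHS](_ : \int[normal_law 0 v]_x ((x - 0) ^+ k.+1) = _).
  by rewrite h; congr (_ * _); apply: eq_Rintegral => x _; rewrite subr0.
by apply: eq_Rintegral => x _; rewrite subr0.
Qed.

Lemma normal_law_moment0 v : \int[normal_law 0 v]_x (x ^+ 0) = 1 :> R.
Proof.
under eq_Rintegral do rewrite expr0.
exact: Rintegral_prob_cst.
Qed.

Lemma normal_law1 : normal_law 0 1 = normal_prob 0 1 :> probability (measurableTypeR R) R.
Proof. by rewrite normal_law_neq0 ?sqrtr1. Qed.

Lemma Rintegral_normal_prob_poly (u : {poly R}) :
  \int[@normal_prob R 0 1]_x u.[x] = gauss_mean u.
Proof.
have mom k : \int[normal_law 0 1]_x (x ^+ k) = gauss_moment R k.
  suff: \int[normal_law 0 1]_x (x ^+ k) = gauss_moment R k /\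
    \int[normal_law 0 1]_x (x ^+ k.+1) = gauss_moment R k.+1 by case.
  elim: k => [|k [IH1 IH2]]; split => //.
  - exact: normal_law_moment0.
  - by rewrite normal_law_moment // mulr0 mul0r.
  - by rewrite normal_law_moment // mul1r IH1.
have -> : \int[@normal_prob R 0 1]_x u.[x] = \int[normal_law 0 1]_x u.[x].
  by rewrite normal_law1.
rewrite /gauss_mean.
under eq_Rintegral do rewrite horner_coef.
rewrite Rintegral_sum // => [|i].
  apply: eq_bigr => i _; rewrite RintegralZl //.
    congr (_ * _); exact: mom.
  exact: integrable_normal_law_pow.
by apply: integrableZlR => //; exact: integrable_normal_law_pow.
Qed.

End normal_law_moments.

(** * Polynomials in the variables of a Gaussian process *)

Section laws.
Context d (T : measurableType d) (R : realType) (P : probability T R).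
Implicit Types (Y Z : T -> R).

(** Stated for functions rather than bundled random variables, so that it
    applies to linear combinations as they stand. *)
Definition has_law Y (nu : probability (measurableTypeR R) R) :=
  measurable_fun setT Y /\ forall A, measurable A -> pushforward P Y A = nu A.

Lemma ge0_integral_law Y nu (g : R -> \bar R) : has_law Y nu ->
  measurable_fun setT g -> (forall x, 0 <= g x)%E ->
  (\int[P]_w g (Y w) = \int[nu]_x g x)%E.
Proof.
move=> [mY lY] mg g0.
have mY' : @measurable_fun _ _ T (measurableTypeR R) setT Y by exact: mY.
pose Y' : {mfun T >-> measurableTypeR R} := MeasurableFun.Pack (MeasurableFun.Class (isMeasurableFun.Build _ _ _ _ _ mY')).
transitivity (\int[distribution P Y']_y g y)%E.
  by rewrite ge0_integral_distribution.
by apply: (@eq_measure_integral _ _ _ _ nu (distribution P Y')) => A mA _; exact: lY.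
Qed.

Lemma integrable_law Y nu (f : R -> R) : has_law Y nu ->
  measurable_fun setT f -> nu.-integrable setT (EFin \o f) ->
  P.-integrable setT (EFin \o (fun w => f (Y w))).
Proof.
move=> lY mf /integrableP[_ fi]; apply/integrableP; split.
  by apply/measurable_EFinP; apply: (measurableT_comp mf); case: lY.
rewrite (ge0_integral_law lY (g := fun x => (`|(f x)%:E|)%E)) //.
by apply: measurableT_comp => //; exact/measurable_EFinP.
Qed.

Lemma Rintegral_law Y nu (f : R -> R) : has_law Y nu ->
  measurable_fun setT f -> nu.-integrable setT (EFin \o f) ->
  \int[P]_w f (Y w) = \int[nu]_x f x.
Proof.
move=> lY mf fi; have fY := integrable_law lY mf fi; case: lY => mY lY.
have mY' : @measurable_fun _ _ T (measurableTypeR R) setT Y by exact: mY.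
pose Y' : {mfun T >-> measurableTypeR R} := MeasurableFun.Pack (MeasurableFun.Class (isMeasurableFun.Build _ _ _ _ _ mY')).
rewrite /Rintegral; congr fine.
transitivity (\int[distribution P Y']_y (f y)%:E)%E.
  by rewrite integral_distribution //; exact/measurable_EFinP.
by apply: (@eq_measure_integral _ _ _ _ nu (distribution P Y')) => A mA _; exact: lY.
Qed.

Lemma covariance_centered Y Z : ('E_P[Y] = 0)%E -> ('E_P[Z] = 0)%E ->
  covariance P Y Z = (\int[P]_w (Y w * Z w)%:E)%E.
Proof.
move=> EY EZ; rewrite covariance.unlock EY EZ expectation.unlock.
apply: eq_integral => w _ /=.
by congr (_%:E); rewrite /= !fctE /= !subr0.
Qed.

Definition all_moments Y := measurable_fun setT Y /\
  forall k, P.-integrable setT (EFin \o (fun w => Y w ^+ k)).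

Lemma all_moments_prod Y Z a b : all_moments Y -> all_moments Z ->
  P.-integrable setT (EFin \o (fun w => Y w ^+ a * Z w ^+ b)).
Proof.
move=> [mY iY] [mZ iZ].
apply: (@le_integrableR _ _ _ _ _ measurableT _ (fun w => Y w ^+ (a + a) + Z w ^+ (b + b))).
- by apply: measurable_funM; exact: measurable_funX.
- move=> w _; rewrite !exprD; set y := Y w ^+ a; set z := Z w ^+ b.
  rewrite ler_norml; apply/andP; split.
    by have := sqr_ge0 (y + z); have := sqr_ge0 y; have := sqr_ge0 z; nra.
  by have := sqr_ge0 (y - z); have := sqr_ge0 y; have := sqr_ge0 z; nra.
- exact: integrableDR.
Qed.

Lemma all_momentsM Y Z : all_moments Y -> all_moments Z ->
  all_moments (fun w => Y w * Z w).
Proof.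
move=> aY aZ; split; first by apply: measurable_funM; [case: aY|case: aZ].
move=> k; have := all_moments_prod k k aY aZ.
by congr integrable; apply/funext => w; rewrite /= exprMn.
Qed.

Lemma all_momentsD Y Z : all_moments Y -> all_moments Z ->
  all_moments (fun w => Y w + Z w).
Proof.
move=> aY aZ; split; first by apply: measurable_funD; [case: aY|case: aZ].
move=> k.
have -> : (fun w => (Y w + Z w) ^+ k) =
    (fun w => \sum_(i < k.+1) 'C(k, i)%:R * (Y w ^+ (k - i) * Z w ^+ i)).
  by apply/funext => w; rewrite exprDn; apply: eq_bigr => i _; rewrite mulr_natl.
by apply: integrable_sumR => // i; apply: integrableZlR => //; exact: all_moments_prod.
Qed.

Lemma all_moments_cst c : all_moments (fun=> c).
Proof. by split => // k; exact: finite_measure_integrable_cst. Qed.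

Lemma all_moments_integrable Y : all_moments Y -> P.-integrable setT (EFin \o Y).
Proof.
by move=> [_ /(_ 1%N)]; congr integrable; apply/funext => w; rewrite /= expr1.
Qed.

Lemma all_moments_law Y m v : 0 <= v -> has_law Y (normal_law m v) -> all_moments Y.
Proof.
move=> v0 lY; split; first by case: lY.
move=> k; apply: (integrable_law lY (f := fun x => x ^+ k)).
  by apply: measurable_funX.
exact: integrable_normal_law_pow.
Qed.

Lemma all_moments_mpoly N (Y : 'I_N -> T -> R) (p : {mpoly R[N]}) :
  (forall i, all_moments (Y i)) -> all_moments (fun w => p.@[fun i => Y i w]).
Proof.
move=> aY; elim/mpoly.mpolyind: p => [|c mm p _ _ IH].
  have -> : (fun w => 0.@[fun i => Y i w]) = (fun=> 0 : R).
    by apply/funext => w; rewrite mpoly.meval0.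
  exact: all_moments_cst.
have -> : (fun w => (c *: mpoly.mpolyX R mm + p).@[fun i => Y i w]) =
    (fun w => c * (\prod_(i <- index_enum 'I_N) Y i w ^+ mm i) + p.@[fun i => Y i w]).
  by apply/funext => w; rewrite mpoly.mevalD mpoly.mevalZ mpoly.mevalX.
apply: all_momentsD => //; apply: all_momentsM; first exact: all_moments_cst.
elim: (index_enum 'I_N) => [|i r IHr].
  have -> : (fun w => \prod_(i <- [::]) Y i w ^+ mm i) = (fun=> 1 : R).
    by apply/funext => w; rewrite big_nil.
  exact: all_moments_cst.
have -> : (fun w => \prod_(j <- i :: r) Y j w ^+ mm j) =
    (fun w => Y i w ^+ mm i * \prod_(j <- r) Y j w ^+ mm j).
  by apply/funext => w; rewrite big_cons.
apply: all_momentsM => //; elim: (mm i) => [|e IHe].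
  by have -> : (fun w => Y i w ^+ 0) = (fun=> 1 : R) by []; exact: all_moments_cst.
have -> : (fun w => Y i w ^+ e.+1) = (fun w => Y i w * Y i w ^+ e).
  by apply/funext => w; rewrite exprS.
exact: all_momentsM.
Qed.

End laws.

Section gaussian_process_mean.
Context d (T : measurableType d) (R : realType) (P : probability T R).
Variable X : nat -> {RV P >-> R}.
Hypothesis Xgauss : gaussian_process X.
Hypothesis Xstat : stationary X.
Hypothesis Xstd : standard X.

(** The index is shifted by one because sums run over X_1, ..., X_n. *)
Lemma linear_comb_law n (a : 'I_n -> R) : exists m v : R, 0 <= v /\
  has_law P (fun w => \sum_(i < n) a i * X i.+1 w) (normal_law m v).
Proof.
pose b (i : nat) := if i is j.+1 then (if insub j is Some k then a k else 0) else 0.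
have [m [v [v0 h]]] := Xgauss n.+1 b; exists m, v; split => //.
have e : (fun w => \sum_(i < n.+1) b i * X i w)%R = (fun w => \sum_(i < n) a i * X i.+1 w).
  apply/funext => w; rewrite big_ord_recl /= mul0r add0r; apply: eq_bigr => i _.
  by rewrite /= valK.
split.
  by apply: measurable_sum => i; apply: measurable_funM => //; exact: measurable_funP.
by move=> A mA; rewrite -e; exact: h.
Qed.

Lemma var_all_moments i : all_moments P (X i.+1).
Proof.
have [m [v [v0 h]]] := linear_comb_law (fun k : 'I_i.+1 => (k == ord_max)%:R).
apply: (all_moments_law v0).
have := h; congr has_law; apply/funext => w.
rewrite (bigD1 ord_max) //= eqxx mul1r big1 ?addr0 // => k km.
by rewrite (negPf km) mul0r.
Qed.

Definition process_mean n (p : {mpoly R[n]}) : R :=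
  \int[P]_w p.@[fun i : 'I_n => X i.+1 w].

Lemma integrable_process n (p : {mpoly R[n]}) :
  P.-integrable setT (EFin \o (fun w => p.@[fun i : 'I_n => X i.+1 w])).
Proof.
apply: all_moments_integrable; apply: all_moments_mpoly => i.
exact: var_all_moments.
Qed.

Lemma process_mean_is_linear n : linear_for *%R (@process_mean n).
Proof.
move=> c p q; rewrite /process_mean.
under eq_Rintegral do rewrite mpoly.mevalD mpoly.mevalZ.
rewrite RintegralD //; last 2 first.
- by apply: integrableZlR => //; exact: integrable_process.
- exact: integrable_process.
by rewrite RintegralZl //; exact: integrable_process.
Qed.

HB.instance Definition _ n := GRing.isLinear.Build R {mpoly R[n]} R *%R
  (@process_mean n) (@process_mean_is_linear n).

Let E n : {scalar {mpoly R[n]}} := @process_mean n.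

Lemma process_mean1 n : E n 1 = 1.
Proof.
rewrite /E /= /process_mean; under eq_Rintegral do rewrite mpoly.meval1.
exact: Rintegral_prob_cst.
Qed.

Lemma process_mean_ge0 n (p : {mpoly R[n]}) : (forall v, 0 <= p.@[v]) -> 0 <= E n p.
Proof. by move=> p0; apply: Rintegral_ge0 => w _. Qed.

Lemma process_meanX n (i : 'I_n) : E n 'x_i = 0.
Proof.
have [EX _] := Xstd i.+1.
rewrite /E /= /process_mean; under eq_Rintegral do rewrite mpoly.mevalXU.
by move: EX; rewrite unlock /Rintegral => ->.
Qed.

Lemma process_mean_form n (a : 'I_n -> R) k :
  E n (linear_form a ^+ k.+2) =
  k.+1%:R * E n (linear_form a ^+ 2) * E n (linear_form a ^+ k).
Proof.
have [m [v [v0 h]]] := linear_comb_law a.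
have mom j : E n (linear_form a ^+ j) = \int[normal_law m v]_x (x ^+ j).
  rewrite -(Rintegral_law h); last 2 first.
  - exact: measurable_funX.
  - exact: integrable_normal_law_pow.
  apply: eq_Rintegral => w _; rewrite mevalXn /linear_form meval_sum; congr (_ ^+ _).
  by apply: eq_bigr => i _; rewrite mpoly.mevalZ mpoly.mevalXU.
have m0 : m = 0.
  rewrite -(normal_law_mean m v0); have := mom 1%N.
  under [X in _ = X -> _]eq_Rintegral do rewrite expr1.
  move=> <-; rewrite expr1 /linear_form mean_sum big1 // => i _.
  by rewrite meanZ process_meanX mulr0.
rewrite !mom m0 !normal_law_moment // normal_law_moment0 /=; ring.
Qed.

Definition process_cov n (i k : 'I_n) : R := E n ('x_i * 'x_k).

(** Linear combinations are Gaussian by hypothesis, and the moments of a centered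
    normal law satisfy the recursion from which integration by parts follows. *)
Lemma process_gaussian_mean n : gaussian_mean (@process_cov n) (E n).
Proof.
have ibp := ibp_from_linear_forms (@process_mean1 n) (@process_meanX n) (@process_mean_form n).
split.
- exact: process_mean1.
- exact: process_mean_ge0.
- exact: ibp.
move=> i.
have [EX VX] := Xstd i.+1.
move: VX; rewrite /variance (covariance_centered EX EX) => VX.
rewrite /process_cov /E /= /process_mean.
under eq_Rintegral do rewrite mpoly.mevalM !mpoly.mevalXU.
by rewrite /Rintegral VX.
Qed.

Lemma process_covE rho n (i k : 'I_n) : autocorrelation X rho ->
  process_cov i k = rho `|i - k|%N.
Proof.
move=> Xrho; wlog ik : i k / (i <= k)%N.
  move=> H; have [/H//|/ltnW/H] := leqP i k.
  by rewrite /process_cov mulrC distnC.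
rewrite distnEr //; have [_ cov] := Xstat.
have [EX0 _] := Xstd 0; have EX j : ('E_P[X j] = 0)%E by have [] := Xstd j.
have := cov i.+1 (k - i)%N; rewrite (_ : (i.+1 + (k - i))%N = k.+1); last by lia.
rewrite !covariance_centered // => e.
have := Xrho (k - i)%N; rewrite unlock => r; rewrite r in e.
rewrite /process_cov /E /= /process_mean.
under eq_Rintegral do rewrite mpoly.mevalM !mpoly.mevalXU.
by rewrite /Rintegral e.
Qed.

End gaussian_process_mean.

(** * Moments and means of cosines *)

Section cosine_taylor.
Context {R : realType}.
Implicit Types (x y s t : R) (n k : nat).

Lemma ge0_of_derive (f f' : R -> R) y : (forall x, is_derive x 1 f (f' x)) -> f 0 = 0 ->
  (forall x, 0 <= x -> 0 <= f' x) -> 0 <= y -> 0 <= f y.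
Proof.
move=> df f0 f'0 y0; rewrite -f0; apply: (@ger0_derive1_ndecr _ f 0 y) => //.
- by move=> x; rewrite in_itv /= => /andP[/ltW x0 _]; rewrite derive1E derive_val; exact: f'0.
- apply: continuous_subspaceT => x; apply: differentiable_continuous.
  by apply/derivable1_diffP; exact: ex_derive.
Qed.

Lemma norm_le_of_derive (f f' g g' : R -> R) y : (forall x, is_derive x 1 f (f' x)) ->
  (forall x, is_derive x 1 g (g' x)) -> f 0 = 0 -> g 0 = 0 ->
  (forall x, 0 <= x -> `|f' x| <= g' x) -> 0 <= y -> `|f y| <= g y.
Proof.
move=> df dg f0 g0 fg y0; rewrite ler_norml; apply/andP; split.
  rewrite -subr_ge0 opprK addrC.
  apply: (@ge0_of_derive (fun x => g x + f x) (fun x => g' x + f' x)) => //.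
    by rewrite f0 g0 addr0.
  by move=> x /fg; rewrite ler_norml => /andP[]; lra.
rewrite -subr_ge0.
apply: (@ge0_of_derive (fun x => g x - f x) (fun x => g' x - f' x)) => //.
  by rewrite f0 g0 subr0.
by move=> x /fg; rewrite ler_norml => /andP[]; lra.
Qed.

(** Taylor polynomial at 0 of y |-> cos (y + s); each differentiation adds a
    quarter turn to the phase. *)
Definition cos_taylor s n : {poly R} :=
  \sum_(k < n) (cos (s + k%:R * (pi / 2)) / k`!%:R) *: 'X^k.

Lemma cos_taylorE s n y : (cos_taylor s n).[y] =
  \sum_(k < n) cos (s + k%:R * (pi / 2)) / k`!%:R * y ^+ k.
Proof. by rewrite horner_sum; apply: eq_bigr => k _; rewrite hornerZ hornerXn. Qed.

Lemma deriv_cos_taylor s n : (cos_taylor s n.+1)^`() = cos_taylor (s + pi / 2) n.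
Proof.
rewrite raddf_sum big_ord_recl /= derivZ derivXn mulr0n scaler0 add0r.
apply: eq_bigr => k _; rewrite derivZ derivXn /= /bump leq0n add1n /=.
rewrite -[X in _ *: X = _]scaler_nat scalerA add0n; congr (_ *: _).
have -> : s + k.+1%:R * (pi / 2) = s + pi / 2 + k%:R * (pi / 2).
  by rewrite -natr1 mulrDl mul1r (addrC _ (pi / 2)) addrA.
have k0 : k.+1%:R != 0 :> R by rewrite pnatr_eq0.
have f0 : k`!%:R != 0 :> R by rewrite pnatr_eq0 -lt0n fact_gt0.
rewrite factS natrM; move: k0 f0; set K := k.+1%:R; set F := k`!%:R => k0 f0.
by rewrite invfM [K^-1 * _]mulrC [X in X * K]mulrA divfK.
Qed.

(** The sign [e] treats the two half-lines at once.  Differentiating both sides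
    reduces degree [n.+1] to degree [n] with phase [s + pi / 2]. *)
Lemma cos_taylor_signed s n e y : `|e| = 1 -> 0 <= y ->
  `|cos (e * y + s) - (cos_taylor s n).[e * y]| <= y ^+ n / n`!%:R.
Proof.
move=> e1; elim: n s y => [|n IH] s y y0.
  by rewrite /cos_taylor big_ord0 horner0 subr0 expr0 divr1 cos_max.
apply: (@norm_le_of_derive (fun y => cos (e * y + s) - (cos_taylor s n.+1).[e * y])
  (fun y => e * (cos (e * y + (s + pi / 2)) - (cos_taylor (s + pi / 2) n).[e * y]))
  (fun y => y ^+ n.+1 / n.+1`!%:R) (fun y => y ^+ n / n`!%:R)) => //.
- move=> x; rewrite mulrBr; apply: is_deriveB.
    have : is_derive x 1 (fun y => cos (e * y + s)) (e * - sin (e * x + s)).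
      by apply: is_derive_eq; rewrite /GRing.scale /=; ring.
    by rewrite addrA cosDpihalf.
  have ex : is_derive x 1 (fun y => e * y) e.
    by apply: is_derive_eq; rewrite /GRing.scale /=; ring.
  rewrite -deriv_cos_taylor mulrC.
  exact: (is_derive1_comp (f := horner (cos_taylor s n.+1))).
- move=> x; have : is_derive x 1 (fun y => y ^+ n.+1 / n.+1`!%:R) (n.+1%:R * x ^+ n / n.+1`!%:R).
    have := is_derive_poly ((n.+1`!%:R)^-1 *: 'X^(n.+1)) x.
    have -> : horner ((n.+1`!%:R)^-1 *: 'X^(n.+1)) = (fun y => y ^+ n.+1 / n.+1`!%:R).
      by apply/funext => z; rewrite hornerZ hornerXn mulrC.
    by rewrite derivZ derivXn hornerZ hornerMn hornerXn /= mulrC -[x ^+ n *+ _]mulr_natl.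
  by rewrite factS natrM invfM mulrACA mulfV ?mul1r ?pnatr_eq0.
- rewrite cos_taylorE mulr0 big_ord_recl big1 => [|k _]; last by rewrite expr0n mulr0.
  by rewrite add0r mul0r addr0 expr0 divr1 mulr1 addr0 subrr.
- by rewrite expr0n mul0r.
- by move=> x x0; rewrite normrM e1 mul1r; exact: IH.
Qed.

Lemma cos_taylor_le s n y : `|cos (y + s) - (cos_taylor s n).[y]| <= `|y| ^+ n / n`!%:R.
Proof.
have [y0|/ltW y0] := leP 0 y.
  by have := @cos_taylor_signed s n 1 y (normr1 _) y0; rewrite mul1r (ger0_norm y0).
have yN : 0 <= - y by rewrite oppr_ge0.
have := @cos_taylor_signed s n (-1) (- y) _ yN.
by rewrite mulrNN mul1r (ler0_norm y0); apply; rewrite normrN normr1.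
Qed.

End cosine_taylor.

Section method_of_moments.
Context {R : realType}.
Implicit Types (s t v : R).

(** Interchange of limits: [a] is approximated, up to [r m], by sequences
    [A m] whose limits approximate [l] as well. *)
Lemma cvg_of_approximants (a : nat -> R) (A r : nat -> nat -> R) (A' r' : nat -> R) l :
  (\forall j \near \oo, forall m, `|a j - A m j| <= r m j) ->
  (forall m, A m @ \oo --> A' m) -> (forall m, r m @ \oo --> r' m) ->
  (forall m, `|l - A' m| <= r' m) -> r' @ \oo --> (0 : R) -> a @ \oo --> l.
Proof.
move=> aA cA cr lA r0; apply/cvgrPdist_le => e e0.
have e4 : 0 < e / 4 by lra.
have /cvgrPdist_le/(_ _ e4)[m _ /(_ m (leqnn m)) /= hm] := r0.
have /cvgrPdist_le/(_ _ e4) hA := cA m.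
have /cvgrPdist_le/(_ _ e4) hr := cr m.
near=> j.
have h1 : `|A' m - A m j| <= e / 4 by near: j.
have h2 : `|r' m - r m j| <= e / 4 by near: j.
have h3 : `|a j - A m j| <= r m j.
  have h : forall m, `|a j - A m j| <= r m j by near: j.
  exact: h.
have h4 := lA m.
move: hm h1 h2 h3 h4; rewrite sub0r normrN.
rewrite !ler_norml => /andP[? ?] /andP[? ?] /andP[? ?] /andP[? ?] /andP[? ?].
by apply/andP; split; lra.
Unshelve. all: by end_near. Qed.

Lemma exp_coeff_cvg0 (x : R) : (fun m => x ^+ m / m`!%:R) @ \oo --> (0 : R).
Proof. exact: (cvg_series_cvg_0 (is_cvg_series_exp_coeff x)). Qed.

(** The moment (2m)! / (2^m m!) v^m, divided by (2m)!. *)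
Lemma normal_even_moment v m : 0 <= v ->
  \int[normal_law 0 v]_x (x ^+ m.*2) / m.*2`!%:R = (v / 2) ^+ m / m`!%:R.
Proof.
move=> v0; elim: m => [|m IH]; first by rewrite normal_law_moment0 expr0.
rewrite doubleS normal_law_moment //= [_.+2`!]factS [_.+1`!]factS natrM natrM.
rewrite exprS factS natrM [(v / 2) * _ / _](_ : _ = v / 2 / m.+1%:R * ((v / 2) ^+ m / m`!%:R)).
  rewrite -IH; set I := \int[_]_x _.
  have f0 : m.*2`!%:R != 0 :> R by rewrite pnatr_eq0 -lt0n fact_gt0.
  have k1 : m.*2.+1%:R != 0 :> R by rewrite pnatr_eq0.
  have k2 : m.+1%:R != 0 :> R by rewrite pnatr_eq0.
  have -> : m.*2.+2%:R = 2 * m.+1%:R :> R by rewrite -doubleS -mul2n natrM.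
  move: f0 k1 k2; set F := m.*2`!%:R; set K := m.*2.+1%:R; set L := m.+1%:R.
  move: F K L I => F K L J f0 k1 k2.
  by field; rewrite f0 k1 k2.
by rewrite invfM; ring.
Qed.

(** The moments are polynomials in the variance. *)
Lemma normal_law_moment_cvg (v_ : nat -> R) v k : (forall L, 0 <= v_ L) -> 0 <= v ->
  v_ @ \oo --> v ->
  (fun L => \int[normal_law 0 (v_ L)]_x (x ^+ k)) @ \oo --> \int[normal_law 0 v]_x (x ^+ k).
Proof.
move=> v_0 v0 vv; pose I v k : R := \int[normal_law 0 v]_x (x ^+ k).
have I0 w : I w 0%N = 1 by exact: normal_law_moment0.
have IS w i : 0 <= w -> I w i.+1 = w * i%:R * I w i.-1 by exact: normal_law_moment.
change ((fun L => I (v_ L) k) @ \oo --> I v k).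
move: I I0 IS => I I0 IS.
have m0 : (fun L => I (v_ L) 0%N) @ \oo --> I v 0%N.
  rewrite I0; have -> : (fun L => I (v_ L) 0%N) = fun=> 1 by apply/funext => L; exact: I0.
  exact: cvg_cst.
have step i : (fun L => I (v_ L) i.-1) @ \oo --> I v i.-1 ->
    (fun L => I (v_ L) i.+1) @ \oo --> I v i.+1.
  move=> h; rewrite (IS v) //.
  have -> : (fun L => I (v_ L) i.+1) = (fun L => v_ L * i%:R * I (v_ L) i.-1).
    by apply/funext => L; exact: IS.
  by apply: cvgM => //; apply: cvgM => //; exact: cvg_cst.
suff : (fun L => I (v_ L) k) @ \oo --> I v k /\ (fun L => I (v_ L) k.+1) @ \oo --> I v k.+1.
  by case.
elim: k => [|k [h1 h2]]; first by split => //; exact: step.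
by split => //; exact: step.
Qed.

Section taylor_mean.
Context d (T : measurableType d) (P : probability T R).
Implicit Types (Y : T -> R).

Lemma measurable_cos_comp Y t s : measurable_fun setT Y ->
  measurable_fun setT (fun w => cos (t * Y w + s)).
Proof.
move=> mY; apply: (@measurableT_comp _ _ _ _ _ _ (fun x => cos (t * x + s))) => //.
apply: continuous_measurable_fun => x.
apply: (cvg_comp (fun y => t * y + s) cos); last exact: continuous_cos.
by apply: cvgD; [apply: cvgM; [exact: cvg_cst|exact: cvg_id]|exact: cvg_cst].
Qed.

Lemma integrable_bounded_mfun (Y : T -> R) M : measurable_fun setT Y ->
  (forall w, `|Y w| <= M) -> P.-integrable setT (EFin \o Y).
Proof.
move=> mY YM; apply: (@le_integrableR _ _ _ P setT measurableT _ (fun=> M)) => //.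
exact: finite_measure_integrable_cst.
Qed.

Definition taylor_mean (mom : nat -> R) t s n :=
  \sum_(k < n) cos (s + k%:R * (pi / 2)) / k`!%:R * (t ^+ k * mom k).

(** An even number of terms is taken, so that the remainder is a moment. *)
Lemma cos_mean_taylor Y t s m : all_moments P Y ->
  `|\int[P]_w cos (t * Y w + s) - taylor_mean (fun k => \int[P]_w (Y w ^+ k)) t s m.*2|
  <= t ^+ m.*2 * (\int[P]_w (Y w ^+ m.*2) / m.*2`!%:R).
Proof.
move=> [mY iY].
have iT k c : P.-integrable setT (EFin \o (fun w => c * Y w ^+ k)) by exact: integrableZlR.
have ic : P.-integrable setT (EFin \o (fun w => cos (t * Y w + s))).
  apply: (@integrable_bounded_mfun _ 1); first exact: measurable_cos_comp.
  by move=> w; exact: cos_max.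
have -> : taylor_mean (fun k => \int[P]_w (Y w ^+ k)) t s m.*2 =
    \int[P]_w (cos_taylor s m.*2).[t * Y w].
  transitivity (\int[P]_w (\sum_(k < m.*2) (cos (s + k%:R * (pi / 2)) / k`!%:R * t ^+ k) * Y w ^+ k)).
    rewrite Rintegral_sum //; apply: eq_bigr => k _; rewrite RintegralZl // mulrA //.
  apply: eq_Rintegral => w _; rewrite cos_taylorE; apply: eq_bigr => k _.
  by rewrite exprMn [RHS]mulrA.
have ip : P.-integrable setT (EFin \o (fun w => (cos_taylor s m.*2).[t * Y w])).
  under eq_fun do rewrite cos_taylorE.
  apply: integrable_sumR => // k; apply: (eq_integrable measurableT _ _ _ (iT k (cos (s + k%:R * (pi / 2)) / k`!%:R * t ^+ k))).
  by move=> w _ /=; congr (_%:E); rewrite exprMn [RHS]mulrA.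
rewrite -RintegralB // mulrA mulrC mulrA -RintegralZl //.
apply: (le_trans (le_normr_Rintegral measurableT _)); first exact: integrableBR.
apply: le_Rintegral => //; first by apply: integrable_norm; exact: integrableBR.
move=> w _; apply: (le_trans (cos_taylor_le _ _ _)).
rewrite normrM exprMn -!normrX !ger0_norm ?mulrA //.
- by rewrite [leRHS](_ : _ = t ^+ m.*2 * Y w ^+ m.*2 / m.*2`!%:R) //; ring.
- by rewrite -mul2n exprM exprn_ge0 // sqr_ge0.
- by rewrite -mul2n exprM exprn_ge0 // sqr_ge0.
Qed.

End taylor_mean.

Lemma taylor_mean_cvg (mom : nat -> nat -> R) (mom' : nat -> R) t s n :
  (forall k, (fun j => mom j k) @ \oo --> mom' k) ->
  (fun j => taylor_mean (mom j) t s n) @ \oo --> taylor_mean mom' t s n.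
Proof.
move=> h; apply: cvg_sumR => k.
by apply: cvgM; [exact: cvg_cst|apply: cvgM; [exact: cvg_cst|exact: h]].
Qed.

Lemma normal_law_all_moments v : 0 <= v ->
  all_moments (normal_law 0 v) (fun x : measurableTypeR R => x).
Proof. by move=> v0; split => // k; exact: integrable_normal_law_pow. Qed.

Lemma normal_remainder_cvg0 t v : 0 <= v ->
  (fun m => t ^+ m.*2 * (\int[normal_law 0 v]_x (x ^+ m.*2) / m.*2`!%:R)) @ \oo --> (0 : R).
Proof.
move=> v0; rewrite (_ : (fun m => _) = (fun m => (t ^+ 2 * (v / 2)) ^+ m / m`!%:R)).
  exact: exp_coeff_cvg0.
apply/funext => m; by rewrite normal_even_moment // [(t ^+ 2 * _) ^+ m]exprMn -[t ^+ 2 ^+ m]exprM mul2n mulrA.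
Qed.

(** Method of moments.  The Taylor polynomials converge with the moments; the
    remainders converge to those of the normal law, which are small. *)
Lemma cos_mean_cvg d (T : measurableType d) (P : probability T R) (Y : nat -> T -> R) v t s :
  0 <= v -> (\forall j \near \oo, all_moments P (Y j)) ->
  (forall k, (fun j => \int[P]_w (Y j w ^+ k)) @ \oo --> \int[normal_law 0 v]_x (x ^+ k)) ->
  (fun j => \int[P]_w cos (t * Y j w + s)) @ \oo --> \int[normal_law 0 v]_x cos (t * x + s).
Proof.
move=> v0 aY mY; have aN := normal_law_all_moments v0.
apply: (cvg_of_approximants
  (A := fun m j => taylor_mean (fun k => \int[P]_w (Y j w ^+ k)) t s m.*2)
  (r := fun m j => t ^+ m.*2 * (\int[P]_w (Y j w ^+ m.*2) / m.*2`!%:R))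
  (A' := fun m => taylor_mean (fun k => \int[normal_law 0 v]_x (x ^+ k)) t s m.*2)
  (r' := fun m => t ^+ m.*2 * (\int[normal_law 0 v]_x (x ^+ m.*2) / m.*2`!%:R))).
- by apply: filterS aY => j aYj m; exact: cos_mean_taylor.
- by move=> m; exact: taylor_mean_cvg.
- by move=> m; apply: cvgM; [exact: cvg_cst|apply: cvgM; [exact: mY|exact: cvg_cst]].
- by move=> m; exact: (cos_mean_taylor t s m aN).
- exact: normal_remainder_cvg0.
Qed.

Lemma normal_cos_mean_cvg (v_ : nat -> R) v t s : (forall L, 0 <= v_ L) -> 0 <= v ->
  v_ @ \oo --> v ->
  (fun L => \int[normal_law 0 (v_ L)]_x cos (t * x + s)) @ \oo -->
    \int[normal_law 0 v]_x cos (t * x + s).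
Proof.
move=> v_0 v0 vv; have aN := normal_law_all_moments v0.
apply: (cvg_of_approximants
  (A := fun m j => taylor_mean (fun k => \int[normal_law 0 (v_ j)]_x (x ^+ k)) t s m.*2)
  (r := fun m j => t ^+ m.*2 * (\int[normal_law 0 (v_ j)]_x (x ^+ m.*2) / m.*2`!%:R))
  (A' := fun m => taylor_mean (fun k => \int[normal_law 0 v]_x (x ^+ k)) t s m.*2)
  (r' := fun m => t ^+ m.*2 * (\int[normal_law 0 v]_x (x ^+ m.*2) / m.*2`!%:R))).
- by apply: nearW => j m; exact: (cos_mean_taylor t s m (normal_law_all_moments (v_0 j))).
- by move=> m; apply: taylor_mean_cvg => k; exact: normal_law_moment_cvg.
- move=> m; apply: cvgM; [exact: cvg_cst|apply: cvgM; last exact: cvg_cst].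
  exact: normal_law_moment_cvg.
- by move=> m; exact: (cos_mean_taylor t s m aN).
- exact: normal_remainder_cvg0.
Qed.

End method_of_moments.

(** * Toeplitz forms and the Fejer kernel *)

Section fejer.
Context {R : realType}.
Local Notation mu := (@lebesgue_measure R).
Local Notation I := (`](-pi)%R, pi[%classic : set R).
Implicit Types (f g w : R -> R) (n k : nat) (x : R).

Lemma measurable_period : @measurable _ (measurableTypeR R) I. Proof. exact: measurable_itv. Qed.
Hint Resolve measurable_period : core.

Lemma pi_pos : 0 < pi :> R. Proof. exact: pi_gt0. Qed.

Lemma mu_period : mu I = (pi *+ 2)%:E.
Proof.
rewrite lebesgue_measure_itv /= lte_fin ifT; last by have := pi_pos; lra.
by rewrite -EFinB opprK mulr2n.
Qed.

Lemma Rintegral_period_cst (c : R) : \int[mu]_(x in I) c = pi *+ 2 * c.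
Proof. by rewrite Rintegral_cst //= mu_period mulrC. Qed.

Lemma integrable_period_bounded f (M : R) : measurable_fun I f ->
  (forall x, I x -> `|f x| <= M) -> mu.-integrable I (EFin \o f).
Proof.
move=> mf fM; apply: measurable_bounded_integrable => //.
  by rewrite /= mu_period ltry.
by exists M; split; rewrite ?num_real // => x Mx y Iy /=; apply: (le_trans (fM y Iy)); exact: ltW.
Qed.

Lemma integrable_period_mul f w (M : R) : measurable_fun I w ->
  (forall x, I x -> `|w x| <= M) -> mu.-integrable I (EFin \o f) ->
  mu.-integrable I (EFin \o (fun x => w x * f x)).
Proof.
move=> mw wM fi.
apply: (@le_integrableR _ _ _ mu _ measurable_period _ (fun x => M * `|f x|)).
- by apply: measurable_funM => //; exact: measurable_integrableR fi.
- by move=> x Ix; rewrite normrM ler_wpM2r // wM.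
- by apply: integrableZlR => //; exact: integrable_norm.
Qed.

Lemma measurable_cos_mulT k : measurable_fun setT (fun x : R => cos (x * k%:R)).
Proof.
apply: continuous_measurable_fun => x.
apply: (cvg_comp (fun y => y * k%:R) cos); last exact: continuous_cos.
by apply: cvgM; [exact: cvg_id|exact: cvg_cst].
Qed.

Lemma measurable_sin_mulT k : measurable_fun setT (fun x : R => sin (x * k%:R)).
Proof.
apply: continuous_measurable_fun => x.
apply: (cvg_comp (fun y => y * k%:R) sin); last exact: continuous_sin.
by apply: cvgM; [exact: cvg_id|exact: cvg_cst].
Qed.

Lemma measurable_cos_mul k : measurable_fun I (fun x => cos (x * k%:R)).
Proof. exact: measurable_funTS (measurable_cos_mulT k). Qed.

Lemma measurable_sin_mul k : measurable_fun I (fun x => sin (x * k%:R)).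
Proof. exact: measurable_funTS (measurable_sin_mulT k). Qed.

Lemma sin_pi_mul k : sin (pi * k%:R) = 0 :> R.
Proof.
elim: k => [|k IH]; first by rewrite mulr0 sin0.
by rewrite -natr1 mulrDr mulr1 sinD IH sinpi mul0r mulr0 addr0.
Qed.

Lemma integral_cos_mul k : \int[mu]_(x in I) cos (x * k%:R) = (k == 0)%:R * (pi *+ 2).
Proof.
have [->|k0] := eqVneq k 0%N.
  rewrite mul1r -[RHS]mulr1 -Rintegral_period_cst.
  by apply: eq_Rintegral => x _; rewrite mulr0 cos0.
rewrite mul0r; have kR : k%:R != 0 :> R by rewrite pnatr_eq0.
pose F x : R := sin (x * k%:R) / k%:R.
have dF x : is_derive x 1 F (cos (x * k%:R)).
  by apply: is_derive_eq; rewrite /GRing.scale /=; field.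
have cc : continuous (fun x : R => cos (x * k%:R)).
  move=> x; apply: (cvg_comp (fun y => y * k%:R) cos); last exact: continuous_cos.
  by apply: cvgM; [exact: cvg_id|exact: cvg_cst].
have pp : - pi < pi :> R by have := pi_pos; lra.
have icos : mu.-integrable `[(- pi)%R, pi] (EFin \o (fun x : R => cos (x * k%:R))).
  apply: continuous_compact_integrable; first exact: segment_compact.
  exact: continuous_subspaceT.
rewrite (Rintegral_itv_bndo_bndc (a := BRight (- pi))); last first.
  by apply: integrableS icos => //; apply: subset_itv; rewrite bnd_simp.
rewrite Rintegral_itv_obnd_cbnd; last first.
  by apply: integrableS icos => //; apply: subset_itv; rewrite bnd_simp.
rewrite /Rintegral (@continuous_FTC2 _ (fun x => cos (x * k%:R)) F) //.
- by rewrite /F -EFinB /= mulNr sinN sin_pi_mul oppr0 !mul0r subrr.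
- exact: continuous_subspaceT.
- split => [x _|  | ].
  + exact: ex_derive.
  + apply: cvg_at_right_filter; apply: differentiable_continuous.
    by apply/derivable1_diffP; exact: ex_derive.
  + apply: cvg_at_left_filter; apply: differentiable_continuous.
    by apply/derivable1_diffP; exact: ex_derive.
- by move=> x _; rewrite derive1E; exact: derive_val.
Qed.

Lemma cos_dist (i k : nat) x : cos (x * (`|i - k|%N)%:R) =
  cos (x * i%:R) * cos (x * k%:R) + sin (x * i%:R) * sin (x * k%:R).
Proof.
rewrite -cosB; case: (leqP i k) => [ik|/ltnW ik].
  rewrite distnEr // natrB //; rewrite -cosN; congr cos; ring.
by rewrite distnEl // natrB //; congr cos; ring.
Qed.

(** The squared modulus of \sum_i v_i e^{i x sqrt(-1)}; for v = 1, n times the Fejer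
    kernel (up to normalization). *)
Definition trig_sqr n (v : 'I_n -> R) x : R :=
  (\sum_i v i * cos (x * i%:R)) ^+ 2 + (\sum_i v i * sin (x * i%:R)) ^+ 2.

Lemma trig_sqr_ge0 n (v : 'I_n -> R) x : 0 <= trig_sqr v x.
Proof. by rewrite addr_ge0 ?sqr_ge0. Qed.

Lemma trig_sqrE n (v : 'I_n -> R) x : trig_sqr v x =
  \sum_i \sum_k (v i * v k) * cos (x * (`|i - k|%N)%:R).
Proof.
rewrite /trig_sqr !expr2 !mulr_suml -big_split; apply: eq_bigr => i _ /=.
rewrite !mulr_sumr -big_split; apply: eq_bigr => k _ /=.
by rewrite cos_dist; ring.
Qed.

(** The quadratic form of the Toeplitz matrix with entries the cosine
    coefficients of [f] is an integral against [f]. *)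
Lemma Rintegral_trig_sqr n (v : 'I_n -> R) f : mu.-integrable I (EFin \o f) ->
  \int[mu]_(x in I) (trig_sqr v x * f x) =
  \sum_i \sum_k (v i * v k) * \int[mu]_(x in I) (cos (x * (`|i - k|%N)%:R) * f x).
Proof.
move=> fi.
have ic k : mu.-integrable I (EFin \o (fun x => cos (x * k%:R) * f x)).
  by apply: (@integrable_period_mul _ _ 1) => //; [exact: measurable_cos_mul|move=> x _; exact: cos_max].
under eq_Rintegral do rewrite trig_sqrE mulr_suml.
have ivc (i k : 'I_n) : mu.-integrable I
    (EFin \o (fun x => v i * v k * (cos (x * (`|i - k|%N)%:R) * f x))).
  by apply: integrableZlR => //; exact: ic.
transitivity (\int[mu]_(x in I)
    \sum_i \sum_k (v i * v k * (cos (x * (`|i - k|%N)%:R) * f x))).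
  apply: eq_Rintegral => x _; apply: eq_bigr => i _.
  by rewrite mulr_suml; apply: eq_bigr => k _; rewrite mulrA.
rewrite Rintegral_sum // => [|i]; last by apply: integrable_sumR => // k; exact: ivc.
apply: eq_bigr => i _; rewrite Rintegral_sum //.
by apply: eq_bigr => k _; rewrite RintegralZl //; exact: ic.
Qed.

Lemma measurable_trig_sqr n (v : 'I_n -> R) : measurable_fun I (trig_sqr v).
Proof.
by apply: measurable_funD; apply: measurable_funX; apply: measurable_sum => i;
  apply: measurable_funM => //; [exact: measurable_cos_mul|exact: measurable_sin_mul].
Qed.

Lemma trig_sqr_bounded n (v : 'I_n -> R) x :
  `|trig_sqr v x| <= \sum_i \sum_k `|v i * v k|.
Proof.
rewrite trig_sqrE; apply: (le_trans (ler_norm_sum _ _ _)); apply: ler_sum => i _.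
apply: (le_trans (ler_norm_sum _ _ _)); apply: ler_sum => k _.
by rewrite normrM ler_piMr // cos_max.
Qed.

Lemma integrable_trig_sqr n (v : 'I_n -> R) f : mu.-integrable I (EFin \o f) ->
  mu.-integrable I (EFin \o (fun x => trig_sqr v x * f x)).
Proof.
move=> fi; apply: (@integrable_period_mul _ _ (\sum_i \sum_k `|v i * v k|)) => //.
  exact: measurable_trig_sqr.
by move=> x _; exact: trig_sqr_bounded.
Qed.

Lemma integrable_period_cst (c : R) : mu.-integrable I (EFin \o (fun=> c)).
Proof. by apply: (@integrable_period_bounded _ `|c|). Qed.

Lemma Rintegral_trig_sqr1 n (v : 'I_n -> R) :
  \int[mu]_(x in I) trig_sqr v x = pi *+ 2 * \sum_i v i ^+ 2.
Proof.
have := Rintegral_trig_sqr v (integrable_period_cst 1).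
under eq_Rintegral do rewrite mulr1; move=> ->.
rewrite mulr_sumr; apply: eq_bigr => i _.
rewrite (bigD1 i) //= big1 => [|k ki]; under eq_Rintegral do rewrite mulr1; rewrite integral_cos_mul.
  by rewrite distnn eqxx mul1r addr0 -expr2 mulrC.
rewrite (_ : (_ == 0)%N = false) ?mul0r ?mulr0 //.
by rewrite distn_eq0 eq_sym; apply/negbTE.
Qed.

(** The norm of a Toeplitz form is at most 2 pi times the bound of its
    symbol. *)
Lemma trig_form_bound n (v : 'I_n -> R) f (M : R) : mu.-integrable I (EFin \o f) ->
  (forall x, I x -> `|f x| <= M) ->
  `|\int[mu]_(x in I) (trig_sqr v x * f x)| <= pi *+ 2 * M * \sum_i v i ^+ 2.
Proof.
move=> fi fM; rewrite mulrAC -Rintegral_trig_sqr1.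
have i1 : mu.-integrable I (EFin \o trig_sqr v).
  have := integrable_trig_sqr v (integrable_period_cst 1).
  by congr integrable; apply/funext => x; rewrite /= mulr1.
rewrite -RintegralZr //.
apply: (le_trans (le_normr_Rintegral _ _)) => //; first exact: integrable_trig_sqr.
apply: le_Rintegral => //.
- by apply: integrable_norm; exact: integrable_trig_sqr.
- have := integrableZlR measurable_period M i1.
  by congr integrable; apply/funext => x; rewrite /= mulrC.
- by move=> x Ix; rewrite normrM ger0_norm ?trig_sqr_ge0 // ler_wpM2l ?trig_sqr_ge0 // fM.
Qed.

(** The decay of the Fejer kernel away from 0: multiplying the geometric sum
    of the z^i, with z on the unit circle at angle x, by 1 - z telescopes; here in real coordinates. *)
Lemma trig_sqr_telescope n x :
  (1 - cos x) * trig_sqr (fun _ : 'I_n => 1) x <= 2.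
Proof.
pose A := \sum_(i < n) cos (x * i%:R); pose B := \sum_(i < n) sin (x * i%:R).
have AB : (1 - cos x) * A + sin x * B = 1 - cos (x * n%:R) /\
          (1 - cos x) * B - sin x * A = - sin (x * n%:R).
  rewrite /A /B; elim: (n) => [|m [IH1 IH2]].
    by split; rewrite !big_ord0 !mulr0 ?cos0 ?sin0 ?addr0 subrr ?oppr0.
  have xm : x * m.+1%:R = x * m%:R + x by rewrite -natr1 mulrDr mulr1.
  rewrite !big_ord_recr /= xm cosD sinD; split.
    by rewrite !mulrDr addrACA IH1; ring.
  by rewrite !mulrDr opprD addrACA IH2; ring.
have -> : trig_sqr (fun _ : 'I_n => 1) x = A ^+ 2 + B ^+ 2.
  by congr (_ ^+ 2 + _ ^+ 2); apply: eq_bigr => i _; rewrite mul1r.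
case: AB => h1 h2.
have e : ((1 - cos x) ^+ 2 + sin x ^+ 2) * (A ^+ 2 + B ^+ 2) =
    (1 - cos (x * n%:R)) ^+ 2 + sin (x * n%:R) ^+ 2.
  by rewrite -h1 -[sin (x * _)]opprK -h2; ring.
have c1 := cos2Dsin2 x; have c2 := cos2Dsin2 (x * n%:R).
have c3 := cos_geN1 (x * n%:R).
have sq y : (1 - cos y) ^+ 2 + sin y ^+ 2 = 2 * (1 - cos y) :> R.
  have -> : (1 - cos y) ^+ 2 + sin y ^+ 2 = 1 - 2 * cos y + (cos y ^+ 2 + sin y ^+ 2) by ring.
  by rewrite cos2Dsin2; ring.
by move: e; rewrite !sq -mulrA; set T := (1 - cos x) * _; lra.
Qed.

(** Where |x| <= D the oscillation of [w] is at most [e]; elsewhere the kernel is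
    at most 2 / (1 - cos D).  The last term only covers n = 0, where the kernel
    vanishes. *)
Lemma fejer_estimate w n (M e D : R) : measurable_fun I w ->
  (forall x, I x -> `|w x| <= M) -> 0 <= e -> 0 < D < pi ->
  (forall x, `|x| <= D -> `|w x - w 0| <= e) ->
  `|n%:R^-1 * \int[mu]_(x in I) (trig_sqr (fun _ : 'I_n => 1) x * w x) - pi *+ 2 * w 0|
  <= pi *+ 2 * e + n%:R^-1 * (pi *+ 2 * (4 * M / (1 - cos D))) + (n == 0)%:R * (pi *+ 2 * M).
Proof.
move=> mw wM e0 /andP[D0 Dpi] we.
have I0 : I 0 by rewrite /= in_itv /= oppr_lt0 pi_pos.
have M0 : 0 <= M by exact: le_trans (wM 0 I0).
have cD : cos D < 1.
  by rewrite -[ltRHS]cos0 ltr_cos // in_itv /= ?lexx ?pi_ge0 //; apply/andP; split; exact: ltW.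
have cD0 : 0 < 1 - cos D by rewrite subr_gt0.
set K := 4 * M / (1 - cos D).
have K0 : 0 <= K by rewrite divr_ge0 ?mulr_ge0 // ltW.
have [n0|n0] := eqVneq n 0%N.
  rewrite n0 invr0 !mul0r sub0r normrN addr0 mul1r normrM (ger0_norm (_ : 0 <= pi *+ 2)).
    apply: ler_wpDl; first by rewrite mulr_ge0 // mulrn_wge0 // pi_ge0.
    by rewrite ler_wpM2l ?wM // mulrn_wge0 // pi_ge0.
  by rewrite mulrn_wge0 // pi_ge0.
rewrite mul0r addr0; have nR : 0 < n%:R :> R by rewrite ltr0n lt0n.
set t := trig_sqr _.
have iw : mu.-integrable I (EFin \o w) by exact: integrable_period_bounded wM.
have it f : mu.-integrable I (EFin \o f) -> mu.-integrable I (EFin \o (fun x => t x * f x)).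
  exact: integrable_trig_sqr.
have ic := integrable_period_cst.
have t1 : \int[mu]_(x in I) t x = pi *+ 2 * n%:R.
  by rewrite Rintegral_trig_sqr1; under eq_bigr do rewrite expr1n; rewrite sumr_const card_ord.
have itt : mu.-integrable I (EFin \o t).
  have := it _ (ic 1); by congr integrable; apply/funext => x; rewrite /= mulr1.
have -> : n%:R^-1 * \int[mu]_(x in I) (t x * w x) - pi *+ 2 * w 0 =
    n%:R^-1 * \int[mu]_(x in I) (t x * (w x - w 0)).
  have -> : \int[mu]_(x in I) (t x * (w x - w 0)) =
      \int[mu]_(x in I) (t x * w x) - \int[mu]_(x in I) (t x * w 0).
    rewrite -RintegralB //; [|exact: it|exact: it].
    by apply: eq_Rintegral => x _; rewrite mulrBr.
  rewrite RintegralZr // t1; field; by rewrite gt_eqF.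
rewrite normrM ger0_norm ?invr_ge0 // mulrC ler_pdivrMr // mulrDl [n%:R^-1 * _]mulrC divfK ?gt_eqF //.
apply: (le_trans (le_normr_Rintegral measurable_period _)).
  by apply: it; apply: integrableBR.
have -> : pi *+ 2 * e * n%:R + pi *+ 2 * K = \int[mu]_(x in I) (t x * e + K).
  rewrite RintegralD //; last exact: it.
  by rewrite RintegralZr // t1 Rintegral_period_cst; ring.
apply: le_Rintegral => //.
- by apply: integrable_norm; apply: it; apply: integrableBR.
- by apply: integrableDR => //; exact: it.
move=> x Ix; rewrite normrM (ger0_norm (trig_sqr_ge0 _ _)).
have [xD|xD] := leP `|x| D.
  by apply: ler_wpDr => //; rewrite ler_wpM2l ?trig_sqr_ge0 // we.
apply: ler_wpDl; first by rewrite mulr_ge0 // trig_sqr_ge0.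
have cx : cos x <= cos D.
  rewrite -cos_norm ltW // ltr_cos // in_itv /=.
    by rewrite !ltW.
  by rewrite normr_ge0 /= ltW //; move: Ix; rewrite /= in_itv /= ltr_norml.
have w2 : `|w x - w 0| <= 2 * M.
  by apply: (le_trans (ler_normB _ _)); have := wM x Ix; have := wM 0 I0; lra.
have tl := trig_sqr_telescope n x.
rewrite -/t in tl.
have t0 : 0 <= t x := trig_sqr_ge0 _ _.
rewrite /K ler_pdivlMr //.
have : (1 - cos D) * t x <= 2.
  by apply: le_trans tl; rewrite ler_wpM2r // lerD2l lerN2.
have : 0 <= `|w x - w 0| by [].
move: w2; set W := `|_|; set c := 1 - cos D => w2 W0 h.
have := ler_pM W0 (_ : 0 <= c * t x) w2 h; rewrite mulr_ge0 ?(ltW cD0) // => /(_ isT).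
by rewrite (_ : t x * W * c = W * (c * t x)); [lra|ring].
Qed.

Lemma fejer_cvg w (M : R) : measurable_fun I w ->
  (forall x, I x -> `|w x| <= M) -> {for 0, continuous w} ->
  (fun n => n%:R^-1 * \int[mu]_(x in I) (trig_sqr (fun _ : 'I_n => 1) x * w x)) @ \oo
    --> pi *+ 2 * w 0.
Proof.
move=> mw wM cw; apply/cvgrPdist_le => eps eps0.
have I0 : I 0 by rewrite /= in_itv /= oppr_lt0 pi_pos.
have M0 : 0 <= M by exact: le_trans (wM 0 I0).
have pp := pi_pos.
pose e := eps / (pi *+ 4).
have e0 : 0 < e by rewrite divr_gt0 // mulrn_wgt0.
have pe : pi *+ 2 * e = eps / 2.
  by rewrite /e; move: pp; generalize (@pi R) => p pp; field; rewrite gt_eqF.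
have /cvgrPdist_le/(_ _ e0)/nbhs_ballP[r /= r0 hr] := cw.
pose D := Num.min (r / 2) 1.
have D0 : 0 < D by rewrite lt_min divr_gt0 //=.
have Dpi : D < pi.
  by apply: (@le_lt_trans _ _ 1); [rewrite ge_min lexx orbT|have := pi_ge2 R; lra].
have Dr : D < r by rewrite gt_min; apply/orP; left; lra.
have we x : `|x| <= D -> `|w x - w 0| <= e.
  move=> xD; rewrite distrC; apply: hr; rewrite /ball /= sub0r normrN.
  exact: le_lt_trans xD Dr.
have est n := @fejer_estimate w n M e D mw wM (ltW e0) (introT andP (conj D0 Dpi)) we.
pose K := pi *+ 2 * (4 * M / (1 - cos D)).
near=> n; rewrite distrC; apply: (le_trans (est n)).
have n0 : (0 < n)%N by near: n; exact: nbhs_infty_gt.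
rewrite gtn_eqF // mul0r addr0 -/K.
rewrite pe.
suff : n%:R^-1 * K <= eps / 2 by lra.
have : 2 * K / eps <= n%:R by near: n; exact: nbhs_infty_ger.
rewrite ler_pdivrMr // => h; rewrite mulrC ler_pdivrMr ?ltr0n //; lra.
Unshelve. all: by end_near. Qed.

End fejer.

(** * Integration over a period *)

Section translation.
Context {R : realType}.
Local Notation mu := (@lebesgue_measure R).
Local Notation RT := (measurableTypeR R).
Implicit Types (f w : R -> R) (c a : R).

Lemma measurable_reflect c : @measurable_fun _ _ RT RT setT (fun y : R => c - y).
Proof. by apply: measurable_funB => //; exact: measurable_cst. Qed.

(** Lebesgue measure is determined by its values on intervals. *)
Lemma lebesgue_reflect c (A : set RT) : measurable A ->
  mu A = pushforward mu (fun y : R => c - y) A.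
Proof.
pose phi : {mfun RT >-> RT} := MeasurableFun.Pack
  (MeasurableFun.Class (isMeasurableFun.Build _ _ _ _ _ (measurable_reflect c))).
apply: (@lebesgue_measure_unique R (pushforward mu phi)) => X [[b d] _ <-].
transitivity (mu `[c - d, c - b[%classic).
  rewrite !lebesgue_measure_itv /= !lte_fin ltrD2l ltrN2; case: ifP => // _.
  by rewrite -!EFinB; congr EFin; ring.
rewrite /pushforward; congr (lebesgue_measure _).
by apply/seteqP; split => y /=; rewrite !in_itv /= => /andP[h1 h2]; apply/andP; split; lra.
Qed.

Lemma Rintegral_reflect c f (D : set RT) : measurable D -> measurable_fun setT f ->
  mu.-integrable D (EFin \o f) ->
  mu.-integrable [set y | D (c - y)] (EFin \o (fun y => f (c - y))) /\
  \int[mu]_(y in [set y | D (c - y)]) f (c - y) = \int[mu]_(x in D) f x.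
Proof.
move=> mD mf fi.
pose phi : {mfun RT >-> RT} := MeasurableFun.Pack
  (MeasurableFun.Class (isMeasurableFun.Build _ _ _ _ _ (measurable_reflect c))).
have mfE : @measurable_fun _ _ RT (\bar R) setT (EFin \o f) by exact/measurable_EFinP.
have mD' : @measurable _ RT [set y | D (c - y)].
  by rewrite -[X in measurable X]setTI; exact: (measurable_reflect c measurableT mD).
have i1 : mu.-integrable [set y | D (c - y)] (EFin \o (fun y => f (c - y))).
  apply/integrableP; split.
    apply/measurable_EFinP; apply: measurable_funTS.
    exact: (measurableT_comp mf (measurable_reflect c)).
  move/integrableP : fi => [_]; apply: le_lt_trans; rewrite le_eqVlt; apply/orP; left; apply/eqP.
  transitivity (\int[pushforward mu phi]_(x in D) `|(EFin \o f) x|)%E.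
    rewrite ge0_integral_pushforward //.
    by apply: measurable_funTS; apply: measurableT_comp.
  by apply: eq_measure_integral => A mA _; exact: (esym (lebesgue_reflect c mA)).
split => //; rewrite /Rintegral; congr fine.
transitivity (\int[pushforward mu phi]_(x in D) (f x)%:E)%E.
  by rewrite integral_pushforward.
by apply: eq_measure_integral => A mA _; exact: (esym (lebesgue_reflect c mA)).
Qed.

(** A translation is the composition of two reflections. *)
Lemma Rintegral_translate a f (D : set RT) : measurable D -> measurable_fun setT f ->
  mu.-integrable D (EFin \o f) ->
  mu.-integrable [set x | D (x + a)] (EFin \o (fun x => f (x + a))) /\
  \int[mu]_(x in [set x | D (x + a)]) f (x + a) = \int[mu]_(x in D) f x.
Proof.
move=> mD mf fi; have [i1 <-] := Rintegral_reflect a mD mf fi.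
have mD' : @measurable _ RT [set y | D (a - y)].
  by rewrite -[X in measurable X]setTI; exact: (measurable_reflect a measurableT mD).
have mf' : measurable_fun setT (fun y : R => f (a - y)).
  exact: (measurableT_comp mf (measurable_reflect a)).
have [i2 <-] := Rintegral_reflect 0 mD' mf' i1.
have e : [set x | D (x + a)] = [set y | [set y0 | D (a - y0)] (0 - y)].
  by apply/seteqP; split => y /=; rewrite sub0r opprK addrC.
have e' : (fun y => f (a - (0 - y))) = (fun x => f (x + a)).
  by apply/funext => y; rewrite sub0r opprK addrC.
by rewrite e -e'.
Qed.

Local Notation I := (`](-pi)%R, pi[%classic : set R).

Lemma integrable_itv_bounded w (M b c : R) (s1 s2 : bool) :
  measurable_fun setT w -> (forall x, `|w x| <= M) ->
  mu.-integrable [set` Interval (BSide s1 b) (BSide s2 c)] (EFin \o w).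
Proof.
move=> mw wM; apply: measurable_bounded_integrable => //.
- by rewrite /= lebesgue_measure_itv; case: ifP => // _ /=; exact: ltry.
- exact: measurable_funTS.
- by exists M; split; rewrite ?num_real // => x Mx y Iy /=; apply: (le_trans (wM y)); exact: ltW.
Qed.

(** The part of the translated period that leaves the interval on the right
    comes back, by periodicity, on the left. *)
Lemma Rintegral_period_translate w (M a : R) : measurable_fun setT w ->
  (forall x, `|w x| <= M) -> periodic w (pi *+ 2) -> 0 <= a < pi *+ 2 ->
  \int[mu]_(x in I) w (x + a) = \int[mu]_(x in I) w x.
Proof.
move=> mw wM pw /andP[a0 a2]; have pp := @pi_gt0 R.
have iw b c s1 s2 : mu.-integrable [set` Interval (BSide s1 b) (BSide s2 c)] (EFin \o w).
  exact: integrable_itv_bounded wM.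
have mI b c : @measurable _ RT `]b, c[ by exact: measurable_itv.
have [_ h1] := Rintegral_translate a (mI (- pi + a) (pi + a)) mw (iw _ _ _ _).
rewrite (_ : [set x | _] = I) in h1; last first.
  by apply/seteqP; split => x /=; rewrite !in_itv /= => /andP[? ?]; apply/andP; split; lra.
rewrite h1.
have [_ h2] := Rintegral_translate (pi *+ 2) (mI pi (pi + a)) mw (iw _ _ _ _).
rewrite (_ : [set x | _] = `](- pi)%R, (- pi + a)[%classic) in h2; last first.
  by apply/seteqP; split => x /=; rewrite !in_itv /= mulr2n => /andP[? ?]; apply/andP; split; lra.
have h3 : \int[mu]_(x in `](- pi)%R, (- pi + a)[) w x = \int[mu]_(x in `]pi, (pi + a)[) w x.
  by rewrite -h2; apply: eq_Rintegral => x _; rewrite pw.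
have [->|an0] := eqVneq a 0; first by rewrite !addr0.
have a1 : 0 < a by rewrite lt_neqAle eq_sym an0.
have b1 : (BRight (- pi) <= BRight (- pi + a))%O by rewrite bnd_simp; lra.
have b2 : (BRight (- pi + a) <= BLeft (pi + a))%O by rewrite bnd_simp; lra.
have b3 : (BRight (- pi) <= BRight (pi : R))%O by rewrite bnd_simp; lra.
have b4 : (BRight pi <= BLeft (pi + a))%O by rewrite bnd_simp; lra.
have q1 := Rintegral_itvB (iw (- pi) (pi + a) false true) b1 b2.
have q2 := Rintegral_itvB (iw (- pi) (pi + a) false true) b3 b4.
have q3 := Rintegral_itv_bndo_bndc (iw (- pi) (- pi + a) false true).
have q4 := Rintegral_itv_bndo_bndc (iw (- pi) pi false true).
rewrite q4 -q1 -q3 h3 -q2; ring.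
Qed.

Lemma periodicz (g : R -> R) (p : R) (m : int) x : periodic g p -> g (x + p * m%:~R) = g x.
Proof.
move=> pg; case: m => m; first by rewrite -pmulrn mulr_natr periodicn.
rewrite NegzE mulrNz mulrN -(periodicn pg m.+1) -pmulrn mulr_natr; congr g; ring.
Qed.

Lemma Rintegral_period_shift w (M a : R) : measurable_fun setT w ->
  (forall x, `|w x| <= M) -> periodic w (pi *+ 2) ->
  \int[mu]_(x in I) w (x + a) = \int[mu]_(x in I) w x.
Proof.
move=> mw wM pw; have p2 : 0 < pi *+ 2 :> R by rewrite mulrn_wgt0 // pi_gt0.
pose m := Num.floor (a / (pi *+ 2)).
rewrite -(@Rintegral_period_translate w M (a + pi *+ 2 * (- m)%:~R)) //.
  by apply: eq_Rintegral => x _; rewrite addrA periodicz.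
have /andP[] := floor_itv (a / (pi *+ 2)).
rewrite -/m ler_pdivlMr // ltr_pdivrMr // intrD mulrNz mulrN.
by set z := m%:~R => h1 h2; apply/andP; split; lra.
Qed.

End translation.

Section bounded_fubini.
Context {R : realType}.
Local Notation mu := (@lebesgue_measure R).
Local Notation RT := (measurableTypeR R).
Local Notation I := (`](-pi)%R, pi[%classic : set R).

Lemma Rintegral_period_fubini (F : R -> R -> R) (M : R) :
  @measurable_fun _ _ (RT * RT)%type RT setT (fun z => F z.1 z.2) ->
  (forall x y, `|F x y| <= M) ->
  \int[mu]_(x in I) (\int[mu]_(y in I) F x y) =
  \int[mu]_(y in I) (\int[mu]_(x in I) F x y).
Proof.
move=> mF FM.
have mI : @measurable _ RT I by exact: measurable_itv.
have fI : (mu I < +oo)%E by rewrite /= mu_period ltry.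
pose G (z : RT * RT) : R := F z.1 z.2 * (\1_I z.1 * \1_I z.2).
have m1 : @measurable_fun _ _ (RT * RT)%type RT setT (fun z => \1_I z.1 : R).
  by apply: measurableT_comp; [exact: measurable_indic|exact: measurable_fst].
have m2 : @measurable_fun _ _ (RT * RT)%type RT setT (fun z => \1_I z.2 : R).
  by apply: measurableT_comp; [exact: measurable_indic|exact: measurable_snd].
have mG : @measurable_fun _ _ (RT * RT)%type RT setT G.
  by apply: measurable_funM => //; exact: measurable_funM.
have M0 : 0 <= M by exact: le_trans (FM 0 0).
have iG : (mu \x mu)%E.-integrable setT (EFin \o G).
  apply: (@le_integrableR _ _ _ (mu \x mu)%E setT measurableT _ (fun z => M * \1_(I `*` I) z)) => //.
    move=> z _; rewrite /G normrM; have -> : \1_(I `*` I) z = \1_I z.1 * \1_I z.2 :> R.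
      by rewrite !indicE in_setX; case: (z.1 \in I); case: (z.2 \in I); rewrite /= ?mulr1 ?mulr0.
    rewrite (ger0_norm (_ : 0 <= \1_I z.1 * \1_I z.2)) ?mulr_ge0 ?indicE //.
    by rewrite ler_wpM2r // mulr_ge0.
  apply: integrableZlR => //; apply/integrableP; split.
    by apply/measurable_EFinP; apply: measurable_indic; exact: measurableX.
  have -> : (\int[(mu \x mu)%E]_z `|(EFin \o \1_(I `*` I)) z| = \int[(mu \x mu)%E]_z (\1_(I `*` I) z)%:E)%E.
    by apply: eq_integral => z _; rewrite /= ger0_norm // indicE.
  rewrite integral_indic //; last exact: measurableX.
  rewrite setIT; apply: (@le_lt_trans _ _ (mu I * mu I)%E).
    rewrite le_eqVlt; apply/orP; left; apply/eqP; exact: (@product_measure1E _ _ RT RT R mu mu I I mI mI).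
  rewrite lte_mul_pinfty //.
  by rewrite fin_numElt fI andbT (lt_le_trans (ltNyr 0)).
have inner (f : R -> R) (c : R) : @measurable_fun _ _ RT RT setT f -> (forall x, `|f x| <= M) ->
    (\int[mu]_y (f y * (c * \1_I y))%:E)%E = (\int[mu]_(y in I) f y * c)%:E.
  move=> mf fM; have fi : mu.-integrable I (EFin \o f).
    by apply: (integrable_period_bounded (M := M)) => //; exact: measurable_funTS.
  rewrite -RintegralZr // /Rintegral fineK; last first.
    apply: integrable_fin_num => //.
    by apply: (@eq_integrable _ _ _ mu I mI (EFin \o (fun x => c * f x)));
      [move=> x _ /=; rewrite mulrC|exact: integrableZlR].
  rewrite [RHS]integral_mkcond; apply: eq_integral => y _.
  by rewrite patchE indicE; case: ifP => _; rewrite ?mulr1 ?mulr0.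
have mF1 x : @measurable_fun _ _ RT RT setT (F x).
  exact: (measurableT_comp mF (measurable_pair1 x)).
have mF2 y : @measurable_fun _ _ RT RT setT (F ^~ y).
  exact: (measurableT_comp mF (measurable_pair2 y)).
have := @Fubini _ _ RT RT R mu mu (EFin \o G) iG.
have Gx x y : G (x, y) = F x y * (\1_I x * \1_I y) by [].
have Gy x y : G (x, y) = F x y * (\1_I y * \1_I x) by rewrite Gx (mulrC (\1_I x)).
have -> : (\int[mu]_x \int[mu]_y (EFin \o G) (x, y) =
    \int[mu]_(x in I) (\int[mu]_(y in I) F x y)%:E)%E.
  rewrite [RHS]integral_mkcond; apply: eq_integral => x _ /=.
  under eq_integral do rewrite Gx.
  rewrite (inner (F x)) // patchE indicE; case: ifP => _; rewrite ?mulr1 ?mulr0 //.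
have -> : (\int[mu]_y \int[mu]_x (EFin \o G) (x, y) =
    \int[mu]_(y in I) (\int[mu]_(x in I) F x y)%:E)%E.
  rewrite [RHS]integral_mkcond; apply: eq_integral => y _ /=.
  under eq_integral do rewrite Gy.
  rewrite (inner (F ^~ y)) // patchE indicE; case: ifP => _; rewrite ?mulr1 ?mulr0 //.
by move=> e; rewrite /Rintegral [X in fine X]e.
Qed.

End bounded_fubini.

(** * Convolutions and their Fourier coefficients *)

Section convolution.
Context {R : realType}.
Local Notation mu := (@lebesgue_measure R).
Local Notation RT := (measurableTypeR R).
Local Notation I := (`](-pi)%R, pi[%classic : set R).
Implicit Types (u v g : R -> R).

Lemma le_Rintegral_norm (D : set RT) (f g : R -> R) : measurable D ->
  measurable_fun D f -> mu.-integrable D (EFin \o g) ->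
  (forall x, D x -> `|f x| <= g x) ->
  `|\int[mu]_(x in D) f x| <= \int[mu]_(x in D) g x.
Proof.
move=> mD mf ig fg; have fi : mu.-integrable D (EFin \o f) by exact: le_integrableR ig.
apply: (le_trans (le_normr_Rintegral mD fi)); apply: le_Rintegral => //.
exact: integrable_norm.
Qed.

Lemma subset_Rintegral (D D' : set RT) (f : R -> R) : measurable D -> measurable D' ->
  D `<=` D' -> mu.-integrable D' (EFin \o f) -> (forall x, 0 <= f x) ->
  \int[mu]_(x in D) f x <= \int[mu]_(x in D') f x.
Proof.
move=> mD mD' DD fi f0; have fiD := integrableS mD' mD DD fi.
rewrite /Rintegral fine_le ?integrable_fin_num //.
apply: ge0_subset_integral => //; first exact: (measurable_int mu).
by move=> x _; rewrite /= lee_fin.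
Qed.

(** Density of continuous functions in L1; truncating the approximant at the
    bound of [u] does not increase the error. *)
Lemma bounded_continuous_approx (D : set RT) u (M e : R) : measurable D ->
  (mu D < +oo)%E -> measurable_fun D u -> (forall x, `|u x| <= M) -> 0 < e ->
  exists v, [/\ continuous v, forall x, `|v x| <= M &
    \int[mu]_(x in D) `|u x - v x| <= e].
Proof.
move=> mD fD mu_ uM e0.
have ui : mu.-integrable D (EFin \o u).
  apply: measurable_bounded_integrable => //; exists M; split; rewrite ?num_real // => x Mx y _ /=.
  by apply: (le_trans (uM y)); exact: ltW.
have [g_ [gc gi g0]] := approximation_continuous_integrable mD fD ui.
have M0 : 0 <= M by exact: le_trans (uM 0).
have /fine_cvgP[_ /cvgrPdist_le/(_ e e0)[N _ /(_ N (leqnn N)) /=]] := g0.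
rewrite sub0r normrN => hN.
pose v x := Num.max (- M) (Num.min M (g_ N x)).
have vM x : `|v x| <= M.
  rewrite ler_norml /v le_max lexx /= ge_max ge_min lexx /= andbT.
  by rewrite (le_trans _ M0) // oppr_le0.
have cv : continuous v.
  move=> x; apply: (@continuous_max R R (fun=> - M) _ x); first exact: cvg_cst.
  by apply: (@continuous_min R R (fun=> M) _ x); [exact: cvg_cst|exact: gc].
exists v; split => //.
have uv x : `|u x - v x| <= `|u x - g_ N x|.
  have := uM x; rewrite ler_norml => /andP[u1 u2].
  rewrite /v /Num.max /Num.min; case: ifPn; case: ifPn; rewrite -?leNgt => h1 h2 //;
  by do 2 case: ger0P => ?; lra.
have iug : mu.-integrable D (EFin \o (fun x => `|u x - g_ N x|)).
  by apply: integrable_norm; apply: integrableBR.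
apply: (le_trans _ (le_trans (ler_norm _) hN)); apply: le_Rintegral => //.
apply: le_integrableR iug => //; last by move=> x _; rewrite normr_id.
apply: measurableT_comp => //; apply: measurable_funB => //.
by apply: measurable_funTS; exact: continuous_measurable_fun.
Qed.

Definition convol u g x := \int[mu]_(y in I) (u (x - y) * g y).

Lemma measurable_convol_arg u g x : measurable_fun setT u -> measurable_fun setT g ->
  measurable_fun I (fun y => u (x - y) * g y).
Proof.
move=> mu_ mg; apply: measurable_funTS; apply: measurable_funM => //.
exact: (measurableT_comp mu_ (measurable_reflect x)).
Qed.

Lemma convol_bounded u g (A B : R) x : measurable_fun setT u -> measurable_fun setT g ->
  (forall x, `|u x| <= A) -> (forall x, `|g x| <= B) ->
  `|convol u g x| <= pi *+ 2 * (A * B).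
Proof.
move=> mu_ mg uA gB; rewrite -Rintegral_period_cst; apply: le_Rintegral_norm.
- exact: measurable_period.
- exact: measurable_convol_arg.
- exact: integrable_period_cst.
- by move=> y _; rewrite normrM ler_pM.
Qed.

Lemma integrable_convol u g (A B : R) x : measurable_fun setT u -> measurable_fun setT g ->
  (forall x, `|u x| <= A) -> (forall x, `|g x| <= B) ->
  mu.-integrable I (EFin \o (fun y => u (x - y) * g y)).
Proof.
move=> mu_ mg uA gB; apply: (@integrable_period_bounded _ _ (A * B)).
  exact: measurable_convol_arg.
by move=> y _; rewrite normrM ler_pM.
Qed.

(** For continuous [u] this is dominated convergence.  In general [u] is replaced
    by a continuous function close to it in L1 on a segment that contains all
    translated periods near [x]; the error is uniform there because [g] is
    bounded. *)
Lemma convol_continuous u g (A B : R) : measurable_fun setT u -> measurable_fun setT g ->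
  (forall x, `|u x| <= A) -> (forall x, `|g x| <= B) -> continuous (convol u g).
Proof.
move=> mu_ mg uA gB x.
have mI := @measurable_period R.
have A0 : 0 <= A by exact: le_trans (uA 0).
have B0 : 0 <= B by exact: le_trans (gB 0).
have conv_cont v : continuous v -> (forall x, `|v x| <= A) ->
    convol v g z @[z --> x] --> convol v g x.
  move=> cv vA; apply/(@cvg_nbhsP _ R^o) => z zx.
  have mv : measurable_fun setT v by exact: continuous_measurable_fun.
  apply: (@dominated_cvgR _ _ _ mu I mI _ _ (fun=> A * B)).
  - by move=> n; exact: measurable_convol_arg.
  - exact: measurable_convol_arg.
  - move=> y _; apply: cvgM; last exact: cvg_cst.
    apply: (@cvg_comp _ _ _ (fun n => z n - y) v _ (nbhs (x - y))); last exact: cv.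
    by apply: cvgB => //; exact: cvg_cst.
  - exact: integrable_period_cst.
  - by move=> n y _; rewrite normrM ler_pM.
apply/cvgrPdist_le => e e0.
pose D : set RT := `[x - (pi + 1), x + (pi + 1)]%classic.
have mD : measurable D by exact: measurable_itv.
have fD : (mu D < +oo)%E by rewrite /= lebesgue_measure_itv; case: ifP => // _; exact: ltry.
have e'0 : 0 < e / (4 * (B + 1)) by rewrite divr_gt0 //; lra.
have [v [cv vA uv]] := bounded_continuous_approx mD fD (measurable_funTS mu_) uA e'0.
have mv : measurable_fun setT v by exact: continuous_measurable_fun.
have iD : mu.-integrable D (EFin \o (fun y => `|u y - v y|)).
  apply: integrable_norm; apply: integrableBR => //.
    exact: integrable_itv_bounded uA.
  exact: integrable_itv_bounded vA.
have muv : measurable_fun setT (fun y => `|u y - v y|).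
  by apply: measurableT_comp => //; exact: measurable_funB.
have key z : `|x - z| <= 1 -> `|convol u g z - convol v g z| <= e / 4.
  move=> xz.
  rewrite /convol -RintegralB //; [|exact: integrable_convol uA gB|exact: integrable_convol vA gB].
  pose D' : set RT := [set t | I (z - t)].
  have mD' : measurable D'.
    by rewrite -[X in measurable X]setTI; exact: (measurable_reflect z measurableT mI).
  have DD : D' `<=` D.
    move=> t; rewrite /D' /D /= !in_itv /= => /andP[t1 t2].
    by move: xz; rewrite ler_norml => /andP[x1 x2]; apply/andP; split; lra.
  have [iR eR] := Rintegral_reflect z mD' muv (integrableS mD mD' DD iD).
  have DI : [set y | D' (z - y)] = I.
    by apply/seteqP; split => y; rewrite /D' /= subKr.
  rewrite DI in iR eR.
  apply: (le_trans (@le_Rintegral_norm I _ (fun y => B * `|u (z - y) - v (z - y)|) mI _ _ _)).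
  - by apply: measurable_funB; exact: measurable_convol_arg.
  - exact: integrableZlR.
  - by move=> y _; rewrite -mulrBl normrM mulrC ler_wpM2r.
  rewrite RintegralZl // eR.
  apply: (@le_trans _ _ (B * (e / (4 * (B + 1))))).
    by rewrite ler_wpM2l // (le_trans _ uv) //; apply: subset_Rintegral.
  rewrite mulrCA ler_pM2l // invfM mulrCA -[leRHS]mulr1 ler_wpM2l ?invr_ge0 //.
  by rewrite ler_pdivrMr; lra.
have x1 : \forall z \near x, `|x - z| <= 1.
  exact: (@cvgr_dist_le _ R^o R (nbhs x) _ id x (@cvg_id _ (nbhs x)) 1 ltr01).
have e2 : 0 < e / 2 by lra.
have /cvgrPdist_le/(_ _ e2) hv := conv_cont v cv vA.
near=> z.
have z1 : `|x - z| <= 1 by near: z.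
have z2 : `|convol v g x - convol v g z| <= e / 2 by near: z.
have k1 := key z z1.
have k2 : `|convol u g x - convol v g x| <= e / 4 by apply: key; rewrite subrr normr0.
move: z2 k1 k2; rewrite !ler_norml => /andP[? ?] /andP[? ?] /andP[? ?].
by apply/andP; split; lra.
Unshelve. all: by end_near. Qed.

Lemma convol_periodic u g : periodic u (pi *+ 2) -> periodic (convol u g) (pi *+ 2).
Proof. by move=> pu x; rewrite /convol; apply: eq_Rintegral => y _; rewrite addrAC pu. Qed.

(** Fubini, then translation of the inner integral by [y]. *)
Lemma Rintegral_convol u g (e : R -> R) (A B E : R) : measurable_fun setT u -> measurable_fun setT g ->
  measurable_fun setT e ->
  (forall x, `|u x| <= A) -> (forall x, `|g x| <= B) -> (forall x, `|e x| <= E) ->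
  periodic u (pi *+ 2) -> periodic e (pi *+ 2) ->
  \int[mu]_(x in I) (e x * convol u g x) =
  \int[mu]_(y in I) (g y * \int[mu]_(x in I) (e (x + y) * u x)).
Proof.
move=> mu_ mg me uA gB eE pu pe.
have mI := @measurable_period R.
have A0 : 0 <= A by exact: le_trans (uA 0).
have E0 : 0 <= E by exact: le_trans (eE 0).
transitivity (\int[mu]_(x in I) \int[mu]_(y in I) (e x * (u (x - y) * g y))).
  apply: eq_Rintegral => x _; rewrite /convol RintegralZl //.
  exact: integrable_convol uA gB.
rewrite (@Rintegral_period_fubini _ _ (E * (A * B))); first last.
- by move=> x y; rewrite !normrM ler_pM ?mulr_ge0 // ler_pM.
- apply: measurable_funM.
    by apply: measurableT_comp => //; exact: measurable_fst.
  apply: measurable_funM.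
    apply: (@measurableT_comp _ _ _ (RT * RT)%type RT RT u _ (fun z : RT * RT => z.1 - z.2)) => //.
    by apply: measurable_funB; [exact: measurable_fst|exact: measurable_snd].
  by apply: measurableT_comp => //; exact: measurable_snd.
apply: eq_Rintegral => y; rewrite inE => Iy.
have mey : measurable_fun setT (fun x => e x * u (x - y)).
  apply: measurable_funM => //; apply: (measurableT_comp mu_).
  by apply: measurable_funB => //; exact: measurable_cst.
have eub x : `|e x * u (x - y)| <= E * A by rewrite normrM ler_pM.
rewrite -(@Rintegral_period_shift _ (fun x => e x * (u (x - y) * g y)) (E * A * B) y) //; first last.
- by move=> x; rewrite pe addrAC pu.
- by move=> x; rewrite mulrA normrM ler_pM.
- under eq_fun do rewrite mulrA.
  by apply: measurable_funM => //; exact: measurable_cst.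
have mey' : measurable_fun setT (fun x : R => e (x + y) * u x).
  apply: measurable_funM => //; apply: (measurableT_comp me).
  by apply: measurable_funD => //; exact: measurable_cst.
rewrite -RintegralZl //; last first.
  apply: (@integrable_period_bounded _ _ (E * A)); first exact: measurable_funTS.
  by move=> x _; rewrite normrM ler_pM.
by apply: eq_Rintegral => x _; rewrite addrK; ring.
Qed.

Lemma cos_mul_periodic k : periodic (fun x : R => cos (x * k%:R)) (pi *+ 2).
Proof. by move=> x; rewrite mulrDl (mulr_natr (pi *+ 2)) (periodicn (@cosD2pi R)). Qed.

Lemma sin_mul_periodic k : periodic (fun x : R => sin (x * k%:R)) (pi *+ 2).
Proof. by move=> x; rewrite mulrDl (mulr_natr (pi *+ 2)) (periodicn (@sinD2pi R)). Qed.

(** The Fourier coefficients of [u], without any normalizing factor, so that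
    convolution multiplies them; vanishing sine coefficients, as for the spectral
    density of a real process, make them real. *)
Definition fourier_cos u (a : nat -> R) := forall k,
  \int[mu]_(x in I) (cos (x * k%:R) * u x) = a k /\
  \int[mu]_(x in I) (sin (x * k%:R) * u x) = 0.

Lemma fourier_convol u g (a b : nat -> R) (A B : R) :
  measurable_fun setT u -> measurable_fun setT g ->
  (forall x, `|u x| <= A) -> (forall x, `|g x| <= B) -> periodic u (pi *+ 2) ->
  fourier_cos u a -> fourier_cos g b -> fourier_cos (convol u g) (fun k => a k * b k).
Proof.
move=> mu_ mg uA gB pu fu fg k; have [uc us] := fu k; have [gc gs] := fg k.
have mI := @measurable_period R.
have c1 x : `|cos x| <= 1 :> R by rewrite cos_max.
have s1 x : `|sin x| <= 1 :> R by rewrite sin_max.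
have ib (w : R -> R) (W : R) (e : R -> R) : measurable_fun setT w -> (forall x, `|w x| <= W) ->
   measurable_fun setT e -> (forall x, `|e x| <= 1) ->
   mu.-integrable I (EFin \o (fun x => e x * w x)).
  move=> mw wW me e1; apply: (@integrable_period_bounded _ _ W).
    by apply: measurable_funTS; exact: measurable_funM.
  by move=> x _; rewrite normrM -[leRHS]mul1r ler_pM.
have mc := @measurable_cos_mulT R k; have ms := @measurable_sin_mulT R k.
have icu := ib _ _ _ mu_ uA mc (fun x => c1 (x * k%:R)).
have isu := ib _ _ _ mu_ uA ms (fun x => s1 (x * k%:R)).
have icg := ib _ _ _ mg gB mc (fun x => c1 (x * k%:R)).
have isg := ib _ _ _ mg gB ms (fun x => s1 (x * k%:R)).
split.
- rewrite (@Rintegral_convol u g (fun x => cos (x * k%:R)) A B 1) //; last exact: cos_mul_periodic.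
  transitivity (\int[mu]_(y in I) (a k * (cos (y * k%:R) * g y))).
    apply: eq_Rintegral => y _.
    transitivity (g y * (cos (y * k%:R) * \int[mu]_(x in I) (cos (x * k%:R) * u x) -
                   sin (y * k%:R) * \int[mu]_(x in I) (sin (x * k%:R) * u x))).
      congr (_ * _); rewrite -!RintegralZl // -RintegralB //; try exact: integrableZlR.
      by apply: eq_Rintegral => x _; rewrite mulrDl cosD; ring.
    by rewrite uc us; ring.
  by rewrite RintegralZl // gc.
- rewrite (@Rintegral_convol u g (fun x => sin (x * k%:R)) A B 1) //; last exact: sin_mul_periodic.
  transitivity (\int[mu]_(y in I) (a k * (sin (y * k%:R) * g y))).
    apply: eq_Rintegral => y _.
    transitivity (g y * (sin (y * k%:R) * \int[mu]_(x in I) (cos (x * k%:R) * u x) +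
                   cos (y * k%:R) * \int[mu]_(x in I) (sin (x * k%:R) * u x))).
      congr (_ * _); rewrite -!RintegralZl // -RintegralD //; try exact: integrableZlR.
      by apply: eq_Rintegral => x _; rewrite mulrDl sinD; ring.
    by rewrite uc us; ring.
  by rewrite RintegralZl // gs mulr0.
Qed.

Lemma selfconvS g l : selfconv g l.+2 = convol (selfconv g l.+1) g.
Proof. by []. Qed.

Lemma selfconv_spec g (B : R) (r : nat -> R) l :
  measurable_fun setT g -> (forall x, `|g x| <= B) -> periodic g (pi *+ 2) ->
  fourier_cos g r ->
  [/\ measurable_fun setT (selfconv g l.+1),
      exists C, forall x, `|selfconv g l.+1 x| <= C,
      periodic (selfconv g l.+1) (pi *+ 2) &
      fourier_cos (selfconv g l.+1) (fun k => r k ^+ l.+1)].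
Proof.
move=> mg gB pg fg; elim: l => [|l [m1 [C uC] p1 f1]].
  split => //; first by exists B.
rewrite selfconvS; split.
- by apply: continuous_measurable_fun; exact: convol_continuous uC gB.
- by exists (pi *+ 2 * (C * B)) => x; exact: convol_bounded.
- exact: convol_periodic.
- move=> k; rewrite exprSr; exact: (fourier_convol m1 mg uC gB p1 f1 fg).
Qed.

Lemma selfconv_continuous g (B : R) (r : nat -> R) l :
  measurable_fun setT g -> (forall x, `|g x| <= B) -> periodic g (pi *+ 2) ->
  fourier_cos g r -> continuous (selfconv g l.+2).
Proof.
move=> mg gB pg fg; have [m1 [C uC] _ _] := selfconv_spec l mg gB pg fg.
exact: convol_continuous uC gB.
Qed.

(** The summands are the coefficients of [selfconv g l.+1], so that the double sum
    is the integral of the Fejer kernel against this function.  For one factor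
    continuity at 0 is a hypothesis; convolutions are continuous everywhere. *)
Lemma selfconv_fejer g (B : R) (r : nat -> R) l :
  measurable_fun setT g -> (forall x, `|g x| <= B) -> periodic g (pi *+ 2) ->
  fourier_cos g r -> {for 0, continuous g} ->
  (fun n : nat => n%:R^-1 * \sum_(i < n) \sum_(k < n) r `|i - k|%N ^+ l.+1) @ \oo
    --> pi *+ 2 * selfconv g l.+1 0.
Proof.
move=> mg gB pg fg cg; have [m1 [C uC] p1 f1] := selfconv_spec l mg gB pg fg.
have c1 : {for 0, continuous (selfconv g l.+1)}.
  by case: l m1 uC p1 f1 => // l _ _ _ _; exact: selfconv_continuous pg fg 0.
have := fejer_cvg (measurable_funTS m1) (fun x _ => uC x) c1.
rewrite (_ : (fun n => n%:R^-1 * \int[mu]_(x in I) _) =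
   (fun n : nat => n%:R^-1 * \sum_(i < n) \sum_(k < n) r `|i - k|%N ^+ l.+1)) //.
apply/funext => n; congr (_ * _); rewrite Rintegral_trig_sqr; last first.
  by apply: (@integrable_period_bounded _ _ C) => //; exact: measurable_funTS.
by apply: eq_bigr => i _; apply: eq_bigr => k _; rewrite !mul1r; exact: (f1 _).1.
Qed.

End convolution.

(** * Approximation by trigonometric polynomials *)

Inductive trig_poly (R : realType) : (R -> R) -> Prop :=
| TrigCos c t s : trig_poly (fun x => c * cos (t * x + s))
| TrigAdd p q : trig_poly p -> trig_poly q -> trig_poly (fun x => p x + q x).

Section trigonometric_approximation.
Context {R : realType}.
Local Notation mu := (@lebesgue_measure R).
Local Notation I := (`](-pi)%R, pi[%classic : set R).
Implicit Types (g p q : R -> R) (y e A M : R).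

Lemma trig_poly_sum (J : Type) (r : seq J) (F : J -> R -> R) :
  (forall i, trig_poly (F i)) -> trig_poly (fun x => \sum_(i <- r) F i x).
Proof.
move=> tF; elim: r => [|i r IH].
  rewrite (_ : (fun x => _) = fun x => 0 * cos (0 * x + 0)); first exact: TrigCos.
  by apply/funext => x; rewrite big_nil mul0r.
rewrite (_ : (fun x => _) = fun x => F i x + \sum_(j <- r) F j x); first exact: TrigAdd.
by apply/funext => x; rewrite big_cons.
Qed.

Lemma trig_polyZ c p : trig_poly p -> trig_poly (fun x => c * p x).
Proof.
elim=> [b t s|p1 p2 _ t1 _ t2].
  by rewrite (_ : (fun x => _) = fun x => (c * b) * cos (t * x + s)); [exact: TrigCos|
    apply/funext => x; rewrite mulrA].
rewrite (_ : (fun x => _) = fun x => c * p1 x + c * p2 x); first exact: TrigAdd.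
by apply/funext => x; rewrite mulrDr.
Qed.

Lemma trig_poly_dilate c p : trig_poly p -> trig_poly (fun x => p (c * x)).
Proof.
elim=> [b t s|p1 p2 _ t1 _ t2]; last exact: TrigAdd.
by rewrite (_ : (fun x => _) = fun x => b * cos ((t * c) * x + s)); [exact: TrigCos|
    apply/funext => x; rewrite mulrA].
Qed.

Lemma trig_poly_continuous p : trig_poly p -> continuous p.
Proof.
elim=> [c t s|p1 p2 _ c1 _ c2] x; last by apply: cvgD; [exact: c1|exact: c2].
apply: cvgM; first exact: cvg_cst.
apply: (cvg_comp (fun y => t * y + s) cos); last exact: continuous_cos.
by apply: cvgD; [apply: cvgM; [exact: cvg_cst|exact: cvg_id]|exact: cvg_cst].
Qed.

(** Heine's theorem, with an increment that may leave the segment. *)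
Lemma uniform_continuity_segment g (a b e : R) : continuous g -> 0 < e ->
  exists2 D : R, 0 < D & forall y x, a <= y <= b -> `|x| <= D -> `|g (x + y) - g y| <= e.
Proof.
move=> cg e0.
have /compact_near_coveringP K := @segment_compact R a b.
pose Q (D : R) y := forall x, `|x| <= D -> `|g (x + y) - g y| <= e.
have e2 : 0 < e / 2 by lra.
have := K R (0 : R)^'+ Q _ _; case => //.
  move=> y0 _; have /cvgrPdist_le/(_ _ e2)/nbhs_ballP[r /= r0 hr] := cg y0.
  have r4 : 0 < r / 4 by lra.
  near=> y D => x xD.
  have yr : `|y0 - y| <= r / 4.
    by near: y; exact: (@cvgr_dist_le _ R^o R (nbhs y0) _ id y0 (@cvg_id _ (nbhs y0)) _ r4).
  have Dr : D <= r / 4 by near: D; apply: nbhs_right_le.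
  have h1 : `|g y0 - g y| <= e / 2 by apply: hr; rewrite /ball /=; lra.
  have h2 : `|g y0 - g (x + y)| <= e / 2.
    apply: hr; rewrite /ball /=.
    have := ler_normB (y0 - y) x; rewrite -addrA -opprD (addrC y) => h.
    by move: xD => /= xD; apply: (le_lt_trans h); lra.
  move: h1 h2; rewrite !ler_norml => /andP[? ?] /andP[? ?]; apply/andP; split; lra.
move=> D0 /= D0p hD; exists (D0 / 2); first by lra.
move=> y x yab xD; apply: (hD (D0 / 2)) => //=; try lra.
  by rewrite sub0r normrN ger0_norm; lra.
Unshelve. all: by end_near. Qed.

(** The Cesaro mean of the Fourier series of [g]. *)
Definition fejer_mean g n y : R :=
  (pi *+ 2)^-1 * (n%:R^-1 *
    \int[mu]_(x in I) (trig_sqr (fun _ : 'I_n => 1) x * g (x + y))).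

Section fejer_mean.
Context (g : R -> R) (M : R).
Hypothesis cg : continuous g.
Hypothesis pg : periodic g (pi *+ 2).
Hypothesis gM : forall x, `|g x| <= M.

Let mg : measurable_fun setT g. Proof. exact: continuous_measurable_fun. Qed.

Let M0 : 0 <= M. Proof. exact: le_trans (gM 0). Qed.

Let mshift y : measurable_fun setT (fun x : R => g (x + y)).
Proof. by apply: (measurableT_comp mg); apply: measurable_funD => //; exact: measurable_cst. Qed.

Let ishift y : mu.-integrable I (EFin \o (fun x => g (x + y))).
Proof.
apply: (@integrable_period_bounded _ _ M); first exact: measurable_funTS.
by move=> x _; exact: gM.
Qed.

Lemma fejer_mean_bounded n y : `|fejer_mean g n y| <= M.
Proof.
have p2 : 0 < pi *+ 2 :> R by rewrite mulrn_wgt0 // pi_gt0.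
rewrite /fejer_mean !normrM !normfV normr_nat (gtr0_norm p2).
rewrite mulrC ler_pdivrMr //; have [->|n0] := posnP n.
  by rewrite invr0 mul0r mulr_ge0 // ltW.
rewrite mulrC ler_pdivrMr ?ltr0n //.
apply: (le_trans (@trig_form_bound _ _ _ _ M (ishift y) _)) => [x _|]; first exact: gM.
rewrite (_ : \sum_(k < n) 1 ^+ 2 = n%:R :> R) ?(mulrC M) //.
by rewrite -[in RHS](card_ord n) -sumr_const; apply: eq_bigr => k _; exact: expr1n.
Qed.

Lemma Rintegral_cos_shift k y : \int[mu]_(x in I) (cos (x * k%:R) * g (x + y)) =
  cos (y * k%:R) * \int[mu]_(x in I) (cos (x * k%:R) * g x) +
  sin (y * k%:R) * \int[mu]_(x in I) (sin (x * k%:R) * g x).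
Proof.
have im (e : R -> R) : measurable_fun I e -> (forall x, `|e x| <= 1) ->
    mu.-integrable I (EFin \o (fun x => e x * g x)).
  move=> me e1; apply: (@integrable_period_mul _ _ _ 1) => //.
  by have := ishift 0; congr (integrable _ _ (EFin \o _)); apply/funext => x; rewrite addr0.
have i1 := im _ (measurable_cos_mul k) (fun x => cos_max (x * k%:R)).
have i2 := im _ (measurable_sin_mul k) (fun x => sin_max (x * k%:R)).
pose w x := cos ((x - y) * k%:R) * g x.
transitivity (\int[mu]_(x in I) w (x + y)); first by apply: eq_Rintegral => x _; rewrite /w addrK.
rewrite (@Rintegral_period_shift _ w M y); last first.
- by move=> x; rewrite /w pg addrAC (cos_mul_periodic k).
- by move=> x; rewrite normrM -[leRHS]mul1r ler_pM // cos_max.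
- apply: measurable_funM => //; apply: (measurableT_comp (measurable_cos_mulT k)).
  by apply: measurable_funB => //; exact: measurable_cst.
rewrite -!RintegralZl // -RintegralD //; try exact: integrableZlR.
by apply: eq_Rintegral => x _; rewrite /w mulrBl cosB; ring.
Qed.

(** Translating the integral moves [y] from [g] into the cosines, where the
    addition formula separates it. *)
Lemma fejer_mean_trig n : trig_poly (fejer_mean g n).
Proof.
rewrite /fejer_mean; do 2 apply: trig_polyZ.
rewrite (_ : (fun y => _) = fun y => \sum_(i < n) \sum_(k < n) (1 * 1) *
    (\int[mu]_(x in I) (cos (x * (`|i - k|%N)%:R) * g (x + y)))); last first.
  by apply/funext => y; exact: (Rintegral_trig_sqr _ (ishift y)).
do 2 apply: trig_poly_sum => ?.
apply: trig_polyZ; set m := absz _.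
rewrite (_ : (fun y => _) = fun y =>
  \int[mu]_(x in I) (cos (x * m%:R) * g x) * cos (m%:R * y + 0) +
  \int[mu]_(x in I) (sin (x * m%:R) * g x) * cos (m%:R * y + (- (pi / 2)))).
  by apply: TrigAdd; exact: TrigCos.
apply/funext => y; rewrite Rintegral_cos_shift addr0 cosBpihalf; congr (_ + _).
  by rewrite mulrC (mulrC y).
by rewrite mulrC (mulrC y).
Qed.

Lemma fejer_mean_close e a b : 0 < e ->
  exists n, forall y, a <= y <= b -> `|fejer_mean g n y - g y| <= e.
Proof.
move=> e0; have e2 : 0 < e / 2 by lra.
have [D0 D00 hD] := uniform_continuity_segment a b cg e2.
have pp := @pi_gt0 R.
pose D := Num.min D0 1.
have D1 : 0 < D < pi.
  by rewrite lt_min D00 ltr01 /= gt_min; apply/orP; right; have := @pi_ge2 R; lra.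
pose c := 4 * M / (1 - cos D).
have hc : (fun n => n.+1%:R^-1 * c) @ \oo --> (0 : R).
  rewrite (_ : (fun n => _) = (fun n => c * n.+1%:R^-1)); last by apply/funext => n; rewrite mulrC.
  by apply: cvg_scale0; exact: (@cvg_harmonic R).
have /cvgrPdist_le/(_ _ e2)[N _ /(_ N (leqnn N)) /=] := hc.
rewrite sub0r normrN => hN.
exists N.+1 => y yab.
have := @fejer_estimate _ (fun x => g (x + y)) N.+1 M (e / 2) D
  (measurable_funTS (mshift y)) (fun x _ => gM _) (ltW e2) D1 _.
rewrite /= add0r mul0r addr0 -/c => h.
have {h} : `|N.+1%:R^-1 * \int[mu]_(x in I) (trig_sqr (fun _ : 'I_N.+1 => 1) x * g (x + y)) - pi *+ 2 * g y| <=
   pi *+ 2 * (e / 2) + N.+1%:R^-1 * (pi *+ 2 * c).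
  by apply: h => x xD; apply: hD => //; apply: (le_trans xD); rewrite /D ge_min lexx.
have p2 : 0 < pi *+ 2 :> R by rewrite mulrn_wgt0.
rewrite /fejer_mean; move: p2; set Q := pi *+ 2; set J := N.+1%:R^-1 * _; move=> p2 h.
have -> : Q^-1 * J - g y = Q^-1 * (J - Q * g y) by rewrite mulrBr mulKf // gt_eqF.
rewrite normrM normfV (gtr0_norm p2) mulrC ler_pdivrMr //.
apply: (le_trans h); rewrite [X in _ + X]mulrCA -mulrDr mulrC ler_pM2r //.
by rewrite [leRHS](splitr e) lerD2l; exact: le_trans (ler_norm _) hN.
Qed.

End fejer_mean.

(** On a segment a bounded continuous function agrees with a periodic one: it
    is unfolded through [x = asin (sin x)], with [sin x] truncated so that
    [asin] is evaluated where it is continuous.  The approximants are the Cesaro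
    means of the periodic function. *)
Lemma trig_approximation (phi : R -> R) A M e : continuous phi ->
  (forall x, `|phi x| <= M) -> 0 < A -> 0 < e ->
  exists q, [/\ trig_poly q, forall x, `|q x| <= M &
    forall x, `|x| <= A -> `|q x - phi x| <= e].
Proof.
move=> cphi phiM A0 e0; have p1 := @pihalf_ge1 R.
have ih (x : R) : `|x| <= 1 / 2 -> x \in `[- (pi / 2), pi / 2].
  by rewrite ler_norml in_itv /= => /andP[? ?]; apply/andP; split; lra.
have hh : `|1 / 2 : R| <= 1 / 2 by rewrite ger0_norm; lra.
pose s : R := sin (1 / 2).
have s1 : s < 1.
  have pih : pi / 2 \in `[- (pi / 2), pi / 2 : R] by rewrite in_itv /=; apply/andP; split; lra.
  by rewrite -sin_pihalf (ltr_sin (ih _ hh) pih); lra.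
have s0 : 0 < s.
  by rewrite -sin0 ltr_sin ?ih // ?normr0; lra.
pose clip t := Num.max (- s) (Num.min s t).
have clip_s t : - s <= clip t <= s.
  by rewrite /clip le_max lexx /= ge_max ge_min lexx /= andbT; lra.
have cclip : continuous clip.
  move=> x; apply: (@continuous_max R R (fun=> - s) _ x); first exact: cvg_cst.
  by apply: (@continuous_min R R (fun=> s) _ x); [exact: cvg_cst|exact: cvg_id].
pose g x := phi (2 * A * asin (clip (sin x))).
have cg : continuous g.
  move=> x; apply: (cvg_comp (fun x => 2 * A * asin (clip (sin x))) phi); last exact: cphi.
  apply: cvgM; first exact: cvg_cst.
  apply: (cvg_comp (fun x => clip (sin x)) asin).
    by apply: (@cvg_comp _ _ _ sin clip _ (nbhs (sin x))); [exact: continuous_sin|exact: cclip].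
  by apply: continuous_asin; have := clip_s (sin x) => /andP[? ?]; apply/andP; split; lra.
have pg : periodic g (pi *+ 2) by move=> x; rewrite /g sinD2pi.
have gM x : `|g x| <= M by exact: phiM.
have gE x : `|x| <= 1 / 2 -> g x = phi (2 * A * x).
  move=> x2; rewrite /g; congr (phi (_ * _)).
  have := x2; rewrite ler_norml => /andP[x3 x4].
  have u1 : sin x <= s by rewrite leNgt ltr_sin ?ih // -leNgt.
  have u2 : - s <= sin x.
    by rewrite -sinN leNgt ltr_sin ?ih // ?normrN // -leNgt; lra.
  by rewrite /clip (min_idPr u1) (max_idPr u2) sinK // ih.
have [n hn] := @fejer_mean_close g M cg gM e (- (1 / 2)) (1 / 2) e0.
have A2 : 2 * A != 0 by rewrite gt_eqF //; lra.
exists (fun x => fejer_mean g n ((2 * A)^-1 * x)); split.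
- by apply: trig_poly_dilate; exact: (fejer_mean_trig cg pg gM).
- by move=> x; exact: fejer_mean_bounded.
- move=> x xA; have xs : `|(2 * A)^-1 * x| <= 1 / 2.
    rewrite normrM normfV (@gtr0_norm _ (2 * A)); last by lra.
    by rewrite mulrC ler_pdivrMr; lra.
  have := hn ((2 * A)^-1 * x); rewrite -ler_norml (gE _ xs) mulVKf //.
  exact.
Qed.

End trigonometric_approximation.

(** * Convergence in distribution from means of cosines *)

Section weak_convergence.
Context {R : realType}.
Implicit Types (phi q : R -> R) (e A M V : R).

(** Beyond the segment both functions are bounded by [M], which the quadratic
    term dominates there; so a bound of the second moments replaces a tightness
    argument. *)
Lemma trig_approx_sqr phi q A M e x : (forall x, `|phi x| <= M) -> (forall x, `|q x| <= M) ->
  0 < A -> 0 < e -> (forall x, `|x| <= A -> `|q x - phi x| <= e) ->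
  `|q x - phi x| <= e + 2 * M / A ^+ 2 * x ^+ 2.
Proof.
move=> phiM qM A0 e0 h; have M0 : 0 <= M by exact: le_trans (qM 0).
have A2 : 0 < A ^+ 2 by exact: exprn_gt0.
have [xA|Ax] := leP `|x| A.
  apply: (le_trans (h x xA)); rewrite lerDl mulr_ge0 ?sqr_ge0 // divr_ge0 ?(ltW A2) //.
  by rewrite mulr_ge0.
apply: (@le_trans _ _ (2 * M)).
  by apply: (le_trans (ler_normB _ _)); rewrite mulr_natl mulr2n lerD.
rewrite ler_wpDl ?(ltW e0) // mulrAC ler_pdivlMr // ler_wpM2l ?mulr_ge0 //.
by rewrite -[leRHS]real_normK ?num_real // lerXn2r ?nnegrE // ltW.
Qed.

Lemma measurable_trig_poly q : trig_poly q -> measurable_fun setT q.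
Proof. by move=> tq; apply: continuous_measurable_fun; exact: trig_poly_continuous. Qed.

Section mean.
Context d (T : measurableType d) (P : probability T R).
Implicit Types (Y : T -> R).

Lemma integrable_comp_bounded phi M Y : measurable_fun setT phi ->
  (forall x, `|phi x| <= M) -> measurable_fun setT Y ->
  P.-integrable setT (EFin \o (fun w => phi (Y w))).
Proof.
move=> mphi phiM mY; apply: (@integrable_bounded_mfun _ _ _ _ _ M) => //.
exact: (measurableT_comp mphi mY).
Qed.

Lemma trig_mean_close phi q A M e Y V : measurable_fun setT phi -> measurable_fun setT q ->
  (forall x, `|phi x| <= M) -> (forall x, `|q x| <= M) ->
  0 < A -> 0 < e -> (forall x, `|x| <= A -> `|q x - phi x| <= e) ->
  measurable_fun setT Y -> P.-integrable setT (EFin \o (fun w => Y w ^+ 2)) ->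
  \int[P]_w (Y w ^+ 2) <= V ->
  `|\int[P]_w phi (Y w) - \int[P]_w q (Y w)| <= e + 2 * M / A ^+ 2 * V.
Proof.
move=> mphi mq phiM qM A0 e0 h mY iY YV.
have M0 : 0 <= M by exact: le_trans (qM 0).
have i1 := integrable_comp_bounded mphi phiM mY.
have i2 := integrable_comp_bounded mq qM mY.
rewrite distrC -RintegralB //.
apply: (le_trans (le_normr_Rintegral measurableT _)); first exact: integrableBR.
apply: (@le_trans _ _ (\int[P]_w (e + 2 * M / A ^+ 2 * Y w ^+ 2))).
  apply: le_Rintegral => //.
  - by apply: integrable_norm; exact: integrableBR.
  - apply: integrableDR => //; last exact: integrableZlR.
    exact: finite_measure_integrable_cst.
  - by move=> w _; exact: trig_approx_sqr.
rewrite RintegralD //; last 2 first.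
- exact: finite_measure_integrable_cst.
- exact: integrableZlR.
rewrite Rintegral_prob_cst RintegralZl // lerD2l ler_wpM2l //.
by apply: divr_ge0; rewrite ?sqr_ge0 // mulr_ge0.
Qed.

End mean.

Lemma trig_poly_mean_cvg d (T : measurableType d) (P : probability T R) (Y : nat -> T -> R)
    (nu : probability (measurableTypeR R) R) q : trig_poly q ->
  (forall j, measurable_fun setT (Y j)) ->
  (forall t s, (fun j => \int[P]_w cos (t * Y j w + s)) @ \oo --> \int[nu]_x cos (t * x + s)) ->
  (fun j => \int[P]_w q (Y j w)) @ \oo --> \int[nu]_x q x.
Proof.
move=> tq mY h.
have ib d' (T' : measurableType d') (P' : probability T' R) (Z : T' -> R) p : trig_poly p ->
    measurable_fun setT Z -> P'.-integrable setT (EFin \o (fun w => p (Z w))).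
  move=> tp mZ; have [M pM] : exists M, forall x, `|p x| <= M.
    elim: tp => [c t s|p1 p2 _ [M1 h1] _ [M2 h2]].
      by exists `|c| => x; rewrite normrM -[leRHS]mulr1 ler_wpM2l // cos_max.
    by exists (M1 + M2) => x; apply: (le_trans (ler_normD _ _)); rewrite lerD.
  by apply: integrable_comp_bounded pM mZ; exact: measurable_trig_poly.
have ic t s j : P.-integrable setT (EFin \o (fun w => cos (t * Y j w + s))).
  apply: (@integrable_bounded_mfun _ _ _ _ _ 1); first exact: measurable_cos_comp.
  by move=> w; exact: cos_max.
have icn t s : nu.-integrable setT (EFin \o (fun x : measurableTypeR R => cos (t * x + s))).
  apply: (@integrable_bounded_mfun _ _ _ _ _ 1); first exact: measurable_cos_comp.
  by move=> w; exact: cos_max.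
elim: tq => [c t s|p1 p2 t1 h1 t2 h2].
  rewrite RintegralZl //.
  have -> : (fun j => \int[P]_w (c * cos (t * Y j w + s))) =
      (fun j => c * \int[P]_w cos (t * Y j w + s)).
    by apply/funext => j; rewrite RintegralZl.
  by apply: cvg_scale; exact: h.
rewrite RintegralD //; [|exact: (ib _ _ nu id)|exact: (ib _ _ nu id)].
have -> : (fun j => \int[P]_w (p1 (Y j w) + p2 (Y j w))) =
    (fun j => \int[P]_w p1 (Y j w)) \+ (fun j => \int[P]_w p2 (Y j w)).
  by apply/funext => j /=; rewrite RintegralD //; exact: ib.
exact: cvgD.
Qed.

(** [phi] is approximated on [-m, m] with error 1/m by trigonometric polynomials
    with the bound of [phi]; their means converge by linearity. *)
Lemma cvg_in_distribution_of_cos d (T : measurableType d) (P : probability T R)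
    (Y : nat -> T -> R) (nu : probability (measurableTypeR R) R) V :
  (forall j, measurable_fun setT (Y j)) ->
  (\forall j \near \oo, P.-integrable setT (EFin \o (fun w => Y j w ^+ 2)) /\
     \int[P]_w (Y j w ^+ 2) <= V) ->
  nu.-integrable setT (EFin \o (fun x : R => x ^+ 2)) -> \int[nu]_x (x ^+ 2) <= V ->
  (forall t s, (fun j => \int[P]_w cos (t * Y j w + s)) @ \oo --> \int[nu]_x cos (t * x + s)) ->
  cvg_in_distribution P Y nu.
Proof.
move=> mY YV inu nuV h phi cphi [M phiM].
have mphi : measurable_fun setT phi by exact: continuous_measurable_fun.
have M0 : 0 <= M by exact: le_trans (phiM 0).
pose a (m : nat) : R := m.+1%:R.
have a0 m : 0 < a m by rewrite ltr0n.
have ai0 m : 0 < (a m)^-1 by rewrite invr_gt0.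
have /choice[q hq] : forall m, exists q, [/\ trig_poly q, forall x, `|q x| <= M &
    forall x, `|x| <= a m -> `|q x - phi x| <= (a m)^-1].
  by move=> m; exact: trig_approximation.
have mq m : measurable_fun setT (q m) by have [t _ _] := hq m; exact: measurable_trig_poly.
have key : (fun j => \int[P]_w phi (Y j w)) @ \oo --> \int[nu]_x phi x.
  apply: (cvg_of_approximants (A := fun m j => \int[P]_w q m (Y j w))
    (r := fun m j => (a m)^-1 + 2 * M / a m ^+ 2 * V)
    (A' := fun m => \int[nu]_x q m x)
    (r' := fun m => (a m)^-1 + 2 * M / a m ^+ 2 * V)).
  - near=> j => m; have [t1 t2 t3] := hq m.
    have [i1 i2] : P.-integrable setT (EFin \o (fun w => Y j w ^+ 2)) /\
       \int[P]_w (Y j w ^+ 2) <= V by near: j.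
    exact: trig_mean_close.
  - by move=> m; have [t1 t2 t3] := hq m; exact: trig_poly_mean_cvg.
  - by move=> m; exact: cvg_cst.
  - move=> m; have [t1 t2 t3] := hq m.
    exact: (@trig_mean_close _ _ nu phi (q m) (a m) M (a m)^-1 (fun x => x)).
  - apply: cvg_add0; first exact: (@cvg_harmonic R).
    have -> : (fun m => 2 * M / a m ^+ 2 * V) = (fun m => (2 * M * V) * ((a m)^-1 * (a m)^-1)).
      by apply/funext => m; rewrite expr2 invfM; ring.
    apply: cvg_scale0; have := cvgM (@cvg_harmonic R) (@cvg_harmonic R); rewrite mulr0.
    exact.
have iE d' (T' : measurableType d') (P' : probability T' R) (Z : T' -> R) :
    measurable_fun setT Z ->
    (\int[P']_w (phi (Z w))%:E = (\int[P']_w phi (Z w))%:E)%E.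
  move=> mZ; rewrite /Rintegral fineK //; apply: integrable_fin_num => //.
  exact: integrable_comp_bounded phiM mZ.
have -> : (\int[nu]_x (phi x)%:E)%E = (\int[nu]_x phi x)%:E by exact: (iE _ _ nu id).
have -> : (fun j => \int[P]_w (phi (Y j w))%:E)%E = (fun j => (\int[P]_w phi (Y j w))%:E).
  by apply/funext => j; exact: iE.
by apply: cvg_EFin; [exact: nearW|exact: key].
Unshelve. all: by end_near. Qed.

End weak_convergence.

(** * Convergence in mean square *)

Section square_integrable.
Context d (T : measurableType d) (R : realType) (P : probability T R).
Implicit Types (Y Z : T -> R).

Definition square_integrable Y := measurable_fun setT Y /\
  P.-integrable setT (EFin \o (fun w => Y w ^+ 2)).

Lemma square_integrable_mul Y Z : square_integrable Y -> square_integrable Z ->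
  P.-integrable setT (EFin \o (fun w => Y w * Z w)).
Proof.
move=> [mY iY] [mZ iZ].
apply: (@le_integrableR _ _ _ P setT measurableT _ (fun w => Y w ^+ 2 + Z w ^+ 2)).
- exact: measurable_funM.
- move=> w _; have : 0 <= (`|Y w| - `|Z w|) ^+ 2 by exact: sqr_ge0.
  rewrite normrM -[Y w ^+ 2]real_normK ?num_real // -[Z w ^+ 2]real_normK ?num_real //.
  have : 0 <= `|Y w| * `|Z w| by exact: mulr_ge0.
  by nra.
- exact: integrableDR.
Qed.

Lemma square_integrableD Y Z : square_integrable Y -> square_integrable Z ->
  square_integrable (fun w => Y w + Z w).
Proof.
move=> sY sZ; have [mY iY] := sY; have [mZ iZ] := sZ; split; first exact: measurable_funD.
have -> : (fun w => (Y w + Z w) ^+ 2) = (fun w => (Y w ^+ 2 + Z w ^+ 2) + 2 * (Y w * Z w)).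
  by apply/funext => w; ring.
apply: integrableDR => //; first exact: integrableDR.
by apply: integrableZlR => //; exact: square_integrable_mul.
Qed.

Lemma square_integrableZ (c : R) Y : square_integrable Y ->
  square_integrable (fun w => c * Y w).
Proof.
move=> [mY iY]; split; first by apply: measurable_funM => //; exact: measurable_cst.
have -> : (fun w => (c * Y w) ^+ 2) = (fun w => c ^+ 2 * Y w ^+ 2).
  by apply/funext => w; rewrite exprMn.
exact: integrableZlR.
Qed.

Lemma square_integrableB Y Z : square_integrable Y -> square_integrable Z ->
  square_integrable (fun w => Y w - Z w).
Proof.
move=> sY sZ; have -> : (fun w => Y w - Z w) = (fun w => Y w + (-1) * Z w).
  by apply/funext => w; rewrite mulN1r.
by apply: square_integrableD => //; exact: square_integrableZ.
Qed.

Lemma square_integrable_cst (c : R) : square_integrable (fun=> c).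
Proof. by split => //; exact: finite_measure_integrable_cst. Qed.

Lemma square_integrable_sum (J : Type) (r : seq J) (F : J -> T -> R) :
  (forall i, square_integrable (F i)) -> square_integrable (fun w => \sum_(i <- r) F i w).
Proof.
move=> sF; elim: r => [|i r IH].
  have -> : (fun w => \sum_(i <- [::]) F i w) = fun=> 0 by apply/funext => w; rewrite big_nil.
  exact: square_integrable_cst.
have -> : (fun w => \sum_(j <- i :: r) F j w) = (fun w => F i w + \sum_(j <- r) F j w).
  by apply/funext => w; rewrite big_cons.
exact: square_integrableD.
Qed.

Lemma square_integrable_bounded Y (M : R) : measurable_fun setT Y -> (forall w, `|Y w| <= M) ->
  square_integrable Y.
Proof.
move=> mY YM; split => //; apply: (@integrable_bounded_mfun _ _ _ _ _ (M ^+ 2)).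
  exact: measurable_funX.
by move=> w; rewrite normrX lerXn2r ?nnegrE //; exact: le_trans (YM w).
Qed.

Lemma square_integrable_integrable Y : square_integrable Y -> P.-integrable setT (EFin \o Y).
Proof.
move=> sY; have := square_integrable_mul sY (square_integrable_cst 1).
by congr (integrable _ _ (EFin \o _)); apply/funext => w; rewrite mulr1.
Qed.

Lemma mean_sqr_add_le Y Z : square_integrable Y -> square_integrable Z ->
  \int[P]_w ((Y w + Z w) ^+ 2) <= 2 * \int[P]_w (Y w ^+ 2) + 2 * \int[P]_w (Z w ^+ 2).
Proof.
move=> sY sZ; have [mY iY] := sY; have [mZ iZ] := sZ.
rewrite -!RintegralZl // -RintegralD //; try exact: integrableZlR.
apply: le_Rintegral => //.
- by case: (square_integrableD sY sZ).
- by apply: integrableDR => //; exact: integrableZlR.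
- move=> w _; rewrite -subr_ge0; have -> : 2 * Y w ^+ 2 + 2 * Z w ^+ 2 - (Y w + Z w) ^+ 2 =
      (Y w - Z w) ^+ 2 by ring.
  exact: sqr_ge0.
Qed.

(** The variance of |Y| is nonnegative. *)
Lemma mean_norm_le Y : square_integrable Y ->
  \int[P]_w `|Y w| <= Num.sqrt (\int[P]_w (Y w ^+ 2)).
Proof.
move=> sY; have [mY iY] := sY.
have iN : P.-integrable setT (EFin \o (fun w => `|Y w|)).
  by apply: integrable_norm; exact: square_integrable_integrable.
set m := \int[P]_w `|Y w|.
have m0 : 0 <= m by apply: Rintegral_ge0 => w _.
rewrite -[leLHS](ger0_norm m0) -sqrtr_sqr ler_sqrt; last first.
  by apply: Rintegral_ge0 => w _; exact: sqr_ge0.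
have h : 0 <= \int[P]_w ((`|Y w| - m) ^+ 2) by apply: Rintegral_ge0 => w _; exact: sqr_ge0.
have e : \int[P]_w ((`|Y w| - m) ^+ 2) = \int[P]_w (Y w ^+ 2) - m ^+ 2.
  transitivity (\int[P]_w ((Y w ^+ 2 - (2 * m) * `|Y w|) + m ^+ 2)).
    by apply: eq_Rintegral => w _; rewrite -[Y w ^+ 2]real_normK ?num_real //; ring.
  rewrite RintegralD //; last 2 first.
  - by apply: integrableBR => //; exact: integrableZlR.
  - exact: finite_measure_integrable_cst.
  rewrite RintegralB //; last exact: integrableZlR.
  by rewrite Rintegral_prob_cst RintegralZl // -/m; ring.
by rewrite e subr_ge0 in h.
Qed.

(** From |z^2 - y^2| <= t y^2 + (1 + 1/t) (y - z)^2, for all t > 0. *)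
Lemma mean_sqr_cvg (Z : nat -> T -> R) Y : square_integrable Y ->
  (forall m, square_integrable (Z m)) ->
  (fun m => \int[P]_w ((Y w - Z m w) ^+ 2)) @ \oo --> (0 : R) ->
  (fun m => \int[P]_w (Z m w ^+ 2)) @ \oo --> \int[P]_w (Y w ^+ 2).
Proof.
move=> sY sZ c0; set S := \int[P]_w (Y w ^+ 2).
have S0 : 0 <= S by apply: Rintegral_ge0 => w _; exact: sqr_ge0.
have key m (t : R) : 0 < t ->
    `|\int[P]_w (Z m w ^+ 2) - S| <= t * S + (1 + t^-1) * \int[P]_w ((Y w - Z m w) ^+ 2).
  move=> t0; have [mY iY] := sY; have [mZ iZ] := sZ m.
  have [_ iD] := square_integrableB sY (sZ m).
  rewrite -RintegralB // -!RintegralZl // -RintegralD //; try exact: integrableZlR.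
  apply: (le_trans (le_normr_Rintegral measurableT _)); first exact: integrableBR.
  apply: le_Rintegral => //.
  - by apply: integrable_norm; exact: integrableBR.
  - by apply: integrableDR => //; exact: integrableZlR.
  move=> w _; set y := Y w; set z := Z m w.
  have ti : t * t^-1 = 1 by rewrite mulfV // gt_eqF.
  have t1 : 0 < t^-1 by rewrite invr_gt0.
  have h1 : 0 <= t * (y - t^-1 * (y - z)) ^+ 2 by rewrite mulr_ge0 ?sqr_ge0 // ltW.
  have h2 : 0 <= t * (y + t^-1 * (y - z)) ^+ 2 by rewrite mulr_ge0 ?sqr_ge0 // ltW.
  have e1 : t * (y - t^-1 * (y - z)) ^+ 2 = t * y ^+ 2 - 2 * (y * (y - z)) + t^-1 * (y - z) ^+ 2.
    transitivity (t * y ^+ 2 - 2 * (t * t^-1) * (y * (y - z)) + (t * t^-1) * t^-1 * (y - z) ^+ 2).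
      by ring.
    by rewrite ti; ring.
  have e2 : t * (y + t^-1 * (y - z)) ^+ 2 = t * y ^+ 2 + 2 * (y * (y - z)) + t^-1 * (y - z) ^+ 2.
    transitivity (t * y ^+ 2 + 2 * (t * t^-1) * (y * (y - z)) + (t * t^-1) * t^-1 * (y - z) ^+ 2).
      by ring.
    by rewrite ti; ring.
  have h3 : 0 <= (y - z) ^+ 2 by exact: sqr_ge0.
  have e3 : z ^+ 2 - y ^+ 2 = (y - z) ^+ 2 - 2 * (y * (y - z)) by ring.
  rewrite e1 in h1; rewrite e2 in h2; rewrite mulrDl mul1r.
  by rewrite ler_norml e3; apply/andP; split; lra.
apply: (cvg_of_approximants (A := fun p m => S)
  (r := fun p m => p.+1%:R^-1 * S + (1 + p.+1%:R) * \int[P]_w ((Y w - Z m w) ^+ 2))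
  (A' := fun=> S) (r' := fun p => p.+1%:R^-1 * S)).
- apply: nearW => m p; have := key m (p.+1%:R^-1); rewrite invrK; apply.
  by rewrite invr_gt0 ltr0n.
- by move=> p; exact: cvg_cst.
- move=> p; rewrite -[X in _ --> X]addr0; apply: cvgD; first exact: cvg_cst.
  exact: cvg_scale0.
- by move=> p; rewrite subrr normr0 mulr_ge0 // invr_ge0.
- have -> : (fun p => p.+1%:R^-1 * S) = (fun p => S * p.+1%:R^-1) by apply/funext => p; rewrite mulrC.
  by apply: cvg_scale0; exact: (@cvg_harmonic R).
Qed.

End square_integrable.

(** * Polynomials are dense for the Gaussian law *)

Section hermite_completeness.
Context {R : realType}.
Local Notation RT := (measurableTypeR R).
Local Notation mu := (@lebesgue_measure R).
Local Notation gam := (@normal_prob R 0 1).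
Implicit Types (h v q : R -> R) (p : {poly R}) (M A e : R).

Lemma integrable_gauss_poly p : gam.-integrable setT (EFin \o (fun x : RT => p.[x])).
Proof. by have := integrable_normal_law_poly p 0 ler01; rewrite normal_law1. Qed.

Lemma square_integrable_poly p : square_integrable gam (fun x : RT => p.[x]).
Proof.
split; first exact: measurable_polyfun.
have := integrable_gauss_poly (p ^+ 2).
by congr (integrable _ _ (EFin \o _)); apply/funext => x; rewrite !expr2 hornerM.
Qed.

Lemma Rintegral_gauss_sqr : \int[gam]_x (x ^+ 2) = 1.
Proof.
have := Rintegral_normal_prob_poly ('X ^+ 2 : {poly R}).
rewrite expr2 gauss_mean_ibp derivX gauss_meanC => e; rewrite -[RHS]e.
by apply: eq_Rintegral => x _; rewrite hornerM hornerX.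
Qed.

(** The density is bounded by its peak. *)
Lemma gauss_le_lebesgue (D : set RT) (f : R -> R) : measurable D ->
  measurable_fun setT f -> (forall x, 0 <= f x) -> mu.-integrable D (EFin \o f) ->
  gam.-integrable setT (EFin \o f) ->
  \int[gam]_x (f x * \1_D x) <= normal_peak 1 * \int[mu]_(x in D) f x.
Proof.
move=> mD mf f0 iD iG.
have m1 : measurable_fun setT (\1_D : R -> R) by exact: measurable_indic.
have i1 : gam.-integrable setT (EFin \o (fun x : RT => f x * \1_D x)).
  apply: (le_integrableR measurableT _ _ iG); first exact: measurable_funM.
  move=> x _; rewrite normrM (ger0_norm (f0 x)) -[leRHS]mulr1 ler_wpM2l //.
  by rewrite indicE; case: (x \in D); rewrite ?normr1 ?normr0.
rewrite Rintegral_normal_prob //; last exact: measurable_funM.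
rewrite -RintegralZl // [leRHS]Rintegral_mkcond.
have mpdf := @measurable_normal_pdf R 0 1.
have ipk : mu.-integrable setT (EFin \o ((fun x => normal_peak 1 * f x) \_ D)).
  rewrite -restrict_EFin; apply: (@integrable_mkcond _ RT R mu D _ mD).1.
  exact: integrableZlR.
have le x : f x * \1_D x * normal_pdf 0 1 x <= ((fun x => normal_peak 1 * f x) \_ D) x.
  rewrite patchE indicE; case: ifP => _; last by rewrite mulr0 mul0r.
  by rewrite mulr1 mulrC ler_wpM2r // normal_pdf_ub ?oner_neq0.
apply: le_Rintegral => //; apply: (le_integrableR measurableT _ _ ipk).
- by apply: measurable_funM => //; exact: measurable_funM.
- move=> x _; rewrite ger0_norm // mulr_ge0 ?normal_pdf_ge0 // mulr_ge0 //.
Qed.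

Lemma sqr_le_bound (a b M : R) : `|a| <= M -> `|b| <= M -> (a - b) ^+ 2 <= 2 * M * `|a - b|.
Proof.
move=> aM bM; rewrite -real_normK ?num_real // expr2 ler_wpM2r //.
by apply: (le_trans (ler_normB _ _)); rewrite mulr_natl mulr2n lerD.
Qed.

(** Inside [-A, A] the error is an L1 error for Lebesgue measure; outside, the
    second moment of the Gaussian law bounds it by O(1/A^2). *)
Lemma gauss_continuous_approx h M e : measurable_fun setT h -> 0 < M ->
  (forall x, `|h x| <= M) -> 0 < e ->
  exists v, [/\ continuous v, forall x, `|v x| <= M & \int[gam]_x ((h x - v x) ^+ 2) <= e].
Proof.
move=> mh M0 hM e0.
pose A : R := 1 + 8 * M ^+ 2 / e.
have A1 : 1 <= A by rewrite lerDl divr_ge0 ?mulr_ge0 ?sqr_ge0 // ltW.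
have A0 : 0 < A by exact: lt_le_trans A1.
have MA : 4 * M ^+ 2 / A ^+ 2 <= e / 2.
  rewrite ler_pdivrMr ?exprn_gt0 //.
  have : e / 2 * A <= e / 2 * A ^+ 2.
    by rewrite ler_pM2l ?divr_gt0 // expr2 ler_peMr // ltW.
  apply: le_trans; rewrite /A mulrDr mulr1.
  have -> : e / 2 * (8 * M ^+ 2 / e) = 4 * M ^+ 2 by field; rewrite gt_eqF.
  by rewrite lerDr ltW // divr_gt0.
pose D : set RT := `[- A, A]%classic.
have mD : measurable D by exact: measurable_itv.
have fD : (mu D < +oo)%E by rewrite /= lebesgue_measure_itv; case: ifP => // _; exact: ltry.
have k0 : 0 < normal_peak (1 : R) by rewrite normal_peak_gt0 ?oner_neq0.
pose e' := e / (4 * M * normal_peak 1).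
have e'0 : 0 < e' by rewrite divr_gt0 // !mulr_gt0.
have [v [cv vM hv]] := bounded_continuous_approx mD fD (measurable_funTS mh) hM e'0.
exists v; split => //.
have mv : measurable_fun setT v by exact: continuous_measurable_fun.
have mhv : measurable_fun setT (fun x => `|h x - v x|).
  by apply: measurableT_comp => //; exact: measurable_funB.
have hv2 x : `|h x - v x| <= 2 * M.
  by apply: (le_trans (ler_normB _ _)); rewrite mulr_natl mulr2n lerD.
have iD : mu.-integrable D (EFin \o (fun x => `|h x - v x|)).
  by apply: (integrable_itv_bounded (M := 2 * M)) => // x; rewrite normr_id.
have iG : gam.-integrable setT (EFin \o (fun x : RT => `|h x - v x|)).
  by apply: (@integrable_bounded_mfun _ _ _ _ _ (2 * M)) => // x; rewrite normr_id.
have m1 : measurable_fun setT (\1_D : R -> R) by exact: measurable_indic.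
have i1 : gam.-integrable setT (EFin \o (fun x : RT => `|h x - v x| * \1_D x)).
  apply: (le_integrableR measurableT _ _ iG); first exact: measurable_funM.
  move=> x _; rewrite normrM normr_id -[leRHS]mulr1 ler_wpM2l //.
  by rewrite indicE; case: (x \in D); rewrite ?normr1 ?normr0.
have ix2 : gam.-integrable setT (EFin \o (fun x : RT => x ^+ 2)).
  have := integrable_gauss_poly ('X ^+ 2); congr (integrable _ _ (EFin \o _)).
  by apply/funext => x; rewrite hornerXn.
have pw x : (h x - v x) ^+ 2 <= 2 * M * (`|h x - v x| * \1_D x) + 4 * M ^+ 2 / A ^+ 2 * x ^+ 2.
  rewrite indicE; have [xD|/negP xD] := boolP (x \in D).
    rewrite mulr1 (le_trans (sqr_le_bound (hM x) (vM x))) // lerDl.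
    by rewrite mulr_ge0 ?sqr_ge0 // divr_ge0 ?sqr_ge0 // mulr_ge0 ?sqr_ge0.
  rewrite mulr0 mulr0 add0r.
  have : A <= `|x|.
    rewrite leNgt; apply/negP => xA; apply: xD; rewrite inE /D /= in_itv /= -ler_norml.
    exact: ltW.
  move=> Ax; rewrite mulrAC ler_pdivlMr ?exprn_gt0 //.
  rewrite ler_pM ?sqr_ge0 //.
  - rewrite -real_normK ?num_real // (_ : 4 * M ^+ 2 = (2 * M) ^+ 2); last by ring.
    by rewrite lerXn2r ?nnegrE // mulr_ge0 // ltW.
  - by rewrite -[leRHS]real_normK ?num_real // lerXn2r ?nnegrE // ltW.
have [_ ihv] : square_integrable gam (fun x : RT => h x - v x).
  by apply: (@square_integrable_bounded _ _ _ _ _ (2 * M)) => //; exact: measurable_funB.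
apply: (@le_trans _ _ (\int[gam]_x (2 * M * (`|h x - v x| * \1_D x) + 4 * M ^+ 2 / A ^+ 2 * x ^+ 2))).
  by apply: le_Rintegral => //; apply: integrableDR => //; exact: integrableZlR.
rewrite RintegralD //; try exact: integrableZlR.
rewrite !RintegralZl // Rintegral_gauss_sqr mulr1 [leRHS]splitr lerD //.
apply: (@le_trans _ _ (2 * M * (normal_peak 1 * e'))).
  rewrite ler_wpM2l ?mulr_ge0 ?(ltW M0) //.
  apply: (le_trans (gauss_le_lebesgue mD mhv _ iD iG)) => //.
  by rewrite ler_wpM2l // ltW.
rewrite /e' le_eqVlt; apply/orP; left; apply/eqP; move: k0; set k := normal_peak 1 => k0.
by field; rewrite !gt_eqF.
Qed.

Lemma fact_double_le n : (n.*2)`!%:R <= 4 ^+ n * n`!%:R ^+ 2 :> R.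
Proof.
elim: n => [|n IH]; first by rewrite !fact0 expr0 expr1n mulr1.
rewrite doubleS [_.+2`!]factS [_.+1`!]factS [n.+1`!]factS !natrM.
apply: (@le_trans _ _ (n.*2.+2%:R * (n.*2.+2%:R * (4 ^+ n * n`!%:R ^+ 2)))).
  by rewrite ler_wpM2l // ler_pM // ler_nat.
have -> : n.*2.+2%:R = 2 * n.+1%:R :> R by rewrite -doubleS -mul2n natrM.
by rewrite [4 ^+ n.+1]exprS le_eqVlt; apply/orP; left; apply/eqP; ring.
Qed.

(** The Taylor polynomials of the cosine: the mean square of the remainder of
    order n is at most t^(2n) / n!^2 times the moment (2n)! / (2^n n!), hence at
    most (2 t^2)^n / n!. *)
Lemma gauss_cos_approx t s e : 0 < e ->
  exists p, \int[gam]_x ((cos (t * x + s) - p.[x]) ^+ 2) <= e.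
Proof.
move=> e0; have /cvgrPdist_le/(_ _ e0)[n _ /(_ n (leqnn n)) /=] := exp_coeff_cvg0 (2 * t ^+ 2).
rewrite sub0r normrN => hn.
exists (cos_taylor s n \Po (t *: 'X)).
have iX k : gam.-integrable setT (EFin \o (fun x : RT => x ^+ k)).
  have := integrable_gauss_poly 'X^k; congr (integrable _ _ (EFin \o _)).
  by apply/funext => x; rewrite hornerXn.
have [_ iL] : square_integrable gam
    (fun x : RT => cos (t * x + s) - (cos_taylor s n \Po (t *: 'X)).[x]).
  apply: square_integrableB; last exact: square_integrable_poly.
  apply: (@square_integrable_bounded _ _ _ _ _ 1); first exact: measurable_cos_comp.
  by move=> x; exact: cos_max.
pose c := (t ^+ 2) ^+ n / n`!%:R ^+ 2.
apply: (@le_trans _ _ (\int[gam]_x (c * x ^+ n.*2))).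
  apply: le_Rintegral => //; first exact: integrableZlR.
  move=> x _; rewrite horner_comp hornerZ hornerX -real_normK ?num_real //.
  apply: (@le_trans _ _ ((`|t * x| ^+ n / n`!%:R) ^+ 2)).
    by rewrite lerXn2r ?nnegrE ?divr_ge0 ?exprn_ge0 // cos_taylor_le.
  rewrite le_eqVlt; apply/orP; left; apply/eqP.
  rewrite expr_div_n -exprM mulnC exprM real_normK ?num_real // /c.
  by rewrite [(t * x) ^+ 2]exprMn [(_ * x ^+ 2) ^+ n]exprMn -[x ^+ 2 ^+ n]exprM mul2n; ring.
rewrite RintegralZl //.
have m2 := @normal_even_moment R 1 n ler01; rewrite normal_law1 in m2.
apply: (le_trans _ (le_trans (ler_norm _) hn)).
have f0 : 0 < n`!%:R :> R by rewrite ltr0n fact_gt0.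
have f2 : 0 < (n.*2)`!%:R :> R by rewrite ltr0n fact_gt0.
have -> : \int[gam]_x (x ^+ n.*2) = (n.*2)`!%:R * ((1 / 2) ^+ n / n`!%:R).
  by rewrite -m2 mulrC divfK // gt_eqF.
apply: (@le_trans _ _ (c * ((4 ^+ n * n`!%:R ^+ 2) * ((1 / 2) ^+ n / n`!%:R)))).
  rewrite ler_wpM2l //; first by apply: divr_ge0; [apply: exprn_ge0|]; exact: sqr_ge0.
  by rewrite ler_wpM2r ?fact_double_le // divr_ge0 ?exprn_ge0.
rewrite le_eqVlt; apply/orP; left; apply/eqP.
rewrite /c [(2 * t ^+ 2) ^+ n]exprMn (_ : 4 ^+ n = 2 ^+ n * 2 ^+ n); last by rewrite -exprMn; congr (_ ^+ _); ring.
rewrite expr_div_n expr1n; move: f0; set F := n`!%:R => f0.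
have : 0 < 2 ^+ n :> R by exact: exprn_gt0.
set W := 2 ^+ n => W0; set Z := (t ^+ 2) ^+ n.
by field; rewrite !gt_eqF.
Qed.

Lemma gauss_trig_approx q e : trig_poly q -> 0 < e ->
  exists p, \int[gam]_x ((q x - p.[x]) ^+ 2) <= e.
Proof.
move=> tq; have sq r : trig_poly r -> square_integrable gam (fun x : RT => r x).
  elim=> [c t s|r1 r2 _ s1 _ s2]; last exact: square_integrableD.
  apply: square_integrableZ; apply: (@square_integrable_bounded _ _ _ _ _ 1).
    exact: measurable_cos_comp.
  by move=> x; exact: cos_max.
elim: tq e => [c t s|p1 p2 t1 h1 t2 h2] e e0.
  have c1 : 0 < c ^+ 2 + 1 by rewrite ltr_wpDl // sqr_ge0.
  have [p hp] := @gauss_cos_approx t s (e / (c ^+ 2 + 1)) (divr_gt0 e0 c1).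
  exists (c *: p).
  have [_ iL] : square_integrable gam (fun x : RT => cos (t * x + s) - p.[x]).
    apply: square_integrableB; last exact: square_integrable_poly.
    apply: (@square_integrable_bounded _ _ _ _ _ 1); first exact: measurable_cos_comp.
    by move=> x; exact: cos_max.
  have -> : \int[gam]_x ((c * cos (t * x + s) - (c *: p).[x]) ^+ 2) =
      c ^+ 2 * \int[gam]_x ((cos (t * x + s) - p.[x]) ^+ 2).
    by rewrite -RintegralZl //; apply: eq_Rintegral => x _; rewrite hornerZ; ring.
  apply: (@le_trans _ _ ((c ^+ 2 + 1) * (e / (c ^+ 2 + 1)))); last by rewrite mulrC divfK // gt_eqF.
  rewrite ler_pM ?sqr_ge0 ?lerDl //; apply: Rintegral_ge0 => x _; exact: sqr_ge0.
have e4 : 0 < e / 4 by lra.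
have [r1 hr1] := h1 _ e4; have [r2 hr2] := h2 _ e4; exists (r1 + r2).
have -> : \int[gam]_x ((p1 x + p2 x - (r1 + r2).[x]) ^+ 2) =
    \int[gam]_x (((p1 x - r1.[x]) + (p2 x - r2.[x])) ^+ 2).
  by apply: eq_Rintegral => x _; rewrite hornerD; congr (_ ^+ 2); ring.
apply: (le_trans (mean_sqr_add_le _ _)).
- by apply: square_integrableB; [exact: sq|exact: square_integrable_poly].
- by apply: square_integrableB; [exact: sq|exact: square_integrable_poly].
- lra.
Qed.

(** Continuous functions, then trigonometric polynomials, then polynomials. *)
Lemma gauss_poly_approx h M e : measurable_fun setT h -> (forall x, `|h x| <= M) -> 0 < e ->
  exists p, \int[gam]_x ((h x - p.[x]) ^+ 2) <= e.
Proof.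
move=> mh hM' e0; pose M1 := M + 1.
have M'0 : 0 <= M by exact: le_trans (hM' 0).
have M0 : 0 < M1 by rewrite /M1; lra.
have hM x : `|h x| <= M1 by apply: (le_trans (hM' x)); rewrite /M1; lra.
have e8 : 0 < e / 16 by lra.
have [v [cv vM hv]] := gauss_continuous_approx mh M0 hM e8.
pose A : R := 1 + 64 * M1 ^+ 2 / e.
have A1 : 1 <= A by rewrite lerDl divr_ge0 ?mulr_ge0 ?sqr_ge0 // ltW.
have A0 : 0 < A by exact: lt_le_trans A1.
have MA : 4 * M1 ^+ 2 / A ^+ 2 <= e / 16.
  rewrite ler_pdivrMr ?exprn_gt0 //.
  have : e / 16 * A <= e / 16 * A ^+ 2.
    by rewrite ler_pM2l ?divr_gt0 // expr2 ler_peMr // ltW.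
  apply: le_trans; rewrite /A mulrDr mulr1.
  have -> : e / 16 * (64 * M1 ^+ 2 / e) = 4 * M1 ^+ 2 by field; rewrite gt_eqF.
  by rewrite lerDr ltW // divr_gt0.
have e1 : 0 < e / (32 * M1) by rewrite divr_gt0 // mulr_gt0.
have [q [tq qM qv]] := trig_approximation cv vM A0 e1.
have [p hp] := gauss_trig_approx tq e8.
exists p.
have mv : measurable_fun setT v by exact: continuous_measurable_fun.
have mq := measurable_trig_poly tq.
have sh : square_integrable gam (fun x : RT => h x) by apply: (@square_integrable_bounded _ _ _ _ _ M1).
have sv : square_integrable gam (fun x : RT => v x) by apply: (@square_integrable_bounded _ _ _ _ _ M1).
have sq : square_integrable gam (fun x : RT => q x) by apply: (@square_integrable_bounded _ _ _ _ _ M1).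
have sp := square_integrable_poly p.
have ix2 : gam.-integrable setT (EFin \o (fun x : RT => x ^+ 2)).
  have := integrable_gauss_poly ('X ^+ 2); congr (integrable _ _ (EFin \o _)).
  by apply/funext => x; rewrite hornerXn.
have hvq : \int[gam]_x ((v x - q x) ^+ 2) <= e / 8.
  apply: (@le_trans _ _ (\int[gam]_x (e / 16 + 4 * M1 ^+ 2 / A ^+ 2 * x ^+ 2))).
    apply: le_Rintegral => //.
    - by have [] := square_integrableB sv sq.
    - apply: integrableDR => //; last exact: integrableZlR.
      exact: finite_measure_integrable_cst.
    - move=> x _; apply: (le_trans (sqr_le_bound (vM x) (qM x))).
      apply: (@le_trans _ _ (2 * M1 * (e / (32 * M1) + 2 * M1 / A ^+ 2 * x ^+ 2))).
        rewrite ler_wpM2l ?mulr_ge0 ?(ltW M0) // distrC.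
        exact: (trig_approx_sqr x vM qM A0 e1 qv).
      rewrite le_eqVlt; apply/orP; left; apply/eqP; field.
      by rewrite !gt_eqF.
  rewrite RintegralD //; last 2 first.
  - exact: finite_measure_integrable_cst.
  - exact: integrableZlR.
  by rewrite Rintegral_prob_cst RintegralZl // Rintegral_gauss_sqr; lra.
have -> : \int[gam]_x ((h x - p.[x]) ^+ 2) =
   \int[gam]_x (((h x - v x) + ((v x - q x) + (q x - p.[x]))) ^+ 2).
  by apply: eq_Rintegral => x _; congr (_ ^+ 2); ring.
have svq := square_integrableB sv sq; have sqp := square_integrableB sq sp.
have svp := square_integrableD svq sqp.
apply: (le_trans (mean_sqr_add_le (square_integrableB sh sv) svp)).
apply: (@le_trans _ _ (2 * (e / 16) + 2 * (2 * (e / 8) + 2 * (e / 16)))); last by lra.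
rewrite lerD //; rewrite ler_pM2l //.
by apply: (le_trans (mean_sqr_add_le svq sqp)); rewrite lerD // ler_pM2l.
Qed.

End hermite_completeness.

(** * Hermite expansions *)

Section hermite_expansion.
Context {R : realType}.
Local Notation RT := (measurableTypeR R).
Local Notation gam := (@normal_prob R 0 1).

(** Hermite polynomials are monic of degree [l], whence [hermite_span]. *)
Lemma hermite_lead l : (size (hermite R l) <= l.+1)%N /\ (hermite R l)`_l = 1.
Proof.
elim: l => [|l [sl ml]]; first by rewrite hermite0 size_poly1 coef1.
rewrite hermiteS; split.
  apply: (leq_trans (size_polyD _ _)); rewrite geq_max size_polyN.
  rewrite (leq_trans (size_polyMleq _ _)) ?size_polyX //=.
  by rewrite (leq_trans (leq_trans (size_poly _ _) (leq_pred _))) // (leq_trans sl).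
rewrite coefB coefXM /= ml coef_deriv nth_default ?mul0rn ?subr0 //.
exact: leq_trans sl _.
Qed.

Lemma hermite_span L (p : {poly R}) : (size p <= L)%N ->
  exists b : nat -> R, p = \sum_(l < L) b l *: hermite R l.
Proof.
elim: L p => [|L IH] p sp.
  by exists (fun=> 0); rewrite big_ord0; apply/eqP; rewrite -size_poly_leq0.
have [sL cL] := hermite_lead L.
have sq : (size (p - p`_L *: hermite R L)%R <= L)%N.
  apply/leq_sizeP => j; rewrite leq_eqVlt coefB coefZ => /orP[/eqP <-|Lj].
    by rewrite cL mulr1 subrr.
  by rewrite (nth_default 0 (leq_trans sp Lj)) (nth_default 0 (leq_trans sL Lj)) mulr0 subr0.
have [b hb] := IH _ sq; exists (fun l => if l == L then p`_L else b l).
rewrite big_ord_recr /= eqxx; apply/eqP; rewrite -subr_eq hb; apply/eqP.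
by apply: eq_bigr => l _; rewrite ltn_eqF.
Qed.

Section expansion.
Context (h : R -> R).
Hypothesis sh : square_integrable gam (h : RT -> R).
Hypothesis dense : forall e : R, 0 < e -> exists p : {poly R}, \int[gam]_x ((h x - p.[x]) ^+ 2) <= e.
Local Notation c := (hermite_coef h).

(** Orthogonality of the Hermite polynomials, in the quadratic expansion of the
    mean square. *)
Lemma mean_sqr_hermite_diff (b : nat -> R) L :
  \int[gam]_x ((h x - (\sum_(l < L) b l *: hermite R l).[x]) ^+ 2) =
  \int[gam]_x (h x ^+ 2) + \sum_(l < L) (b l ^+ 2 * l`!%:R - 2 * (b l * c l)).
Proof.
set p := \sum_(l < L) _.
have [mh ih] := sh; have sp := square_integrable_poly p; have [mp ip] := sp.
have ihp := square_integrable_mul sh sp.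
transitivity (\int[gam]_x (h x ^+ 2 + (p.[x] ^+ 2 - 2 * (h x * p.[x])))).
  by apply: eq_Rintegral => x _; ring.
rewrite RintegralD //; last by apply: integrableBR => //; exact: integrableZlR.
rewrite RintegralB //; last exact: integrableZlR.
rewrite RintegralZl // sumrB -mulr_sumr; congr (_ + (_ - 2 * _)).
  transitivity (gauss_mean (p * p)).
    rewrite -Rintegral_normal_prob_poly; apply: eq_Rintegral => x _.
    by rewrite hornerM expr2.
  have gs (J : Type) (r : seq J) (F : J -> {poly R}) :
      gauss_mean (\sum_(i <- r) F i) = \sum_(i <- r) gauss_mean (F i).
    elim: r => [|i r IH]; first by rewrite !big_nil -(scale0r (0 : {poly R})) gauss_meanZ mul0r.
    by rewrite !big_cons gauss_meanD IH.
  rewrite /p mulr_suml gs; apply: eq_bigr => l _; rewrite mulr_sumr gs.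
  rewrite (bigD1 l) //= -scalerAl -scalerAr !gauss_meanZ gauss_mean_hermite2 eqxx mul1r.
  rewrite big1 ?addr0 => [|m ml]; first by rewrite mulrA expr2.
  rewrite -scalerAl -scalerAr !gauss_meanZ gauss_mean_hermite2 eq_sym.
  by rewrite (_ : (m == l :> nat) = false) ?mul0r ?mulr0 //; apply/negbTE.
have iH (l : nat) : gam.-integrable setT (EFin \o (fun x : RT => h x * (hermite R l).[x])).
  exact: square_integrable_mul (square_integrable_poly _).
transitivity (\int[gam]_x (\sum_(l < L) b l * (h x * (hermite R l).[x]))).
  apply: eq_Rintegral => x _; rewrite /p horner_sum mulr_sumr; apply: eq_bigr => l _.
  by rewrite hornerZ mulrCA.
rewrite Rintegral_sum // => [|l]; last by apply: integrableZlR.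
by apply: eq_bigr => l _; rewrite RintegralZl.
Qed.

Definition hermite_part L : {poly R} := \sum_(l < L) (c l / l`!%:R) *: hermite R l.

Lemma fact_neq0 l : l`!%:R != 0 :> R.
Proof. by rewrite pnatr_eq0 -lt0n fact_gt0. Qed.

Lemma mean_sqr_hermite_part L : \int[gam]_x ((h x - (hermite_part L).[x]) ^+ 2) =
  \int[gam]_x (h x ^+ 2) - \sum_(l < L) c l ^+ 2 / l`!%:R.
Proof.
rewrite (mean_sqr_hermite_diff (fun l => c l / l`!%:R)) -sumrN; congr (_ + _).
apply: eq_bigr => l _; have := fact_neq0 l; set F := l`!%:R => F0.
by field.
Qed.

(** The orthogonal projection is the best approximation: completing the
    squares in [mean_sqr_hermite_diff]. *)
Lemma hermite_part_best L (p : {poly R}) : (size p <= L)%N ->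
  \int[gam]_x ((h x - (hermite_part L).[x]) ^+ 2) <= \int[gam]_x ((h x - p.[x]) ^+ 2).
Proof.
move=> /hermite_span[b ->]; rewrite mean_sqr_hermite_part mean_sqr_hermite_diff lerD2l -sumrN.
apply: ler_sum => l _; have := fact_neq0 l.
have : 0 <= l`!%:R :> R by [].
set F := l`!%:R => F1 F0; rewrite -subr_ge0.
have -> : b l ^+ 2 * F - 2 * (b l * c l) - - (c l ^+ 2 / F) = F * (b l - c l / F) ^+ 2.
  by field.
by rewrite mulr_ge0 // sqr_ge0.
Qed.

Lemma hermite_part_cvg :
  (fun L => \int[gam]_x ((h x - (hermite_part L).[x]) ^+ 2)) @ \oo --> (0 : R).
Proof.
apply/cvgrPdist_le => e e0; have [p hp] := dense e0.
near=> L; rewrite sub0r normrN ger0_norm; last by apply: Rintegral_ge0 => x _; exact: sqr_ge0.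
apply: le_trans hp; apply: hermite_part_best; near: L; exact: nbhs_infty_ge.
Unshelve. all: by end_near. Qed.

End expansion.
End hermite_expansion.

(** * Entrywise powers of symmetric matrices *)

Section power_form.
Context {R : realType}.

Lemma power_diff_le (x y : R) l : `|x| <= 1 -> `|y| <= 1 ->
  `|x ^+ l.+2 - y ^+ l.+2| <= l.+2%:R * (`|x - y| * (`|x| + `|y|)).
Proof.
move=> x1 y1; rewrite subrXX normrM mulrCA ler_wpM2l //.
apply: (le_trans (ler_norm_sum _ _ _)).
rewrite mulr_natl -[X in _ *+ X]card_ord -sumr_const; apply: ler_sum => i _.
rewrite normrM !normrX.
have p1 (z : R) m : `|z| <= 1 -> `|z| ^+ m <= 1 by move=> z1; rewrite exprn_ile1.
case: i => -[|i] /= il.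
  rewrite mulr1 subn0 exprS ler_wpDr // -[leRHS]mulr1 ler_wpM2l //.
  exact: p1.
rewrite exprS mulrCA ler_wpDl // -[leRHS]mulr1 ler_wpM2l //.
by rewrite mulr_ile1 ?exprn_ge0 // p1.
Qed.

(** For l = 0 this is the bound of the form of C - G at (1, ..., 1).  For higher
    powers the factor |C| + |G| of [power_diff_le] is square-summable along rows,
    like C - G itself, and the sums along rows are at most O(D) by the weighted
    inequality 2 x y <= x^2 / D + D y^2. *)
Lemma form_power_diff (n l : nat) (C G : 'I_n -> 'I_n -> R) (K D : R) :
  (forall i k, C i k = C k i) -> (forall i k, G i k = G k i) ->
  (forall i k, `|C i k| <= 1) -> (forall i k, `|G i k| <= 1) ->
  0 < K -> 0 < D -> form_norm_bounded C K -> form_norm_bounded G K ->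
  form_norm_bounded (fun i k => C i k - G i k) D ->
  `|\sum_i \sum_k C i k ^+ l.+1 - \sum_i \sum_k G i k ^+ l.+1| <=
    n%:R * (l.+1%:R * (D * (1 + 2 * K ^+ 2))).
Proof.
move=> Cs Gs C1 G1 K0 D0 CK GK DD.
have K1 : 1 <= 1 + 2 * K ^+ 2 by rewrite lerDl mulr_ge0 // sqr_ge0.
case: l => [|l].
  have := DD (fun=> 1).
  rewrite (_ : \sum_(k < n) 1 ^+ 2 = \sum_(k < n) 1 :> R); last by apply: eq_bigr => k _; rewrite expr1n.
  rewrite sumr_const card_ord -sumrB => h.
  have -> : \sum_i (\sum_k C i k ^+ 1 - \sum_k G i k ^+ 1) =
     \sum_k \sum_l (C k l - G k l) * (1 * 1).
    by apply: eq_bigr => i _; rewrite -sumrB; apply: eq_bigr => k _; rewrite !mulr1.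
  rewrite mulrC; apply: (@le_trans _ _ (D * n%:R)).
    by move: h; congr (`|_| <= _); apply: eq_bigr => i _; apply: eq_bigr => k _; rewrite !mulr1.
  by rewrite mulrC ler_wpM2l // mul1r -[leLHS]mulr1 ler_wpM2l // ltW.
rewrite -sumrB; apply: (le_trans (ler_norm_sum _ _ _)).
rewrite mulr_natl -[X in _ *+ X]card_ord -sumr_const; apply: ler_sum => i _.
rewrite -sumrB; apply: (le_trans (ler_norm_sum _ _ _)).
have Ds k m : C k m - G k m = C m k - G m k by rewrite Cs Gs.
have rD := sym_form_row Ds DD D0 i.
have rC := sym_form_row Cs CK K0 i.
have rG := sym_form_row Gs GK K0 i.
apply: (@le_trans _ _ (\sum_k l.+2%:R * (D^-1 / 2 * (C i k - G i k) ^+ 2 +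
    D * (C i k ^+ 2 + G i k ^+ 2)))).
  apply: ler_sum => k _; apply: (le_trans (power_diff_le _ (C1 i k) (G1 i k))).
  rewrite ler_wpM2l //.
  rewrite -(real_normK (num_real (C i k - G i k))) -(real_normK (num_real (C i k))) -(real_normK (num_real (G i k))).
  set a := `|C i k - G i k|; set b := `|C i k|; set c := `|G i k|.
  have : 0 <= (D^-1 / 2) * (a - D * (b + c)) ^+ 2 + D / 2 * (b - c) ^+ 2.
    by rewrite addr_ge0 // mulr_ge0 ?sqr_ge0 // divr_ge0 // ?invr_ge0; exact: ltW.
  have -> : (D^-1 / 2) * (a - D * (b + c)) ^+ 2 + D / 2 * (b - c) ^+ 2 =
     D^-1 / 2 * a ^+ 2 + D * (b ^+ 2 + c ^+ 2) - a * (b + c).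
    by field; rewrite gt_eqF.
  by rewrite subr_ge0.
rewrite -mulr_sumr ler_wpM2l // big_split /= -!mulr_sumr big_split /=.
apply: (@le_trans _ _ (D^-1 / 2 * D ^+ 2 + D * (K ^+ 2 + K ^+ 2))).
  apply: lerD; rewrite ler_wpM2l ?lerD // ?(ltW D0) // divr_ge0 // invr_ge0.
  exact: ltW.
have -> : D^-1 / 2 * D ^+ 2 + D * (K ^+ 2 + K ^+ 2) = D * (2^-1 + 2 * K ^+ 2).
  by field; rewrite gt_eqF.
by rewrite ler_wpM2l ?(ltW D0) // lerD2r; lra.
Qed.

End power_form.

(** * Uniformly convergent spectral densities *)

Section periodic_measurable.
Context {R : realType}.
Local Notation RT := (measurableTypeR R).
Local Notation I := (`](-pi)%R, pi[%classic : set R).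

(** [g] is recovered from a half-open period by composing with the reduction
    modulo the period, a measurable map. *)
Lemma measurable_periodic (g : R -> R) : periodic g (pi *+ 2) ->
  measurable_fun I g -> measurable_fun setT g.
Proof.
move=> pg mg; have pp := @pi_gt0 R.
pose fl (x : R) : R := (Num.floor x)%:~R.
have mfl : measurable_fun setT fl.
  apply: nondecreasing_measurable => //; move=> x y xy.
  by rewrite ler_int; exact: le_floor.
pose red (x : R) : R := x + pi *+ 2 * - fl ((x + pi) / (pi *+ 2)).
have mred : measurable_fun setT red.
  apply: measurable_funD => //; apply: measurable_funM => //.
  apply: measurableT_comp => //; apply: (measurableT_comp mfl).
  apply: measurable_funM => //; exact: measurable_funD.
have mg2 : measurable_fun `[- pi, pi[ g.
  by apply/measurable_fun_itv_obnd_cbndP.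
pose g0 : R -> R := g \_ `[- pi, pi[.
have mg0 : measurable_fun setT g0 by apply/(measurable_restrictT _ _).1.
have -> : g = g0 \o red.
  apply/funext => x; rewrite /= /g0 patchE ifT.
    by rewrite /red /fl -mulrNz periodicz.
  rewrite inE /= in_itv /= /red /fl.
  have /andP[h1 h2] := floor_itv ((x + pi) / (pi *+ 2)).
  have p2 : 0 < pi *+ 2 :> R by rewrite mulrn_wgt0.
  move: h1 h2; rewrite ler_pdivlMr // ltr_pdivrMr // intrD.
  by set z := _%:~R; rewrite !mulr2n => h1 h2; apply/andP; split; lra.
exact: measurableT_comp.
Qed.

End periodic_measurable.

Section spectral_limit.
Context {R : realType}.
Local Notation mu := (@lebesgue_measure R).
Local Notation RT := (measurableTypeR R).
Local Notation I := (`](-pi)%R, pi[%classic : set R).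
Context (f : nat -> R -> R) (rho : nat -> nat -> R) (u : nat -> R) (g : R -> R).
Hypothesis Xf : forall j, (1 <= j)%N -> spectral_density (rho j) (f j).
Hypothesis u_noninc : forall j k, (1 <= j)%N -> (j <= k)%N -> u k <= u j.
Hypothesis u_to0 : u @ \oo --> (0 : R).
Hypothesis f_close : forall j, (1 <= j)%N ->
  (ereal_sup [set (`|f j x - g x|)%:E | x in [set` `](- pi)%R, pi[%R]] <= (u j)%:E)%E.
Hypothesis g_per : periodic g (pi *+ 2).
Hypothesis g_bnd : exists M : R, forall x, x \in `]-pi, pi[ -> `|g x| <= M.
Hypothesis g_cont0 : {for 0, continuous g}.
Hypothesis rho1 : forall j k, (1 <= j)%N -> `|rho j k| <= 1.

Let mI := @measurable_period R.

Lemma spectral_close j x : (1 <= j)%N -> I x -> `|f j x - g x| <= u j.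
Proof.
move=> j1 Ix; rewrite -lee_fin; apply: le_trans (f_close j1).
by apply: ereal_sup_ubound; exists x.
Qed.

Let I0 : I 0.
Proof. by have := @pi_gt0 R; rewrite /= in_itv /= => ?; apply/andP; split; lra. Qed.

Lemma spectral_error_ge0 j : (1 <= j)%N -> 0 <= u j.
Proof. by move=> j1; exact: le_trans (spectral_close j1 I0). Qed.

Lemma integrable_spectral j : (1 <= j)%N -> mu.-integrable I (EFin \o f j).
Proof. by case/Xf. Qed.

Lemma measurable_spectral j : (1 <= j)%N -> measurable_fun I (f j).
Proof. by move=> j1; exact: measurable_integrableR (integrable_spectral j1). Qed.

Lemma spectral_cvg x : I x -> f j x @[j --> \oo] --> g x.
Proof.
move=> Ix; apply: (@cvg_sub0 _ _ (fun=> g x)); last exact: cvg_cst.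
apply: (cvg_abs0_near _ u_to0); near=> j; rewrite spectral_close //.
by near: j; exact: nbhs_infty_ge.
Unshelve. all: by end_near. Qed.

Lemma limit_density_measurable : measurable_fun setT g.
Proof.
apply: measurable_periodic => //.
apply: (@measurable_fun_cvg _ _ _ _ (fun j => f j.+1)) => [j|x Ix].
  exact: measurable_spectral.
by rewrite (cvg_shiftS (fun j => f j x)); exact: spectral_cvg.
Qed.

(** The hypothesis leaves out the odd multiples of pi, at which [g] takes a
    single value. *)
Lemma limit_density_bounded : exists2 M : R, 0 < M & forall x, `|g x| <= M.
Proof.
have [M gM] := g_bnd.
have M0 : 0 <= M by apply: le_trans (gM 0 _).
exists (M + `|g (- pi)| + 1) => [|x]; first by rewrite ltr_wpDl // addr_ge0.
have pp := @pi_gt0 R.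
have p2 : 0 < pi *+ 2 :> R by rewrite mulrn_wgt0.
pose m := Num.floor ((x + pi) / (pi *+ 2)).
rewrite -(periodicz (- m) x g_per) mulrNz mulrN.
have /andP[h1 h2] := floor_itv ((x + pi) / (pi *+ 2)).
move: h1 h2; rewrite -/m ler_pdivlMr // ltr_pdivrMr // intrD mulrC => h1 h2.
have [e|ne] := eqVneq (x - pi *+ 2 * m%:~R) (- pi).
  by rewrite e; lra.
apply: (@le_trans _ _ M); last by rewrite -addrA lerDl addr_ge0.
apply: gM; rewrite in_itv /= lt_neqAle eq_sym ne /=.
move: h1 h2; rewrite mulr2n; set z := m%:~R => h1 h2.
by apply/andP; split; lra.
Qed.

Definition limit_autocorrelation k := \int[mu]_(x in I) (cos (x * k%:R) * g x).
Local Notation r := limit_autocorrelation.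

Let mgI : measurable_fun I g. Proof. by apply: measurable_funTS; exact: limit_density_measurable. Qed.

Lemma integrable_limit_density : mu.-integrable I (EFin \o g).
Proof.
have [M _ gM] := limit_density_bounded.
by apply: (@integrable_period_bounded _ _ M) => // x _; exact: gM.
Qed.

Lemma trig_coef_close j (e : R -> R) : (1 <= j)%N -> measurable_fun I e ->
  (forall x, `|e x| <= 1) ->
  `|\int[mu]_(x in I) (e x * f j x) - \int[mu]_(x in I) (e x * g x)| <= pi *+ 2 * u j.
Proof.
move=> j1 me e1; have ie w : mu.-integrable I (EFin \o w) ->
    mu.-integrable I (EFin \o (fun x => e x * w x)).
  by apply: (@integrable_period_mul _ _ _ 1).
have i1 := ie _ (integrable_spectral j1); have i2 := ie _ integrable_limit_density.
rewrite -RintegralB // -Rintegral_period_cst; apply: le_Rintegral_norm => //.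
- by apply: measurable_funB; apply: measurable_funM => //;
    exact: measurable_spectral.
- exact: integrable_period_cst.
- move=> x Ix; rewrite -mulrBr normrM -[leRHS]mul1r ler_pM //.
  exact: spectral_close.
Qed.

Lemma limit_coef_cvg (e : R -> R) : measurable_fun I e -> (forall x, `|e x| <= 1) ->
  \int[mu]_(x in I) (e x * f j x) @[j --> \oo] --> \int[mu]_(x in I) (e x * g x).
Proof.
move=> me e1; apply: (@cvg_sub0 _ _ (fun=> \int[mu]_(x in I) (e x * g x))); last exact: cvg_cst.
apply: (cvg_abs0_near _ (@cvg_scale0 _ (pi *+ 2) _ u_to0)); near=> j.
by apply: trig_coef_close => //; near: j; exact: nbhs_infty_ge.
Unshelve. all: by end_near. Qed.

Lemma limit_fourier : fourier_cos g r.
Proof.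
move=> k; split => //.
have h := limit_coef_cvg (measurable_sin_mul k) (fun x => sin_max _).
have h0 : (fun j => \int[mu]_(x in I) (sin (x * k%:R) * f j x)) @ \oo --> (0 : R).
  apply: (@cvg_abs0_near _ _ (fun=> 0)); last exact: cvg_cst.
  near=> j; have [|_ _ /(_ k)[_ ->]] := @Xf j; last by rewrite normr0.
  by near: j; exact: nbhs_infty_ge.
exact: (cvg_unique _ h h0).
Unshelve. all: by end_near. Qed.

Lemma rho_cvg k : (fun j => rho j k) @ \oo --> r k.
Proof.
have h := limit_coef_cvg (measurable_cos_mul k) (fun x => cos_max _).
apply: cvg_trans h; apply: near_eq_cvg; near=> j.
have [|_ _ /(_ k)[]//] := @Xf j.
by near: j; exact: nbhs_infty_ge.
Unshelve. all: by end_near. Qed.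

Lemma limit_autocorrelation_le1 k : `|r k| <= 1.
Proof.
apply: (cvg_le_near _ (cvg_norm (@rho_cvg k))); near=> j; apply: rho1.
by near: j; exact: nbhs_infty_ge.
Unshelve. all: by end_near. Qed.

Lemma toeplitz_form n (v : 'I_n -> R) (a : nat -> R) (w : R -> R) : mu.-integrable I (EFin \o w) ->
  (forall k, \int[mu]_(x in I) (cos (x * k%:R) * w x) = a k) ->
  \sum_(k < n) \sum_(l < n) a `|k - l|%N * (v k * v l) = \int[mu]_(x in I) (trig_sqr v x * w x).
Proof.
move=> iw wa; rewrite Rintegral_trig_sqr //; apply: eq_bigr => k _; apply: eq_bigr => l _.
by rewrite wa mulrC.
Qed.

(** A common bound of the forms of all processes of the array and of the
    limit. *)
Definition spectral_bound := pi *+ 2 * (sval (cid2 limit_density_bounded) + u 1).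
Local Notation K := spectral_bound.

Let boundP : 0 < sval (cid2 limit_density_bounded) /\
   forall x, `|g x| <= sval (cid2 limit_density_bounded).
Proof. by case: cid2. Qed.

Lemma spectral_bound_gt0 : 0 < K.
Proof.
have [M0 _] := boundP; rewrite /K mulr_gt0 //; last by rewrite ltr_wpDr // spectral_error_ge0.
by rewrite mulrn_wgt0 // pi_gt0.
Qed.

Lemma rho_form_bounded j n : (1 <= j)%N ->
  form_norm_bounded (fun i k : 'I_n => rho j `|i - k|%N) K.
Proof.
move=> j1 v; have [_ _ fr] := Xf j1; have [M0 gM] := boundP.
rewrite (toeplitz_form v (integrable_spectral j1) (fun k => (fr k).1)).
apply: trig_form_bound (integrable_spectral j1) _ => x Ix.
have := ler_normD (f j x - g x) (g x); rewrite subrK => /le_trans; apply.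
by rewrite addrC lerD // (le_trans (spectral_close j1 Ix)) // u_noninc.
Qed.

Lemma limit_form_bounded n : form_norm_bounded (fun i k : 'I_n => r `|i - k|%N) K.
Proof.
move=> v; have [M0 gM] := boundP.
rewrite (toeplitz_form v integrable_limit_density (fun k => erefl)).
apply: trig_form_bound integrable_limit_density _ => x Ix.
by rewrite (le_trans (gM x)) // lerDl spectral_error_ge0.
Qed.

Lemma diff_form_bounded j n (D : R) : (1 <= j)%N -> pi *+ 2 * u j <= D ->
  form_norm_bounded (fun i k : 'I_n => rho j `|i - k|%N - r `|i - k|%N) D.
Proof.
move=> j1 uD v; have [_ _ fr] := Xf j1.
have id : mu.-integrable I (EFin \o (fun x => f j x - g x)).
  by apply: integrableBR => //; [exact: integrable_spectral|exact: integrable_limit_density].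
rewrite (toeplitz_form (a := fun k => rho j k - r k) v id); last first.
  move=> k; rewrite -(fr k).1 /r -RintegralB //; last first.
  - apply: (@integrable_period_mul _ _ _ 1); [exact: measurable_cos_mul| |exact: integrable_limit_density].
    by move=> x _; exact: cos_max.
  - apply: (@integrable_period_mul _ _ _ 1); [exact: measurable_cos_mul| |exact: integrable_spectral].
    by move=> x _; exact: cos_max.
  by apply: eq_Rintegral => x _; rewrite mulrBr.
apply: (le_trans (trig_form_bound v id (fun x => @spectral_close j x j1))).
by rewrite ler_wpM2r // sumr_ge0 // => k _; exact: sqr_ge0.
Qed.

(** When [a] is the autocorrelation of a standard Gaussian process X, the variance
    of n^(-1/2) (H_l(X_1) + ... + H_l(X_n)) is l! times this. *)
Definition power_mean (a : nat -> R) l n : R :=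
  n%:R^-1 * \sum_(i < n) \sum_(k < n) a `|i - k|%N ^+ l.

Lemma power_mean_close j n l (D : R) : (1 <= j)%N -> pi *+ 2 * u j <= D -> 0 < D ->
  `|power_mean (rho j) l.+1 n - power_mean r l.+1 n| <=
  l.+1%:R * (D * (1 + 2 * K ^+ 2)).
Proof.
move=> j1 uD D0; rewrite /power_mean -mulrBr normrM normfV normr_nat.
have [->|n0] := posnP n.
  by rewrite invr0 mul0r !mulr_ge0 ?(ltW D0) // addr_ge0 // mulr_ge0 // sqr_ge0.
rewrite mulrC ler_pdivrMr ?ltr0n // [leRHS]mulrC; apply: form_power_diff => //.
- by move=> i k; rewrite distnC.
- by move=> i k; rewrite distnC.
- by move=> i k; exact: rho1.
- by move=> i k; exact: limit_autocorrelation_le1.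
- exact: spectral_bound_gt0.
- exact: rho_form_bounded.
- exact: limit_form_bounded.
- exact: diff_form_bounded.
Qed.

Lemma power_mean_cvg (n : nat -> nat) l : n @ \oo --> \oo ->
  power_mean (rho j) l.+1 (n j) @[j --> \oo] --> pi *+ 2 * selfconv g l.+1 0.
Proof.
move=> ninf; have [M M0 gM] := limit_density_bounded.
have h1 := @selfconv_fejer _ _ _ _ l limit_density_measurable gM g_per limit_fourier g_cont0.
have h2 : power_mean r l.+1 (n j) @[j --> \oo] --> pi *+ 2 * selfconv g l.+1 0.
  exact: (cvg_comp n _ ninf h1).
(* the second term makes the bound positive even when [u j] vanishes *)
pose D j := pi *+ 2 * u j + j.+1%:R^-1.
pose c := l.+1%:R * (1 + 2 * K ^+ 2).
have hD : (fun j => c * D j) @ \oo --> (0 : R).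
  apply: cvg_scale0; apply: cvg_add0; first exact: cvg_scale0.
  exact: (@cvg_harmonic R).
apply: (cvg_sub0 _ h2); apply: (cvg_abs0_near _ hD); near=> j.
have j1 : (1 <= j)%N by near: j; exact: nbhs_infty_ge.
apply: (le_trans (@power_mean_close j (n j) l (D j) j1 _ _)).
- by rewrite /D lerDl invr_ge0.
- rewrite /D ltr_wpDl ?invr_gt0 ?ltr0n // mulr_ge0 ?spectral_error_ge0 //.
  by rewrite ltW // mulrn_wgt0 // pi_gt0.
- by rewrite /c -mulrA [D j * _]mulrC.
Unshelve. all: by end_near. Qed.

(** For l = 0 this is the bound of the form at (1, ..., 1); for higher powers
    entries at most 1 reduce it to the bound of the rows in l2. *)
Lemma power_mean_bounded j n l : (1 <= j)%N -> `|power_mean (rho j) l.+1 n| <= K + K ^+ 2.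
Proof.
move=> j1; have K0 := spectral_bound_gt0.
rewrite /power_mean normrM normfV normr_nat.
have [->|n0] := posnP n; first by rewrite invr0 mul0r addr_ge0 ?sqr_ge0 ?(ltW K0).
rewrite mulrC ler_pdivrMr ?ltr0n //.
have CK := @rho_form_bounded j n j1.
have Cs (i k : 'I_n) : rho j `|i - k|%N = rho j `|k - i|%N by rewrite distnC.
case: l => [|l].
  have := CK (fun=> 1).
  rewrite (_ : \sum_(k < n) 1 ^+ 2 = n%:R :> R); last first.
    rewrite -[in RHS](card_ord n) -sumr_const; apply: eq_bigr => k _; exact: expr1n.
  rewrite (_ : \sum_k \sum_l _ = \sum_(i < n) \sum_(k < n) rho j `|i - k|%N ^+ 1); last first.
    by apply: eq_bigr => i _; apply: eq_bigr => k _; rewrite !mulr1.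
  by move=> h; rewrite (le_trans h) // ler_wpM2r // lerDl sqr_ge0.
apply: (le_trans (ler_norm_sum _ _ _)).
apply: (@le_trans _ _ (\sum_(i < n) K ^+ 2)); last first.
  rewrite sumr_const card_ord -[K ^+ 2 *+ n]mulr_natr; apply: ler_wpM2r => //.
  by rewrite lerDr ltW.
apply: ler_sum => i _; apply: (le_trans (ler_norm_sum _ _ _)).
apply: le_trans (sym_form_row Cs CK K0 i); apply: ler_sum => k _.
rewrite normrX -[leRHS]real_normK ?num_real // !exprS expr0 mulr1 mulrA.
by rewrite ler_piMr ?mulr_ge0 // exprn_ile1 // rho1.
Qed.

End spectral_limit.

(** * Normalized sums of one process *)

Section one_process.
Context d (T : measurableType d) (R : realType) (P : probability T R).
Variable X : nat -> {RV P >-> R}.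
Hypothesis Xgauss : gaussian_process X.
Hypothesis Xstat : stationary X.
Hypothesis Xstd : standard X.
Variable rho : nat -> R.
Hypothesis Xrho : autocorrelation X rho.
Local Notation RT := (measurableTypeR R).
Local Notation gam := (@normal_prob R 0 1).
Implicit Types (h : R -> R) (b : {poly R}) (n k i : nat) (a : nat -> R).

Let GE n := process_gaussian_mean Xgauss Xstd n.

(** The mean squares of X_0 + X_k and of X_0 - X_k are nonnegative. *)
Lemma autocorrelation_le1 k : `|rho k| <= 1.
Proof.
have GEk := GE k.+1.
rewrite -(_ : process_cov Xgauss (ord0 : 'I_k.+1) ord_max = rho k); last first.
  by rewrite (process_covE Xgauss Xstat Xstd _ _ Xrho) distnEr // subn0.
have e (s : R) : s ^+ 2 = 1 -> 0 <= 2 + 2 * s * process_cov Xgauss (ord0 : 'I_k.+1) ord_max.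
  move=> s2; have := mean_sqr_ge0 GEk ('x_ord0 + s *: 'x_ord_max).
  have -> : ('x_ord0 + s *: 'x_ord_max) ^+ 2 = 'x_ord0 * 'x_ord0 +
      ((s ^+ 2) *: ('x_ord_max * 'x_ord_max) + (2 * s) *: ('x_ord0 * 'x_ord_max)) :> {mpoly R[k.+1]}.
    rewrite sqrrD exprZn -scalerAr -scaler_nat scalerA !expr2 -addrA; congr (_ + _).
    by rewrite addrC.
  by rewrite !meanD !meanZ !(gmean_cov GEk) !(gmean_var GEk) s2; lra.
have sN : (-1 : R) ^+ 2 = 1 by rewrite sqrrN expr1n.
have h1 := e 1 (expr1n _ _); have h2 := e (-1) sN; rewrite ler_norml.
by apply/andP; split; lra.
Qed.

Lemma process_law i : has_law P (X i.+1) gam.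
Proof.
rewrite -normal_law1.
have [m [v [v0 hl]]] := linear_comb_law Xgauss (fun k : 'I_i.+1 => (k == ord_max)%:R).
have {}hl : has_law P (X i.+1) (normal_law m v).
  move: hl; congr has_law; apply/funext => w.
  rewrite (bigD1 ord_max) //= eqxx mul1r big1 ?addr0 // => k km.
  by rewrite (negPf km) mul0r.
have [EX VX] := Xstd i.+1.
have m0 : m = 0.
  rewrite -(normal_law_mean m v0) -(Rintegral_law hl) //; last first.
    by have := integrable_normal_law_pow 1 m v0; congr (integrable _ _ (EFin \o _)).
  by move: EX; rewrite unlock /Rintegral => ->.
rewrite m0 in hl; suff -> : 1 = v by [].
have := normal_law_moment 1 v0; rewrite mulr1 normal_law_moment0 mulr1 => <-.
rewrite -(Rintegral_law hl (f := fun x => x ^+ 2)) //; last exact: integrable_normal_law_pow.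
  move: VX; rewrite /variance (covariance_centered EX EX) => VX.
  have -> : \int[P]_w (X i.+1 w ^+ 2) = \int[P]_w (X i.+1 w * X i.+1 w) by [].
  by rewrite /Rintegral VX.
Qed.

Lemma square_integrable_process h i : square_integrable gam (h : RT -> R) ->
  square_integrable P (fun w => h (X i.+1 w)) /\
  \int[P]_w (h (X i.+1 w) ^+ 2) = \int[gam]_x (h x ^+ 2).
Proof.
move=> [mh ih]; have mh2 : measurable_fun setT (fun x : R => h x ^+ 2) by exact: measurable_funX.
split; last by rewrite (Rintegral_law (process_law i) mh2 ih).
have mX : @measurable_fun _ _ T RT setT (X i.+1) by have [] := process_law i.
split; first exact: (measurableT_comp mh mX).
exact: (integrable_law (process_law i) mh2 ih).
Qed.

Lemma mean_process h i : square_integrable gam (h : RT -> R) ->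
  \int[P]_w h (X i.+1 w) = \int[gam]_x h x.
Proof.
move=> sh; apply: (Rintegral_law (process_law i)); first by case: sh.
exact: square_integrable_integrable.
Qed.

Lemma normalized_sumE h n w : normalized_sum h (fun i => X i) n w =
  \sum_(i < n) (Num.sqrt n%:R)^-1 * h (X i.+1 w).
Proof. by rewrite /normalized_sum big_add1 big_mkord mulr_sumr. Qed.

Lemma normalized_sumB h1 h2 n w :
  normalized_sum (fun x => h1 x - h2 x) (fun i => X i) n w =
  normalized_sum h1 (fun i => X i) n w - normalized_sum h2 (fun i => X i) n w.
Proof. by rewrite !normalized_sumE -sumrB; apply: eq_bigr => i _; rewrite mulrBr. Qed.

Lemma square_integrable_normalized_sum h n : square_integrable gam (h : RT -> R) ->
  square_integrable P (normalized_sum h (fun i => X i) n).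
Proof.
move=> sh; rewrite (_ : normalized_sum _ _ _ = (fun w => \sum_(i < n) (Num.sqrt n%:R)^-1 * h (X i.+1 w))).
  apply: square_integrable_sum => i; apply: square_integrableZ.
  by case: (square_integrable_process i sh).
by apply/funext => w; exact: normalized_sumE.
Qed.

Lemma mean_normalized_sum h n : square_integrable gam (h : RT -> R) ->
  \int[gam]_x h x = 0 -> \int[P]_w normalized_sum h (fun i => X i) n w = 0.
Proof.
move=> sh h0; under eq_Rintegral do rewrite normalized_sumE.
have ih i : P.-integrable setT (EFin \o (fun w => h (X i.+1 w))).
  by apply: square_integrable_integrable; case: (square_integrable_process i sh).
rewrite Rintegral_sum // => [|i]; last exact: integrableZlR.
by rewrite big1 // => i _; rewrite RintegralZl // mean_process // h0 mulr0.
Qed.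

Lemma inv_sqrt_sqr n : (Num.sqrt n%:R)^-1 ^+ 2 = n%:R^-1 :> R.
Proof. by rewrite exprVn sqr_sqrtr. Qed.

Lemma sqr_sum_le n (z : 'I_n -> R) : (\sum_i z i) ^+ 2 <= n%:R * \sum_i z i ^+ 2.
Proof.
have : 0 <= \sum_i \sum_k (z i - z k) ^+ 2.
  by do 2 (apply: sumr_ge0 => ? _); exact: sqr_ge0.
have -> : \sum_i \sum_k (z i - z k) ^+ 2 = 2 * (n%:R * \sum_i z i ^+ 2 - (\sum_i z i) ^+ 2).
  transitivity (\sum_i \sum_(k < n) (z i ^+ 2) + (\sum_(i < n) \sum_k z k ^+ 2 - 2 * \sum_i \sum_k z i * z k)).
    rewrite mulr_sumr -sumrB -big_split; apply: eq_bigr => i _ /=.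
    rewrite mulr_sumr -sumrB -big_split; apply: eq_bigr => k _ /=; ring.
  rewrite sumr_const card_ord; under eq_bigr do rewrite sumr_const card_ord -[_ *+ n]mulr_natl.
  rewrite -mulr_sumr -[_ *+ n]mulr_natl expr2 mulr_suml.
  have -> : \sum_i z i * \sum_j z j = \sum_i \sum_k z i * z k.
    by apply: eq_bigr => i _; rewrite mulr_sumr.
  ring.
by rewrite pmulr_rge0 // subr_ge0.
Qed.

(** A crude bound that ignores correlations, but holds for every square
    integrable [h]; it serves with [n] fixed. *)
Lemma mean_sqr_normalized_sum_le h n : square_integrable gam (h : RT -> R) ->
  \int[P]_w (normalized_sum h (fun i => X i) n w ^+ 2) <= n%:R * \int[gam]_x (h x ^+ 2).
Proof.
move=> sh; set S := \int[gam]_x _.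
have S0 : 0 <= S by apply: Rintegral_ge0 => x _; exact: sqr_ge0.
have ih i : P.-integrable setT (EFin \o (fun w => h (X i.+1 w) ^+ 2)).
  by case: (square_integrable_process i sh) => -[].
apply: (@le_trans _ _ (\int[P]_w (\sum_(i < n) h (X i.+1 w) ^+ 2))).
  apply: le_Rintegral => //.
  - by case: (square_integrable_normalized_sum n sh).
  - exact: integrable_sumR.
  move=> w _; rewrite normalized_sumE -mulr_sumr exprMn inv_sqrt_sqr.
  have [n0|n0] := posnP n.
    by rewrite [n in n%:R]n0 invr0 mul0r; apply: sumr_ge0 => i _; exact: sqr_ge0.
  by rewrite mulrC ler_pdivrMr ?ltr0n // mulrC; exact: sqr_sum_le.
rewrite Rintegral_sum //.
rewrite (eq_bigr (fun=> S)) => [|i _]; first by rewrite sumr_const card_ord -[_ *+ n]mulr_natl.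
by case: (square_integrable_process i sh).
Qed.

Lemma normalized_sum_lin_stat b n w :
  normalized_sum (fun x => b.[x]) (fun i => X i) n w =
  (lin_stat (fun=> (Num.sqrt n%:R)^-1) b).@[fun i : 'I_n => X i.+1 w].
Proof.
rewrite normalized_sumE /lin_stat meval_sum; apply: eq_bigr => i _.
by rewrite mpoly.mevalZ meval_at_var.
Qed.

Lemma normalized_sum_moment b n k :
  \int[P]_w (normalized_sum (fun x => b.[x]) (fun i => X i) n w ^+ k) =
  process_mean X (lin_stat (fun=> (Num.sqrt n%:R)^-1) b ^+ k : {mpoly R[n]}).
Proof.
by apply: eq_Rintegral => w _; rewrite normalized_sum_lin_stat mevalXn.
Qed.

Lemma normalized_sum_all_moments b n :
  all_moments P (normalized_sum (fun x => b.[x]) (fun i => X i) n).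
Proof.
rewrite (_ : normalized_sum _ _ _ =
  (fun w => (lin_stat (fun=> (Num.sqrt n%:R)^-1) b).@[fun i : 'I_n => X i.+1 w])).
  by apply: all_moments_mpoly => i; exact: (var_all_moments Xgauss).
by apply/funext => w; exact: normalized_sum_lin_stat.
Qed.

Lemma mean_sqr_hermite_normalized_sum L a n :
  \int[P]_w (normalized_sum (fun x => (hermite_sum L a).[x]) (fun i => X i) n w ^+ 2) =
  \sum_(l < L) a l ^+ 2 * l.+1`!%:R * power_mean rho l.+1 n.
Proof.
rewrite normalized_sum_moment (mean_sqr_lin_stat (GE n)) inv_sqrt_sqr.
rewrite (eq_bigr (fun i : 'I_n => \sum_(l < L) \sum_(k < n) a l ^+ 2 * l.+1`!%:R * rho `|i - k|%N ^+ l.+1)).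
  rewrite exchange_big mulr_sumr; apply: eq_bigr => l _ /=.
  rewrite /power_mean mulrCA; congr (_ * _); rewrite mulr_sumr; apply: eq_bigr => i _.
  by rewrite mulr_sumr.
move=> i _; rewrite exchange_big; apply: eq_bigr => l _; apply: eq_bigr => k _.
by rewrite (process_covE Xgauss Xstat Xstd _ _ Xrho).
Qed.

Lemma process_form_bounded K n : form_norm_bounded (fun i k : 'I_n => rho `|i - k|%N) K ->
  form_bounded (@process_cov _ _ _ _ _ Xgauss n) K.
Proof.
move=> h v; apply: (le_trans (ler_norm _)); have := h v; congr (`|_| <= _).
apply: eq_bigr => i _; apply: eq_bigr => k _.
by rewrite (process_covE Xgauss Xstat Xstd _ _ Xrho).
Qed.

Lemma hermite_moment_recursion K B L a r n : (0 < n)%N ->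
  (forall N (C : 'I_N -> 'I_N -> R) E (w : R),
    gaussian_mean C E -> form_bounded C K -> 0 < w -> w ^+ 2 * N%:R <= 1 ->
    `|E (lin_stat (fun=> w) (hermite_sum L a) ^+ r.+2) -
      r.+1%:R * E (lin_stat (fun=> w) (hermite_sum L a) ^+ 2) *
      E (lin_stat (fun=> w) (hermite_sum L a) ^+ r)| <= B * w) ->
  form_norm_bounded (fun i k : 'I_n => rho `|i - k|%N) K ->
  `|\int[P]_w (normalized_sum (fun x => (hermite_sum L a).[x]) (fun i => X i) n w ^+ r.+2) -
    r.+1%:R *
    \int[P]_w (normalized_sum (fun x => (hermite_sum L a).[x]) (fun i => X i) n w ^+ 2) *
    \int[P]_w (normalized_sum (fun x => (hermite_sum L a).[x]) (fun i => X i) n w ^+ r)|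
    <= B * (Num.sqrt n%:R)^-1.
Proof.
move=> n0 H hK; rewrite !normalized_sum_moment.
apply: (H _ _ _ _ (GE n) (process_form_bounded hK)).
  by rewrite invr_gt0 sqrtr_gt0 ltr0n.
by rewrite inv_sqrt_sqr mulVf // pnatr_eq0 -lt0n.
Qed.

End one_process.

(** * Limit theorem for an array *)

Section clt.
Context d (T : measurableType d) (R : realType) (P : probability T R).
Variables (X : nat -> nat -> {RV P >-> R}) (rho : nat -> nat -> R) (n : nat -> nat).
Variables (h : R -> R) (V : nat -> R) (K C : R).
Local Notation RT := (measurableTypeR R).
Local Notation gam := (@normal_prob R 0 1).
Hypothesis Xgauss : forall j, (1 <= j)%N -> gaussian_process (X j).
Hypothesis Xstat : forall j, (1 <= j)%N -> stationary (X j).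
Hypothesis Xstd : forall j, (1 <= j)%N -> standard (X j).
Hypothesis Xrho : forall j, (1 <= j)%N -> autocorrelation (X j) (rho j).
Hypothesis n_infty : n @ \oo --> \oo.
Hypothesis K0 : 0 < K.
Hypothesis rho_bounded : forall j, (1 <= j)%N ->
  form_norm_bounded (fun i k : 'I_(n j) => rho j `|i - k|%N) K.
Hypothesis V_cvg : forall l, (fun j => power_mean (rho j) l.+1 (n j)) @ \oo --> V l.
Hypothesis pm_bounded : forall j l, (1 <= j)%N -> `|power_mean (rho j) l.+1 (n j)| <= C.
Hypothesis sh : square_integrable gam (h : RT -> R).
Hypothesis dense : forall e : R, 0 < e -> exists p : {poly R}, \int[gam]_x ((h x - p.[x]) ^+ 2) <= e.
(* Hermite rank at least 1 *)
Hypothesis h0 : hermite_coef h 0 = 0.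
Implicit Types (j l L M : nat).

Local Notation c := (hermite_coef h).
Let a l : R := c l.+1 / l.+1`!%:R.
Let s l : R := c l.+1 ^+ 2 / l.+1`!%:R.
Let Y j : T -> R := normalized_sum h (fun i => X j i) (n j).
Let Z L j : T -> R := normalized_sum (fun x => (hermite_sum L a).[x]) (fun i => X j i) (n j).
(* the mean square, under the Gaussian law, of [h] beyond level [L] *)
Let tail L : R := \int[gam]_x ((h x - (hermite_sum L a).[x]) ^+ 2).
Let v L : R := \sum_(l < L) s l * V l.

Let s_ge0 l : 0 <= s l. Proof. by rewrite divr_ge0 // sqr_ge0. Qed.

Let a_s l : a l ^+ 2 * l.+1`!%:R = s l.
Proof.
rewrite /a /s; have := @fact_neq0 R l.+1; set F := l.+1`!%:R => F0.
by field.
Qed.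

Let hermite_partS L : hermite_part h L.+1 = hermite_sum L a.
Proof. by rewrite /hermite_part big_ord_recl h0 mul0r scale0r add0r. Qed.

Let tailE L : tail L = \int[gam]_x (h x ^+ 2) - \sum_(l < L) s l.
Proof.
rewrite /tail -hermite_partS (mean_sqr_hermite_part sh) big_ord_recl h0 expr0n mul0r add0r.
by [].
Qed.

Let tail_ge0 L : 0 <= tail L.
Proof. by apply: Rintegral_ge0 => x _; exact: sqr_ge0. Qed.

Let tail_cvg : tail @ \oo --> (0 : R).
Proof.
have -> : tail = (fun L => \int[gam]_x ((h x - (hermite_part h L.+1).[x]) ^+ 2)).
  by apply/funext => L; rewrite hermite_partS.
rewrite (cvg_shiftS (fun L => \int[gam]_x ((h x - (hermite_part h L).[x]) ^+ 2))).
exact: hermite_part_cvg.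
Qed.

Let C0 : 0 <= C. Proof. exact: le_trans (pm_bounded 0 (leqnn 1)). Qed.

Let V_bounded l : `|V l| <= C.
Proof.
apply: (cvg_le_near _ (cvg_norm (@V_cvg l))); near=> j; apply: pm_bounded.
by near: j; exact: nbhs_infty_ge.
Unshelve. all: by end_near. Qed.

(** A sum over the levels between [L] and [M], weighted by bounded numbers, is
    controlled by the part of [h] beyond level [L]. *)
Let tail_sum_le (w : nat -> R) L M : (forall l, `|w l| <= C) -> (L <= M)%N ->
  `|\sum_(l < M) s l * w l - \sum_(l < L) s l * w l| <= C * tail L.
Proof.
move=> wC LM; have e (z : nat -> R) : \sum_(l < M) z l - \sum_(l < L) z l = \sum_(L <= l < M) z l.
  by rewrite -!(big_mkord xpredT z) (big_cat_nat (leq0n L) LM) /= addrAC subrr add0r.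
rewrite (e (fun l => s l * w l)); apply: (le_trans (ler_norm_sum _ _ _)).
apply: (@le_trans _ _ (\sum_(L <= l < M) C * s l)).
  by apply: ler_sum => l _; rewrite normrM (ger0_norm (s_ge0 l)) mulrC ler_wpM2r.
rewrite -mulr_sumr ler_wpM2l // -e.
by have := tail_ge0 M; rewrite !tailE; lra.
Qed.

Let sq_Z L j : (1 <= j)%N -> square_integrable P (Z L j).
Proof.
by move=> j1; apply: (square_integrable_normalized_sum (Xgauss j1) (Xstd j1)); exact: square_integrable_poly.
Qed.

Let sq_Y j : (1 <= j)%N -> square_integrable P (Y j).
Proof. by move=> j1; exact: (square_integrable_normalized_sum (Xgauss j1) (Xstd j1)). Qed.

Let mean_sqr_Z L j : (1 <= j)%N ->
  \int[P]_w (Z L j w ^+ 2) = \sum_(l < L) s l * power_mean (rho j) l.+1 (n j).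
Proof.
move=> j1; rewrite (mean_sqr_hermite_normalized_sum (Xgauss j1) (Xstat j1) (Xstd j1) (Xrho j1)).
by apply: eq_bigr => l _; rewrite a_s.
Qed.

Let mean_sqr_Z_cvg L : (fun j => \int[P]_w (Z L j w ^+ 2)) @ \oo --> v L.
Proof.
have : (fun j => \sum_(l < L) s l * power_mean (rho j) l.+1 (n j)) @ \oo --> v L.
  by apply: cvg_sumR => l; apply: cvg_scale; exact: V_cvg.
apply: cvg_trans; apply: near_eq_cvg; near=> j; rewrite mean_sqr_Z //.
by near: j; exact: nbhs_infty_ge.
Unshelve. all: by end_near. Qed.

Let v_ge0 L : 0 <= v L.
Proof.
apply: (@cvgr_to_ge _ _ _ _ _ _ _ (@mean_sqr_Z_cvg L)).
by apply: nearW => j; apply: Rintegral_ge0 => w _; exact: sqr_ge0.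
Qed.

Let v_cauchy L M : (L <= M)%N -> `|v M - v L| <= C * tail L.
Proof. exact: tail_sum_le. Qed.

Let tailC_cvg : (fun L => C * tail L) @ \oo --> (0 : R).
Proof. exact: (@cvg_scale0 _ C _ tail_cvg). Qed.

(** The sum of the series with terms c_l^2 / l! V_(l-1): it converges because V
    is bounded and the c_l^2 / l! are summable. *)
Definition limit_variance : R := lim (v @ \oo).
Local Notation sigma2 := limit_variance.

Lemma limit_variance_cvg : v @ \oo --> sigma2.
Proof.
suff : cvgn v by [].
apply: cauchy_cvg; apply/cauchy_ballP => e e0.
have e2 : 0 < e / 2 by lra.
have /cvgrPdist_lt/(_ _ e2)[N _ hN] := tailC_cvg.
exists (v @` [set M | (N <= M)%N], v @` [set M | (N <= M)%N]) => [|[x y] [/= [M1 h1 <-] [M2 h2 <-]]].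
  by split; exists N => // M hM; exists M.
have := hN N (leqnn N); rewrite /= sub0r normrN => /(le_lt_trans (ler_norm _)) t2.
have := v_cauchy h1; have := v_cauchy h2; rewrite /ball /= !ler_norml ltr_norml.
by move=> /andP[? ?] /andP[? ?]; apply/andP; split; lra.
Qed.

Let v_close L : `|sigma2 - v L| <= C * tail L.
Proof.
have hc : (fun M => `|v M - v L|) @ \oo --> `|sigma2 - v L|.
  apply: cvg_norm; apply: cvgB; [exact: limit_variance_cvg|exact: cvg_cst].
apply: (cvg_le_near _ hc); near=> M; apply: v_cauchy.
by near: M; exact: nbhs_infty_ge.
Unshelve. all: by end_near. Qed.

Lemma limit_variance_ge0 : 0 <= sigma2.
Proof. by apply: (@cvgr_to_ge _ _ _ _ _ _ _ limit_variance_cvg); exact: nearW. Qed.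

Let Y_Z_diff M j : (1 <= j)%N ->
  \int[P]_w ((Y j w - Z M j w) ^+ 2) <= (n j)%:R * tail M.
Proof.
move=> j1; have sd := square_integrableB sh (square_integrable_poly (hermite_sum M a)).
have := mean_sqr_normalized_sum_le (Xgauss j1) (Xstd j1) (n j) sd.
by congr (_ <= _); apply: eq_Rintegral => w _; rewrite normalized_sumB.
Qed.

Let Y_Z_cvg j : (1 <= j)%N -> (fun M => \int[P]_w ((Y j w - Z M j w) ^+ 2)) @ \oo --> (0 : R).
Proof.
move=> j1; apply: (cvg_abs0_near _ (@cvg_scale0 _ (n j)%:R _ tail_cvg)).
apply: nearW => M; rewrite ger0_norm; first exact: Y_Z_diff.
by apply: Rintegral_ge0 => w _; exact: sqr_ge0.
Qed.

(** The crude bound of [mean_sqr_normalized_sum_le] shows that Z_M tends to Y in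
    mean square for fixed [j] as M grows; the bound between Z_L and Z_M, which is
    uniform in [j], passes to the limit. *)
Let mean_sqr_Y_close L j : (1 <= j)%N ->
  `|\int[P]_w (Y j w ^+ 2) - \int[P]_w (Z L j w ^+ 2)| <= C * tail L.
Proof.
move=> j1; have hc := mean_sqr_cvg (sq_Y j1) (fun M => sq_Z M j1) (Y_Z_cvg j1).
have {}hc : (fun M => `|\int[P]_w (Z M j w ^+ 2) - \int[P]_w (Z L j w ^+ 2)|) @ \oo -->
    `|\int[P]_w (Y j w ^+ 2) - \int[P]_w (Z L j w ^+ 2)|.
  by apply: cvg_norm; apply: cvgB; [exact: hc|exact: cvg_cst].
apply: (cvg_le_near _ hc); near=> M; rewrite !mean_sqr_Z //.
apply: (@tail_sum_le (fun l => power_mean (rho j) l.+1 (n j))); first by move=> l; exact: pm_bounded.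
by near: M; exact: nbhs_infty_ge.
Unshelve. all: by end_near. Qed.

Lemma mean_sqr_cvg_limit_variance : (fun j => \int[P]_w (Y j w ^+ 2)) @ \oo --> sigma2.
Proof.
apply: (cvg_of_approximants (A := fun L j => \int[P]_w (Z L j w ^+ 2))
  (r := fun L _ => C * tail L) (A' := v) (r' := fun L => C * tail L)).
- near=> j => L; apply: mean_sqr_Y_close; near: j; exact: nbhs_infty_ge.
- exact: mean_sqr_Z_cvg.
- by move=> L; exact: cvg_cst.
- exact: v_close.
- exact: tailC_cvg.
Unshelve. all: by end_near. Qed.

Let Z_diff L M j : (1 <= j)%N -> (L <= M)%N ->
  \int[P]_w ((Z M j w - Z L j w) ^+ 2) <= C * tail L.
Proof.
move=> j1 LM; pose b l : R := if (l < L)%N then 0 else a l.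
have eb : hermite_sum M a - hermite_sum L a = hermite_sum M b.
  have hs (z : nat -> R) N : hermite_sum N z = \sum_(0 <= l < N) z l *: hermite R l.+1.
    by rewrite big_mkord.
  rewrite !hs !(big_cat_nat (leq0n L) LM) /= addrAC subrr add0r.
  rewrite [X in _ = X + _]big1_seq ?add0r => [|l]; last first.
    by rewrite mem_index_iota => /andP[_ /andP[_ lL]]; rewrite /b lL scale0r.
  rewrite big_nat_cond [RHS]big_nat_cond; apply: eq_bigr => l /andP[/andP[Ll _] _].
  by rewrite /b ltnNge Ll.
have -> : \int[P]_w ((Z M j w - Z L j w) ^+ 2) =
    \int[P]_w (normalized_sum (fun x => (hermite_sum M b).[x]) (fun i => X j i) (n j) w ^+ 2).
  apply: eq_Rintegral => w _; rewrite -eb /Z -normalized_sumB; congr (_ ^+ 2).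
  by congr normalized_sum; apply/funext => x; rewrite hornerD hornerN.
rewrite (mean_sqr_hermite_normalized_sum (Xgauss j1) (Xstat j1) (Xstd j1) (Xrho j1)).
pose w l : R := if (l < L)%N then 0 else power_mean (rho j) l.+1 (n j).
have wC l : `|w l| <= C by rewrite /w; case: ifP => _; [rewrite normr0|exact: pm_bounded].
have := @tail_sum_le w L M wC LM.
rewrite [X in _ - X]big1 ?subr0 => [|l _]; last by rewrite /w ltn_ord mulr0.
move=> /(le_trans (ler_norm _)); congr (_ <= _); apply: eq_bigr => l _.
by rewrite /w /b; case: ifP => _; rewrite ?a_s ?expr0n ?mulr0 ?mul0r.
Qed.

(** The same passage to the limit, for the differences. *)
Let Y_Z_close L j : (1 <= j)%N -> \int[P]_w ((Y j w - Z L j w) ^+ 2) <= 2 * C * tail L.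
Proof.
move=> j1.
have hc : (fun M => 2 * \int[P]_w ((Y j w - Z M j w) ^+ 2) + 2 * C * tail L) @ \oo --> 2 * C * tail L.
  rewrite -[X in _ --> X]add0r; apply: cvgD; last exact: cvg_cst.
  by apply: cvg_scale0; exact: Y_Z_cvg.
apply: (@cvgr_to_ge _ _ _ _ _ _ _ hc); near=> M.
have LM : (L <= M)%N by near: M; exact: nbhs_infty_ge.
have -> : \int[P]_w ((Y j w - Z L j w) ^+ 2) =
    \int[P]_w (((Y j w - Z M j w) + (Z M j w - Z L j w)) ^+ 2).
  by apply: eq_Rintegral => w _; congr (_ ^+ 2); ring.
apply: (le_trans (mean_sqr_add_le _ _)).
- by apply: square_integrableB; [exact: sq_Y|exact: sq_Z].
- by apply: square_integrableB; exact: sq_Z.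
- by rewrite lerD2l -mulrA ler_wpM2l //; exact: Z_diff.
Unshelve. all: by end_near. Qed.

Let n_near (A : set nat) : (\forall m \near \oo, A m) -> \forall j \near \oo, A (n j).
Proof. by move=> hA; have := n_infty hA. Qed.

Let inv_sqrt_cvg : (fun j => (Num.sqrt (n j)%:R)^-1) @ \oo --> (0 : R).
Proof.
apply/cvgrPdist_le => e e0; near=> j; rewrite sub0r normrN ger0_norm ?invr_ge0 //.
have nj : e^-1 ^+ 2 <= (n j)%:R.
  near: j; have hn : \forall m \near \oo, e^-1 ^+ 2 <= m%:R by exact: nbhs_infty_ger.
  exact: (n_near hn).
rewrite -[leRHS]invrK lef_pV2 ?posrE ?invr_gt0 //.
  by rewrite -[leLHS]ger0_norm ?invr_ge0 ?(ltW e0) // -sqrtr_sqr ler_wsqrtr.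
by rewrite sqrtr_gt0 (lt_le_trans _ nj) // exprn_gt0 // invr_gt0.
Unshelve. all: by end_near. Qed.

(** Induction on the order: 0 and 1 by computation, then two by two with the
    asymptotic recursion. *)
Let Z_moment_cvg L k :
  (fun j => \int[P]_w (Z L j w ^+ k)) @ \oo --> \int[normal_law 0 (v L)]_x (x ^+ k).
Proof.
pose m k j := \int[P]_w (Z L j w ^+ k).
pose I k := \int[normal_law 0 (v L)]_x (x ^+ k).
have m0 : m 0%N @ \oo --> I 0%N.
  rewrite /I normal_law_moment0 (_ : m 0%N = fun=> 1); first exact: cvg_cst.
  by apply/funext => j; exact: Rintegral_prob_cst.
have m1 : m 1%N @ \oo --> I 1%N.
  rewrite /I (normal_law_moment 0 (v_ge0 L)) mulr0 mul0r.
  apply: (@cvg_abs0_near _ _ (fun=> 0)); last exact: cvg_cst.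
  near=> j; have j1 : (1 <= j)%N by near: j; exact: nbhs_infty_ge.
  rewrite /m; under eq_Rintegral do rewrite expr1.
  rewrite (mean_normalized_sum (Xgauss j1) (Xstd j1)) ?normr0 //.
    exact: square_integrable_poly.
  by rewrite Rintegral_normal_prob_poly gauss_mean_hermite_sum.
have mS r : m r @ \oo --> I r -> m r.+2 @ \oo --> I r.+2.
  move=> hr; rewrite /I (normal_law_moment r.+1 (v_ge0 L)) /= -/(I r).
  have [B HB] := @stein_moment_recursion R K L a r K0.
  apply: (@cvg_sub0 _ _ (fun j => r.+1%:R * m 2%N j * m r j)).
    apply: (cvg_abs0_near _ (@cvg_scale0 _ B _ inv_sqrt_cvg)); near=> j.
    have j1 : (1 <= j)%N by near: j; exact: nbhs_infty_ge.
    have nj : (0 < n j)%N.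
      near: j; have hn : \forall m \near \oo, (0 < m)%N by exact: nbhs_infty_gt.
      exact: (n_near hn).
    exact: (hermite_moment_recursion (Xgauss j1) (Xstat j1) (Xstd j1) (Xrho j1) nj HB (rho_bounded j1)).
  rewrite (mulrC (v L)); apply: cvgM => //; apply: cvg_scale; exact: mean_sqr_Z_cvg.
suff : m k @ \oo --> I k /\ m k.+1 @ \oo --> I k.+1 by case.
by elim: k => [|k [IH1 IH2]]; split => //; exact: mS.
Unshelve. all: by end_near. Qed.

Let cos_lipschitz (x y : R) : `|cos x - cos y| <= `|x - y|.
Proof.
have := cos_taylor_le y 1 (x - y).
rewrite subrK /cos_taylor big_ord1 mul0r addr0 expr0 alg_polyC hornerC fact0 !divr1 expr1.
exact.
Qed.

Let cos_mean_close L j (t r : R) : (1 <= j)%N ->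
  `|\int[P]_w cos (t * Y j w + r) - \int[P]_w cos (t * Z L j w + r)| <=
  `|t| * Num.sqrt (2 * C * tail L).
Proof.
move=> j1; have sY := sq_Y j1; have sZ := sq_Z L j1; have sD := square_integrableB sY sZ.
have ic (W : T -> R) : measurable_fun setT W -> P.-integrable setT (EFin \o (fun w => cos (t * W w + r))).
  move=> mW; apply: (@integrable_bounded_mfun _ _ _ _ _ 1); first exact: measurable_cos_comp.
  by move=> w; exact: cos_max.
have iY := ic _ sY.1; have iZ := ic _ sZ.1.
have iN : P.-integrable setT (EFin \o (fun w => `|Y j w - Z L j w|)).
  by apply: integrable_norm; exact: square_integrable_integrable.
rewrite -RintegralB //.
apply: (le_trans (le_normr_Rintegral measurableT _)); first exact: integrableBR.
apply: (@le_trans _ _ (\int[P]_w (`|t| * `|Y j w - Z L j w|))).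
  apply: le_Rintegral => //.
  - by apply: integrable_norm; exact: integrableBR.
  - exact: integrableZlR.
  - move=> w _; apply: (le_trans (cos_lipschitz _ _)).
    by rewrite -normrM le_eqVlt; apply/orP; left; apply/eqP; congr `|_|; ring.
rewrite RintegralZl // ler_wpM2l //; apply: (le_trans (mean_norm_le sD)).
by rewrite ler_wsqrtr //; exact: Y_Z_close.
Qed.

(** For fixed L the moments of Z_L converge; Z_L is close to Y uniformly in [j], and
    the limit laws depend continuously on their variances. *)
Let cos_mean_Y_cvg (t r : R) :
  (fun j => \int[P]_w cos (t * Y j w + r)) @ \oo --> \int[normal_law 0 sigma2]_x cos (t * x + r).
Proof.
have nc := @normal_cos_mean_cvg R v sigma2 t r v_ge0 limit_variance_ge0 limit_variance_cvg.
pose q L := `|t| * Num.sqrt (2 * C * tail L) +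
  `|\int[normal_law 0 sigma2]_x cos (t * x + r) - \int[normal_law 0 (v L)]_x cos (t * x + r)|.
have q0 : q @ \oo --> (0 : R).
  apply: cvg_add0.
    apply: cvg_scale0; rewrite -[X in _ --> X](@sqrtr0 R).
    apply: (cvg_comp (fun L => 2 * C * tail L) Num.sqrt); last exact: sqrt_continuous.
    exact: (@cvg_scale0 _ (2 * C) _ tail_cvg).
  exact: (cvg_dist0 nc).
apply: (cvg_of_approximants (A := fun L j => \int[P]_w cos (t * Z L j w + r))
  (r := fun L _ => q L) (A' := fun L => \int[normal_law 0 (v L)]_x cos (t * x + r)) (r' := q)).
- near=> j => L; rewrite (le_trans (cos_mean_close L _ _ _)) ?lerDl //.
  by near: j; exact: nbhs_infty_ge.
- move=> L; apply: (@cos_mean_cvg R d T P (Z L) (v L) t r (v_ge0 L) _ (@Z_moment_cvg L)).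
  near=> j; have j1 : (1 <= j)%N by near: j; exact: nbhs_infty_ge.
  exact: (normalized_sum_all_moments (Xgauss j1)).
- by move=> L; exact: cvg_cst.
- by move=> L; rewrite lerDr mulr_ge0.
- exact: q0.
Unshelve. all: by end_near. Qed.

Lemma normalized_sum_cvg_in_distribution (mh : measurable_fun setT h) :
  cvg_in_distribution P Y (normal_law 0 sigma2).
Proof.
apply: (@cvg_in_distribution_of_cos _ _ _ _ _ _ (sigma2 + 1)).
- move=> j; rewrite /Y /normalized_sum; apply: measurable_funM => //.
  apply: measurable_sum => i; apply: (measurableT_comp mh).
  exact: measurable_funP.
- near=> j; have j1 : (1 <= j)%N by near: j; exact: nbhs_infty_ge.
  split; first by case: (sq_Y j1).
  near: j; have := mean_sqr_cvg_limit_variance => /cvgrPdist_le/(_ 1 ltr01).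
  apply: filterS => j; rewrite ler_norml => /andP[]; lra.
- exact: (integrable_normal_law_pow _ _ limit_variance_ge0).
- rewrite (normal_law_moment 1 limit_variance_ge0) normal_law_moment0 !mulr1.
  by rewrite lerDl.
- exact: cos_mean_Y_cvg.
Unshelve. all: by end_near. Qed.

Lemma variance_normalized_sum_cvg :
  ('V_P[Y j])%E @[j --> \oo] --> sigma2%:E.
Proof.
have h1 : (fun j => (\int[P]_w (Y j w ^+ 2))%:E) @ \oo --> sigma2%:E.
  by apply: cvg_EFin; [exact: nearW|exact: mean_sqr_cvg_limit_variance].
apply: cvg_trans h1; apply: near_eq_cvg; near=> j.
have j1 : (1 <= j)%N by near: j; exact: nbhs_infty_ge.
have [mY iY] := sq_Y j1.
have h00 : \int[gam]_x h x = 0.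
  transitivity (hermite_coef h 0) => //.
  by apply: eq_Rintegral => x _; rewrite hermite0 -polyC1 hornerC mulr1.
have EY : ('E_P[Y j] = 0)%E.
  have e := mean_normalized_sum (Xgauss j1) (Xstd j1) (n j) sh h00.
  rewrite expectation.unlock; transitivity (\int[P]_w Y j w)%:E; last by rewrite e.
  rewrite /Rintegral fineK //; apply: integrable_fin_num => //.
  exact: square_integrable_integrable (sq_Y j1).
rewrite /variance covariance_centered // /Rintegral fineK //; last exact: integrable_fin_num.
Unshelve. all: by end_near. Qed.

Lemma limit_variance_series : (fun L => \sum_(l < L) c l.+1 ^+ 2 / l.+1`!%:R * V l) @ \oo --> sigma2.
Proof. exact: limit_variance_cvg. Qed.

End clt.

(** * The two classes of functions *)

Section function_class.
Context {R : realType}.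
Local Notation RT := (measurableTypeR R).
Local Notation gam := (@normal_prob R 0 1).

Lemma bounded_or_hermite_dense (h : R -> R) : measurable_fun setT h ->
  (exists M : R, forall x, `|h x| <= M) \/
  (exists (N : nat) (a : nat -> R), forall x, h x = \sum_(l < N) a l * (hermite R l).[x]) ->
  square_integrable gam (h : RT -> R) /\
  forall e : R, 0 < e -> exists p : {poly R}, \int[gam]_x ((h x - p.[x]) ^+ 2) <= e.
Proof.
move=> mh [[M hM]|[N [a ha]]].
  split; first by apply: (@square_integrable_bounded _ _ _ _ _ M).
  by move=> e e0; exact: gauss_poly_approx hM e0.
pose p : {poly R} := \sum_(l < N) a l *: hermite R l.
have -> : h = (fun x => p.[x]).
  by apply/funext => x; rewrite ha horner_sum; apply: eq_bigr => l _; rewrite hornerZ.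
split; first exact: square_integrable_poly.
move=> e e0; exists p; rewrite (_ : \int[gam]_x _ = 0) ?ltW //.
rewrite (_ : (fun x : RT => (p.[x] - p.[x]) ^+ 2) = fun=> 0); first exact: Rintegral_prob_cst.
by apply/funext => x; rewrite subrr expr0n.
Qed.

End function_class.

Lemma sum_from_rank (R : realType) (z : nat -> R) (tau N : nat) : (1 <= tau)%N ->
  (forall l, (l < tau)%N -> z l = 0) ->
  \sum_(tau <= l < N.+1) z l = \sum_(l < N) z l.+1.
Proof.
move=> tau1 z0; transitivity (\sum_(1 <= l < N.+1) z l); last by rewrite big_add1 big_mkord.
have zero m : (m <= tau)%N -> \sum_(1 <= l < m) z l = 0.
  move=> mt; rewrite big1_seq // => l; rewrite mem_index_iota => /andP[_ /andP[_ lm]].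
  by rewrite z0 // (leq_trans lm).
have [tN|/ltnW Nt] := leqP tau N.+1.
  by rewrite (big_cat_nat tau1 tN) /= zero // add0r.
by rewrite zero // big_geq.
Qed.

Theorem theorem4 (R : realType) (d : measure_display) (T : measurableType d)
    (P : probability T R)
    (X : nat -> nat -> {RV P >-> R})
    (f : nat -> R -> R) (rho : nat -> nat -> R)
    (u : nat -> R) (ginf : R -> R)
    (h : R -> R) (tau : nat) (n : nat -> nat)
    (Xgauss : forall j, (1 <= j)%N -> gaussian_process (X j))
    (Xstat : forall j, (1 <= j)%N -> stationary (X j))
    (Xstd : forall j, (1 <= j)%N -> standard (X j))
    (Xrho : forall j, (1 <= j)%N -> autocorrelation (X j) (rho j))
    (Xf : forall j, (1 <= j)%N -> spectral_density (rho j) (f j))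
    (u_noninc : forall j k, (1 <= j)%N -> (j <= k)%N -> u k <= u j)
    (u_to0 : u @ \oo --> (0 : R))
    (f_close : forall j, (1 <= j)%N ->
       (ereal_sup [set (`|f j x - ginf x|)%:E | x in [set` `](- pi)%R, pi[%R]]
          <= (u j)%:E)%E)
    (g_per : periodic ginf (pi *+ 2))
    (g_bnd : exists M : R, forall x, x \in `]-pi, pi[ -> `|ginf x| <= M)
    (g_cont0 : {for 0, continuous ginf})
    (h_meas : measurable_fun setT h)
    (tau_ge1 : (1 <= tau)%N)
    (h_rank : hermite_rank h tau)
    (h_class : (exists M : R, forall x, `|h x| <= M) \/
       (exists (N : nat) (a : nat -> R),
          forall x, h x = \sum_(l < N) a l * (hermite R l).[x]))
    (n_infty : n @ \oo --> \oo) :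
  exists sigma2 : R,
    [/\ ('V_P[normalized_sum h (fun i => X j i) (n j)])%E @[j --> \oo] --> sigma2%:E,
        (pi *+ 2) * \sum_(tau <= l < L)
           (hermite_coef h l ^+ 2 / l`!%:R * selfconv ginf l 0)
          @[L --> \oo] --> sigma2 &
        cvg_in_distribution P (fun j => normalized_sum h (fun i => X j i) (n j))
          (normal_law 0 sigma2)].
Proof.
have [sh dense] := bounded_or_hermite_dense h_meas h_class.
have h0 : hermite_coef h 0 = 0 by case: h_rank => _; apply.
have rho1 j k : (1 <= j)%N -> `|rho j k| <= 1.
  by move=> j1; exact: (autocorrelation_le1 (Xgauss j j1) (Xstat j j1) (Xstd j j1) (Xrho j j1) k).
have K0 := spectral_bound_gt0 f_close g_per g_bnd.
have rho_bounded j (j1 : (1 <= j)%N) :=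
  @rho_form_bounded _ _ _ _ _ Xf u_noninc f_close g_per g_bnd j (n j) j1.
have V_cvg l := @power_mean_cvg _ _ _ _ _ Xf u_noninc u_to0 f_close g_per g_bnd g_cont0 rho1 n l n_infty.
have pm_bounded j l (j1 : (1 <= j)%N) :=
  power_mean_bounded Xf u_noninc f_close g_per g_bnd rho1 (n j) l j1.
exists (limit_variance h (fun l => pi *+ 2 * selfconv ginf l.+1 0)); split.
- exact: (variance_normalized_sum_cvg Xgauss Xstat Xstd Xrho V_cvg pm_bounded sh dense h0).
- rewrite -(cvg_shiftS (fun L => pi *+ 2 * \sum_(tau <= l < L) _)).
  have e : (fun L => pi *+ 2 * \sum_(tau <= l < L.+1)
      (hermite_coef h l ^+ 2 / l`!%:R * selfconv ginf l 0)) =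
    (fun L => \sum_(l < L) hermite_coef h l.+1 ^+ 2 / l.+1`!%:R * (pi *+ 2 * selfconv ginf l.+1 0)).
    apply/funext => L; rewrite (@sum_from_rank _ (fun l => hermite_coef h l ^+ 2 / l`!%:R * selfconv ginf l 0)) //.
      by rewrite mulr_sumr; apply: eq_bigr => l _; rewrite mulrCA.
    by move=> l lt; case: h_rank => _ ->; rewrite // expr0n !mul0r.
  rewrite e; exact: (limit_variance_series V_cvg pm_bounded sh dense h0).
- exact: (normalized_sum_cvg_in_distribution Xgauss Xstat Xstd Xrho n_infty K0 rho_bounded V_cvg
    pm_bounded sh dense h0 h_meas).
Qed.
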